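(* Let $\beta>0$. For every integer $m\ge2$, let $\mathbf P_{\beta,m}=(\mathsf{Comp}_m)_*\mathsf{Sine}_\beta$, where $\mathsf{Comp}_m\gamma$ is the image of the configuration $\gamma$ under $x\mapsto x/m$. Then $\mathbf P_{\beta,m}$ is a stationary point process supported on simple configurations, satisfies the canonical $\beta$-DLR equations, has intensity $m$, is different from $\mathsf{Sine}_\beta$, and satisfies $\mathcal W^{\mathrm{div}}(\mathbf P_{\beta,m})=+\infty$. Moreover, the vacuum law $\delta_\varnothing$ (the point mass at the empty configuration) is another stationary solution of the canonical $\beta$-DLR equations, for every $\beta>0$, and $\mathcal W^{\mathrm{div}}(\delta_\varnothing)=+\infty$.
   Context: **Configurations.** $\mathrm{Conf}(\mathbb R)$ is the space of locally finite nonnegative-integer-valued Radon measures on $\mathbb R$ with the vague topology and its Borel $\sigma$-field. For Borel $A\subset\mathbb R$, $\gamma_A$ is the restriction of $\gamma$ to $A$, $\mathrm{Conf}(A)=\{\gamma:\gamma(A^c)=0\}$, and $\mathrm{Conf}_n(A)=\{\eta\in\mathrm{Conf}(A):\eta(A)=n\}$. $\gamma$ is simple if $\gamma(\{x\})\le1$ for all $x$. $(\theta_t\gamma)(A)=\gamma(A+t)$. A point process is a Borel probability measure $\mathbf P$ on $\mathrm{Conf}(\mathbb R)$, stationary if $\mathbf P\circ\theta_t^{-1}=\mathbf P$ for all $t$; $\mathsf C(\gamma)=\gamma$ is the canonical configuration; $\mathbf P$ has intensity $\lambda$ if $\mathbb E_{\mathbf P}[\mathsf C(A)]=\lambda|A|$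 for bounded Borel $A$. $\mathsf g(x)=-\log|x|$ for $x\ne0$, $\mathsf g(0)=0$; $\Delta=\{(x,x)\}$. For bounded Borel $\Lambda$ with $|\Lambda|>0$, $\mathrm{Bin}_{n,\Lambda}$ is the law of $\sum_{j=1}^n\delta_{U_j}$ with $U_j$ i.i.d. uniform on $\Lambda$; $\mathrm{Bin}_{0,\Lambda}=\delta_\varnothing$. **The process $\mathsf{Sine}_\beta$.** If $(\theta_1,\dots,\theta_N)\in[-\pi,\pi)^N$ has density proportional to $\prod_{j<k}|e^{i\theta_j}-e^{i\theta_k}|^\beta$, then $\mathsf{Sine}_\beta$ is the weak limit (in law on $\mathrm{Conf}(\mathbb R)$, vague topology) of $\sum_{j=1}^N\delta_{N\theta_j/(2\pi)}$ as $N\to\infty$. Known facts: $\mathsf{Sine}_\beta$ is stationary of intensity one, satisfies the canonical $\beta$-DLR equations below, and $\mathcal W^{\mathrm{div}}(\mathsf{Sine}_\beta)<\infty$. **Canonical $\beta$-DLR equations.** For integers $p\ge1$ put $\Lambda_p=[-p/2,p/2]$. Let $\Lambda$ be bounded Borel with $|\Lambda|>0$, $\gamma\in\mathrm{Conf}(\mathbb R)$, $n=\gamma(\Lambda)$, $\eta\in\mathrm{Conf}_n(\Lambda)$. Put $\mathsf H_\Lambda(\eta)=\frac12\iint_{\Lambda^2\setminus\Delta}\mathsf g(x-y)\,d\eta(x)d\eta(y)$ if $\eta$ is simple and $+\infty$ otherwise, and, when $\Lambda\subset\Lambda_p$, $\mathsf M_{\Lambda,\Lambda_p}(\eta,\gamma)=\iint_{\Lambda\times(\Lambda_p\setminus\Lambda)}\mathsf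 g(x-y)\,d(\eta-\gamma_\Lambda)(x)\,d\gamma(y)$. $\gamma$ is $(\beta,\Lambda)$-admissible if there is a finite function $\mathsf M_{\Lambda,\mathbb R}(\cdot,\gamma)$ on $\mathrm{Conf}_n(\Lambda)$ with $\lim_{p\to\infty,\,p\in\mathbb N}\sup_{\eta\in\mathrm{Conf}_n(\Lambda)}|\mathsf M_{\Lambda,\Lambda_p}(\eta,\gamma)-\mathsf M_{\Lambda,\mathbb R}(\eta,\gamma)|=0$ and $0<Z^\beta_{\Lambda,\mathbb R}(\gamma):=\int e^{-\beta(\mathsf H_\Lambda(\eta)+\mathsf M_{\Lambda,\mathbb R}(\eta,\gamma))}\mathrm{Bin}_{n,\Lambda}(d\eta)<\infty$. For admissible $\gamma$ put $\mathsf G^\beta_{\Lambda,\mathbb R}(d\eta,\gamma)=Z^\beta_{\Lambda,\mathbb R}(\gamma)^{-1}e^{-\beta(\mathsf H_\Lambda(\eta)+\mathsf M_{\Lambda,\mathbb R}(\eta,\gamma))}\mathrm{Bin}_{n,\Lambda}(d\eta)$. Let $\mathscr F_A=\sigma\{\gamma\mapsto\gamma(B):B\subset A\text{ bounded Borel}\}$ and $\mathscr F_\Lambda^{\mathrm{can}}=\mathscr F_{\Lambda^c}\vee\sigma(\gamma\mapsto\gamma(\Lambda))$. $\mathbf P$ satisfies the canonical $\beta$-DLR equations if for every bounded Borel $\Lambda$ with $|\Lambda|>0$ there is a universally measurable set of full $\mathbf P$-measure consisting of $(\beta,\Lambda)$-admissible configurations such that the kernel $\mathsf G^\beta_{\Lambda,\mathbb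 R}$, defined on that set, has a probability-kernel extension, measurable for the $\mathbf P$-completion of $\mathscr F^{\mathrm{can}}_\Lambda$ and denoted the same way, with $\int F\,d\mathbf P=\int\int_{\mathrm{Conf}(\Lambda)}F(\eta+\gamma_{\Lambda^c})\,\mathsf G^\beta_{\Lambda,\mathbb R}(d\eta,\gamma)\,\mathbf P(d\gamma)$ for every bounded Borel $F$. **Electric energy.** Fix $1<q<2$. A field $E\in L^{q}_{\mathrm{loc}}(\mathbb R^2;\mathbb R^2)$ is divergence-compatible with $\gamma$ if $-\operatorname{div}E=2\pi(\gamma-\mathrm{Leb})$ in the sense of distributions on $\mathbb R^2$, where $\gamma$ and $\mathrm{Leb}$ (Lebesgue measure on $\mathbb R$) are embedded in $\mathbb R\times\{0\}$. For $\varepsilon\in(0,1)$ put $f_\varepsilon(X)=(\log(\varepsilon/|X|))^+$ and $E_\varepsilon=E-\int_{\mathbb R}\nabla f_\varepsilon(\cdot-(x,0))\,d\gamma(x)$. Define $\widetilde{\mathcal W}^{\mathrm{div}}(\gamma)=\inf_{E}\lim_{\varepsilon\downarrow0}\limsup_{R\to\infty}\big(\frac1{2R}\frac1{2\pi}\int_{[-R,R]\times\mathbb R}|E_\varepsilon|^2\,dX+\log\varepsilon\big)$, the infimum over all $E$ divergence-compatible with $\gamma$ ($+\infty$ if there is none); it is bounded below by a universal constant. For stationary $\mathbf P$, $\mathcal W^{\mathrm{div}}(\mathbf P)=\mathbb E_{\mathbf P}[\widetilde{\mathcal W}^{\mathrm{div}}(\mathsf C)]$. *)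

(* Defs.v *)
From HB Require Import structures.
From mathcomp Require Import all_boot all_order all_algebra.
From mathcomp Require Import all_classical all_reals all_analysis.
From mathcomp Require Import measurable_realfun.

Set Implicit Arguments.
Unset Strict Implicit.
Unset Printing Implicit Defensive.

Import Order.TTheory GRing.Theory Num.Theory.
Import numFieldNormedType.Exports.

Local Open Scope classical_set_scope.
Local Open Scope ring_scope.

Section configurations.
Context (R : realType).

(** Two configurations that agree on Borel sets need not be equal as records,
    since a library measure also takes values on non-measurable sets.  All the
    notions below only depend on the values on Borel sets. *)
Record conf := Conf {
  conf_measure :> {measure set (measurableTypeR R) -> \bar R} ;
  conf_nat : forall B : set (measurableTypeR R),
    measurable B -> bounded_set (B : set R) ->
    exists n : nat, conf_measure B = n%:R%:E }.

Lemma conf0_nat (B : set (measurableTypeR R)) :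
  measurable B -> bounded_set (B : set R) ->
  exists n : nat, @mzero _ (measurableTypeR R) R B = n%:R%:E.
Proof. by exists 0%N. Qed.

Definition conf0 : conf := Conf conf0_nat.

HB.instance Definition _ := gen_eqMixin conf.
HB.instance Definition _ := gen_choiceMixin conf.
HB.instance Definition _ := isPointed.Build conf conf0.

Lemma conf_add_nat (g h : conf) (B : set (measurableTypeR R)) :
  measurable B -> bounded_set (B : set R) ->
  exists n : nat, measure_add g h B = n%:R%:E.
Proof.
move=> mB bB; have [k gk] := conf_nat g mB bB; have [l hl] := conf_nat h mB bB.
by exists (k + l)%N; rewrite measure_addE gk hl natrD EFinD.
Qed.

Definition conf_add (g h : conf) : conf := Conf (@conf_add_nat g h).

Lemma conf_restr_nat (g : conf) (A : set (measurableTypeR R))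
    (mA : measurable A) (B : set (measurableTypeR R)) :
  measurable B -> bounded_set (B : set R) ->
  exists n : nat, mrestr g mA B = n%:R%:E.
Proof.
move=> mB bB; apply: conf_nat; first exact: measurableI.
by apply: sub_boundedr bB => X GX x [Bx _]; exact: GX.
Qed.

Definition conf_restr (g : conf) (A : set (measurableTypeR R))
  (mA : measurable A) : conf := Conf (@conf_restr_nat g A mA).

Lemma conf_dirac_nat (x : R) (B : set (measurableTypeR R)) :
  measurable B -> bounded_set (B : set R) ->
  exists n : nat, @dirac _ (measurableTypeR R) x R B = n%:R%:E.
Proof. by exists (nat_of_bool (x \in B)); rewrite diracE. Qed.

Definition conf_dirac (x : R) : conf := Conf (@conf_dirac_nat x).

Definition conf_of_seq (s : seq R) : conf :=
  foldr (fun x g => conf_add (conf_dirac x) g) conf0 s.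

Definition conf_in (A : set R) : set conf := [set g | g (~` A) = 0%E].

Definition conf_n (A : set R) (n : nat) : set conf :=
  [set g | conf_in A g /\ g A = n%:R%:E].

Definition npoints (g : conf) (A : set R) : nat := Num.truncn (fine (g A)).

Definition simple_conf (g : conf) : Prop := forall x : R, (g [set x] <= 1)%E.

Definition Cc : Type :=
  {f : R -> R | continuous f /\ exists r, forall x, r < `|x| -> f x = 0}.

(** The initial topology of [vague_eval] is the vague topology. *)
Definition vague_eval (g : conf) : {ptws Cc -> R} :=
  fun f => \int[g]_x sval f x.

HB.instance Definition _ := Topological.copy conf (initial_topology vague_eval).

HB.instance Definition _ :=
  Measurable.copy conf (g_sigma_algebraType (@open conf)).

Lemma vague_eval_continuous (f : Cc) :
  continuous ((fun g => vague_eval g f) : conf -> R).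
Proof.
move=> g; apply: (@continuous_comp _ _ _ (vague_eval : conf -> {ptws Cc -> R})
  (fun h => h f)).
  exact: initial_continuous.
exact: (@proj_continuous {classic Cc} (fun _ => R) f).
Qed.

End configurations.

Section image_configuration.
Context (R : realType).

Section image.
Variables (f : measurableTypeR R -> measurableTypeR R)
  (mf : measurable_fun setT f)
  (bf : forall B : set R, bounded_set B -> bounded_set (f @^-1` B : set R)).

Definition conf_image_measure (g : conf R) (B : set (measurableTypeR R)) :
    \bar R :=
  pushforward g f B.

Lemma conf_image0 (g : conf R) : conf_image_measure g set0 = 0%E.
Proof. by rewrite /conf_image_measure /pushforward preimage_set0 measure0. Qed.

Lemma conf_image_ge0 (g : conf R) B : (0 <= conf_image_measure g B)%E.
Proof. exact: measure_ge0. Qed.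

Lemma conf_image_sigma_additive (g : conf R) :
  semi_sigma_additive (conf_image_measure g).
Proof. exact: measure_semi_sigma_additive. Qed.

HB.instance Definition _ (g : conf R) := isMeasure.Build _ _ _
  (conf_image_measure g) (conf_image0 g) (conf_image_ge0 g)
  (@conf_image_sigma_additive g).

Lemma conf_image_nat (g : conf R) (B : set (measurableTypeR R)) :
  measurable B -> bounded_set (B : set R) ->
  exists n : nat, conf_image_measure g B = n%:R%:E.
Proof.
move=> mB bB; apply: conf_nat; last exact: bf.
by rewrite -[X in measurable X]setTI; exact: mf.
Qed.

Definition conf_image (g : conf R) : conf R := Conf (@conf_image_nat g).

End image.

Lemma bounded_setP (B : set R) :
  bounded_set B <-> exists M, forall x, B x -> `|x| <= M.
Proof.
split=> [[M [_ bM]]|[M bM]].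
  by exists (M + 1) => x; apply: bM; rewrite ltrDl.
by exists M; split=> [|r Mr x /bM/le_trans]; [exact: num_real|apply; exact: ltW].
Qed.

Lemma measurable_shift (t : R) :
  measurable_fun setT
    ((fun x => x - t) : measurableTypeR R -> measurableTypeR R).
Proof.
have m : measurable_fun setT ((fun x => x - t) : R -> R).
  by apply: measurable_funB.
by move=> mT Y mY; exact: m.
Qed.

Lemma bounded_shift (t : R) (B : set R) :
  bounded_set B -> bounded_set ((fun x => x - t) @^-1` B).
Proof.
move=> /bounded_setP[M bM]; apply/bounded_setP; exists (M + `|t|) => x /= /bM bx.
rewrite /= -(subrK t x) (le_trans (ler_normD _ _)) // lerD2r.
exact: bx.
Qed.

(** [(conf_shift t g) A = g (A + t)]. *)
Definition conf_shift (t : R) : conf R -> conf R :=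
  conf_image (measurable_shift t) (@bounded_shift t).

Lemma measurable_compress (m : nat) :
  measurable_fun setT
    ((fun x => x / m%:R) : measurableTypeR R -> measurableTypeR R).
Proof.
have mf : measurable_fun setT ((fun x => x / m%:R) : R -> R).
  by apply: measurable_funM.
by move=> mT Y mY; exact: mf.
Qed.

Lemma bounded_compress (m : nat) (hm : (1 < m)%N) (B : set R) :
  bounded_set B -> bounded_set ((fun x => x / m%:R) @^-1` B).
Proof.
have m0 : (m%:R : R) != 0 by rewrite pnatr_eq0; case: m hm.
move=> /bounded_setP[M bM]; apply/bounded_setP; exists (M * m%:R) => x /bM bx.
by rewrite -(divfK m0 x) normrM normr_nat ler_wpM2r.
Qed.

Definition conf_compress (m : nat) (hm : (1 < m)%N) : conf R -> conf R :=
  conf_image (measurable_compress m) (bounded_compress hm).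

Lemma compress_Cc m (hm : (1 < m)%N) (f : Cc R) :
  continuous (fun x : R => sval f (x / m%:R)) /\
  exists r, forall x : R, r < `|x| -> sval f (x / m%:R) = 0.
Proof.
have m0 : (0 : R) < m%:R by rewrite ltr0n; case: m hm.
case: f => f [/= cf [r rf]]; split.
  by move=> x; apply: continuous_comp; [exact: mulrr_continuous|exact: cf].
exists (r * m%:R) => x rx; apply: rf.
by rewrite normrM normfV normr_nat ltr_pdivlMr.
Qed.

Lemma compressE m (hm : (1 < m)%N) (g : conf R) (f : Cc R) :
  vague_eval (conf_compress hm g) f =
  vague_eval g (exist _ _ (compress_Cc hm f)).
Proof.
have mf : measurable_fun setT (sval f).
  by apply: continuous_measurable_fun; case: (svalP f).
rewrite /vague_eval /Rintegral; apply: (congr1 fine).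
have mF : measurable_fun [set: measurableTypeR R] (EFin \o sval f).
  by move=> mT Y mY; move/measurable_EFinP: mf => mf; exact: mf.
rewrite integralE [RHS]integralE /= /conf_image_measure.
rewrite !(ge0_integral_pushforward (measurable_compress m)) //.
- by rewrite !preimage_setT; congr (_ - _)%E; apply: eq_integral => x _;
    rewrite /= ?funeposE ?funenegE.
- exact: (measurable_funeneg mF).
- exact: (measurable_funepos mF).
Qed.

Lemma continuous_conf_compress m (hm : (1 < m)%N) :
  continuous (conf_compress hm).
Proof.
pose F (g : conf R) : {ptws Cc R -> R} := vague_eval (conf_compress hm g).
suff cF : continuous F.
  apply/continuousP => _ [A oA <-].
  by rewrite -comp_preimage; apply: open_comp => // x _; exact: cF.
move=> g.
have FF0 : Filter (nbhs g) by exact: nbhs_filter.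
have FF : Filter (F x @[x --> g]) by exact: (@fmap_filter _ _ F (nbhs g) FF0).
apply/cvg_sup => f U [/= _ [[V oV <-] /= Vfg]] /filterS; apply.
rewrite /F compressE in Vfg.
have : nbhs g [set h | V (vague_eval h (exist _ _ (compress_Cc hm f)))].
  apply: vague_eval_continuous; exact: open_nbhs_nbhs.
by apply: filterS => h /=; rewrite -compressE.
Qed.

Lemma measurable_conf_compress m (hm : (1 < m)%N) :
  measurable_fun setT (conf_compress hm).
Proof.
apply: (@measurability _ _ _ _ _ _ (@open (conf R))) => //.
move=> _ [B oB <-]; rewrite setTI; apply: sub_sigma_algebra.
by apply: open_comp => // x _; exact: continuous_conf_compress.
Qed.

HB.instance Definition _ m (hm : (1 < m)%N) :=
  isMeasurableFun.Build _ _ _ _ (conf_compress hm) (measurable_conf_compress hm).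

(** The image of [P] under [conf_compress hm]. *)
Definition compressed_law (m : nat) (hm : (1 < m)%N)
  (P : probability (conf R) R) : probability (conf R) R :=
  distribution P (conf_compress hm).

End image_configuration.

Section iid.
Context d (T : measurableType d) (R : realType).

Definition tuple_cons n (x : T * n.-tuple T) : n.+1.-tuple T :=
  [the n.+1.-tuple T of x.1 :: x.2].

Lemma measurable_tuple_cons n : measurable_fun setT (@tuple_cons n).
Proof.
exact: (@measurable_cons _ _ _ _ (fst : T * n.-tuple T -> T) n snd).
Qed.

HB.instance Definition _ n :=
  isMeasurableFun.Build _ _ _ _ (@tuple_cons n) (@measurable_tuple_cons n).

(** The [n]-fold product of [P] with itself. *)
Fixpoint iid (P : probability T R) (n : nat) : probability (n.-tuple T) R :=
  if n is n'.+1 then distribution (P \x iid P n')%E (@tuple_cons n')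
  else \d_([tuple] : 0.-tuple T).

End iid.

Section gibbs.
Context (R : realType).
Local Notation mu := (@lebesgue_measure R).
Local Notation RB := (measurableTypeR R).

Definition uniform_on (A : set RB) (mA : measurable A) : probability RB R :=
  mnormalize (mrestr mu mA) (\d_(0 : RB)).

(** [\sum_j dirac (U_j)] with [U_j] i.i.d. uniform on [A]. *)
Definition Bin (n : nat) (A : set RB) (mA : measurable A) :
    set (conf R) -> \bar R :=
  pushforward (iid (uniform_on mA) n) (fun t : n.-tuple RB => conf_of_seq t).

Definition log_kernel (x : R) : R := if x == 0 then 0 else - ln `|x|.

Definition diagonal_set : set (RB * RB) := [set z | z.1 = z.2].

Definition energy_H (A : set RB) (h : conf R) : \bar R :=
  if `[< simple_conf h >] then
    (2^-1%:E * \int[h \x h]_(z in (A `*` A) `\` diagonal_set)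
      (log_kernel ((z.1 : R) - z.2))%:E)%E
  else +oo%E.

Definition window (p : nat) : set R := `[- (p%:R / 2), p%:R / 2].

Definition pair_interaction (A : set RB) (p : nat) (h g : conf R) : R :=
  fine (\int[h \x g]_(z in A `*` (window p `\` A))
          (log_kernel ((z.1 : R) - z.2))%:E)%E.

(** Integrating [h - conf_restr g mA] against [g] splits into two finite sums. *)
Definition move_cost (A : set RB) (mA : measurable A) (p : nat)
    (h g : conf R) : R :=
  pair_interaction A p h g - pair_interaction A p (conf_restr g mA) g.

(** Only the values of [M] on [conf_n A (npoints g A)] matter, here and in
    [partition_function] and [gibbs]. *)
Definition is_move_cost_limit (A : set RB) (mA : measurable A) (g : conf R)
    (M : conf R -> R) : Prop :=
  ereal_sup [set `|move_cost mA p h g - M h|%:E | h in conf_n A (npoints g A)]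
    @[p --> \oo] --> 0%E.

Definition boltzmann (beta : R) (A : set RB) (M : conf R -> R) (h : conf R) :
    \bar R :=
  expeR (- beta%:E * (energy_H A h + (M h)%:E))%E.

Definition partition_function (beta : R) (A : set RB) (mA : measurable A)
    (g : conf R) (M : conf R -> R) : \bar R :=
  (\int[Bin (npoints g A) mA]_(h in conf_n A (npoints g A))
     boltzmann beta A M h)%E.

Definition admissible (beta : R) (A : set RB) (mA : measurable A)
    (g : conf R) : Prop :=
  exists M : conf R -> R, is_move_cost_limit mA g M /\
    (0 < partition_function beta mA g M < +oo)%E.

Definition gibbs (beta : R) (A : set RB) (mA : measurable A)
    (g : conf R) (M : conf R -> R) (C : set (conf R)) : \bar R :=
  ((fine (partition_function beta mA g M))^-1%:E *
   \int[Bin (npoints g A) mA]_(h in C `&` conf_n A (npoints g A))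
     boltzmann beta A M h)%E.

Definition sigma_local (A : set R) : set (set (conf R)) :=
  <<s [set C | exists (B : set RB) (Y : set (\bar R)),
        [/\ measurable B, bounded_set (B : set R), B `<=` A, measurable Y &
            C = (fun g : conf R => g B) @^-1` Y] ] >>.

Definition sigma_can (A : set RB) : set (set (conf R)) :=
  <<s sigma_local (~` A) `|`
      [set (fun g : conf R => g A) @^-1` Y | Y in measurable] >>.

Definition completion (P : probability (conf R) R) (G : set (set (conf R))) :
    set (set (conf R)) :=
  [set C | exists B1 B2, [/\ G B1, G B2, B1 `<=` C, C `<=` B2 &
    P (B2 `\` B1) = 0%E]].

Definition universally_measurable (C : set (conf R)) : Prop :=
  forall Q : probability (conf R) R, completion Q measurable C.

(** The integrand of the outer integral is measurable for the completion of [P];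
    the library integral, defined by simple functions from below on the positive
    and negative parts, then agrees with the integral for the completion. *)
Definition DLR_kernel (beta : R) (P : probability (conf R) R) (A : set RB)
    (mA : measurable A) (U : set (conf R))
    (K : conf R -> probability (conf R) R) : Prop :=
  [/\ (forall g M, U g -> is_move_cost_limit mA g M ->
        forall C, measurable C -> K g C = gibbs beta mA g M C),
      (forall C, measurable C -> forall Y : set (\bar R), measurable Y ->
        completion P (sigma_can A) ((fun g => K g C) @^-1` Y)) &
      (forall F : conf R -> R, measurable_fun setT F ->
        (exists c, forall g, `|F g| <= c) ->
        (\int[P]_g (F g)%:E =
         \int[P]_g \int[K g]_(h in conf_in A)
           (F (conf_add h (conf_restr g (measurableC mA))))%:E)%E)].

Definition canonical_DLR (beta : R) (P : probability (conf R) R) : Prop :=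
  forall (A : set RB) (mA : measurable A), bounded_set (A : set R) ->
  (0 < mu A)%E ->
  exists U : set (conf R),
    [/\ universally_measurable U, {ae P, forall g, U g},
        forall g, U g -> admissible beta mA g &
        exists K : conf R -> probability (conf R) R, DLR_kernel beta P mA U K].

Definition stationary (P : probability (conf R) R) : Prop :=
  forall (t : R) (C : set (conf R)), measurable C ->
    P (conf_shift t @^-1` C) = P C.

Definition has_intensity (lambda : R) (P : probability (conf R) R) : Prop :=
  forall B : set RB, measurable B -> bounded_set (B : set R) ->
    (\int[P]_g g B = lambda%:E * mu B)%E.

Definition vacuum : probability (conf R) R := \d_(conf0 R).

(** Equality on Borel sets; library measures may differ elsewhere. *)
Definition same_law (P Q : probability (conf R) R) : Prop :=
  forall C, measurable C -> P C = Q C.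

End gibbs.

Section sine.
Context (R : realType).
Local Notation RB := (measurableTypeR R).

Definition arc : set RB := `[- pi, pi[%classic.

Lemma measurable_arc : measurable arc.
Proof. exact: measurable_itv. Qed.

(** [|e^{ia} - e^{ib}|] *)
Definition chord (a b : R) : R :=
  Num.sqrt ((cos a - cos b) ^+ 2 + (sin a - sin b) ^+ 2).

Definition circular_weight (beta : R) (N : nat) (t : N.-tuple RB) : R :=
  \prod_(j < N) \prod_(k < N | (j < k)%N) chord (tnth t j) (tnth t k) `^ beta.

(** Normalising Lebesgue measure on [[-pi, pi)^N] to the uniform law does not
    change the law with density proportional to the weight. *)
Definition circular_mass (beta : R) (N : nat) (C : set (N.-tuple RB)) : \bar R :=
  (\int[iid (uniform_on measurable_arc) N]_(t in C)
     (circular_weight beta t)%:E)%E.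

Definition circular_law (beta : R) (N : nat) (C : set (N.-tuple RB)) : \bar R :=
  ((fine (circular_mass beta [set: N.-tuple RB]))^-1%:E * circular_mass beta C)%E.

Definition circular_process (beta : R) (N : nat) : set (conf R) -> \bar R :=
  pushforward (circular_law beta (N := N))
    (fun t => conf_of_seq [seq N%:R * (x : R) / (2 * pi) | x <- t]).

Definition is_Sine (beta : R) (S : probability (conf R) R) : Prop :=
  forall F : conf R -> R, continuous F -> (exists c, forall g, `|F g| <= c) ->
    (\int[circular_process beta N]_g (F g)%:E)%E @[N --> \oo] -->
    (\int[S]_g (F g)%:E)%E.

End sine.

Section electric.
Context (R : realType).
Local Notation mu := (@lebesgue_measure R).
Local Notation RB := (measurableTypeR R).
Local Notation mu2 := (mu \x mu)%E.

Definition partial1 (f : R * R -> R) (X : R * R) : R :=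
  derive1 (fun s => f (s, X.2)) X.1.
Definition partial2 (f : R * R -> R) (X : R * R) : R :=
  derive1 (fun s => f (X.1, s)) X.2.

Fixpoint Ck (k : nat) (f : R * R -> R) : Prop :=
  continuous f /\
  if k is k'.+1 then
    [/\ forall X, derivable (fun s : R => f (s, X.2)) X.1 1,
        forall X, derivable (fun s : R => f (X.1, s)) X.2 1,
        Ck k' (partial1 f) & Ck k' (partial2 f)]
  else True.

Definition norm2 (X : R * R) : R := Num.sqrt (X.1 ^+ 2 + X.2 ^+ 2).

Definition test_function (f : R * R -> R) : Prop :=
  (forall k, Ck k f) /\ exists r, forall X, r < norm2 X -> f X = 0.

Definition Lq_loc (q : R) (E : RB * RB -> RB * RB) : Prop :=
  measurable_fun setT E /\
  forall D : set (R * R), compact D ->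
    (\int[mu2]_(X in D) (norm2 (E X) `^ q)%:E < +oo)%E.

(** [- div E = 2 pi (g - Leb)] as distributions: the derivative is moved to the
    test function, which cancels the minus sign. *)
Definition div_compatible (q : R) (g : conf R) (E : RB * RB -> RB * RB) : Prop :=
  Lq_loc q E /\
  forall f : R * R -> R, test_function f ->
    \int[mu2]_X ((E X).1 * partial1 f X + (E X).2 * partial2 f X) =
    2 * pi * (\int[g]_x f (x, 0) - \int[mu]_x f (x, 0)).

(** The junk value [0] at the origin, where the logarithm is infinite, and the
    junk derivatives at the origin and on the circle of radius [e] only affect
    [truncated_field] on a null set. *)
Definition trunc_log (e : R) (X : R * R) : R := Num.max (ln (e / norm2 X)) 0.

Definition truncated_field (g : conf R) (e : R) (E : RB * RB -> RB * RB)
    (X : RB * RB) : R * R :=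
  ((E X).1 - \int[g]_x partial1 (trunc_log e) ((X.1 : R) - x, X.2 : R),
   (E X).2 - \int[g]_x partial2 (trunc_log e) ((X.1 : R) - x, X.2 : R)).

Definition strip_energy (g : conf R) (E : RB * RB -> RB * RB) (e r : R) : \bar R :=
  (((2 * r)^-1 * (2 * pi)^-1)%R%:E *
     \int[mu2]_(X in `[(- r)%R, r]%classic `*` setT)
       (norm2 (truncated_field g e E X) ^+ 2)%:E
   + (ln e)%:E)%E.

(** A field for which the limit in [e] does not exist in the extended reals
    contributes no value, instead of a default value. *)
Definition Wdiv_conf (q : R) (g : conf R) : \bar R :=
  ereal_inf [set l : \bar R | exists E, div_compatible q g E /\
    limf_esup (strip_energy g E e) (pinfty_nbhs R) @[e --> 0^'+] --> l].

(** As in [DLR_kernel], [Wdiv_conf] need only be measurable for the completion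
    of [P]. *)
Definition Wdiv (q : R) (P : probability (conf R) R) : \bar R :=
  (\int[P]_g Wdiv_conf q g)%E.

End electric.

(* Main.v *)
(** Compression by [m] is an affine change of variables: it adds a constant,
    depending only on the number of points, to the energy and to the move cost,
    so it intertwines the Gibbs kernels of [A] and of its dilation [m A].  It
    multiplies the intensity by [m].  Simplicity holds for every solution of the
    DLR equations, because the Boltzmann factor vanishes on configurations that
    are not simple.

    The energy is infinite because a field with finite energy per unit length
    forces density one.  Test [- div E = 2 pi (g - Leb)] against a bump [f] of
    width [r]: the truncated field contributes [O(sqrt r)] to the flux by
    Cauchy-Schwarz, and the truncation errors contribute [O(1 / r)] times the
    number of points of [g] in a window of size [r].  Divided by [r] both vanish
    along [r = c 2^k] for almost every [g], by first moments.  Hence the means of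
    [g] against dilated bumps converge to the mean of Lebesgue measure.  Under
    [S] this holds almost surely, so under the compressed law the limit is [m]
    times too large; under the vacuum it is [0]. *)

Require Import Defs.
From HB Require Import structures.
From mathcomp Require Import all_boot all_order all_algebra.
From mathcomp Require Import all_classical all_reals all_analysis.
From mathcomp Require Import measurable_realfun ring lra.

Set Implicit Arguments.
Unset Strict Implicit.
Unset Printing Implicit Defensive.

Import Order.TTheory GRing.Theory Num.Theory.
Import numFieldNormedType.Exports.

Local Open Scope classical_set_scope.
Local Open Scope ring_scope.

(** Neither [Wdiv_conf] nor the inner integrals of the DLR equations are known to be Borel, and the
    integral of a non-measurable function is only a lower integral. Integrals are therefore
    transported along compression together with its measurable inverse, and the energy is compared
    with measurable events: it is [+oo] on [subquadratic] configurations outside [unit_density],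
    which is all that an integral against the law requires. A second obstacle is that the Borel sets
    of configurations come from the vague topology; they are recovered from numbers of points in
    grid cells, since each open set is a countable union of events that prescribe finitely many such
    numbers. In the flux estimate, [t <= t ^ 2 / a + a] with a small constant [a] stands in for
    Cauchy-Schwarz: the resulting error is an arbitrarily small multiple of [r], which suffices for
    the density. The scales [c * 2 ^ k] carry a factor [c] so that scale [m * 2 ^ k] of a
    configuration matches scale [2 ^ k] of its compression. *)

(** * Integrals of non-measurable functions *)

Section lower_integral.
Local Open Scope ereal_scope.
Import HBNNSimple.

(* The library integral of [f >= 0] is the supremum of the integrals of the simple
   functions below [f], whether or not [f] is measurable. *)
Section one_space.
Context d (T : measurableType d) (R : realType).
Variable mu : {measure set T -> \bar R}.
Implicit Types (D A : set T) (f g : T -> \bar R).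

Lemma le_lower_integral D f g : (forall x, D x -> 0 <= f x) ->
  (forall x, D x -> f x <= g x) ->
  \int[mu]_(x in D) f x <= \int[mu]_(x in D) g x.
Proof.
move=> f0 fg; rewrite !ge0_integralE//; last first.
  by move=> x Dx; apply: (le_trans (f0 _ Dx)); exact: fg.
apply: ge_ereal_sup => _ [h hf <-]; apply: ereal_sup_ubound.
exists h => // x; apply: (le_trans (hf x)); rewrite /patch.
by case: ifPn => // /[!inE]; exact: fg.
Qed.

Let ge_scale_integral (c : R) D f : (0 < c)%R -> (forall x, D x -> 0 <= f x) ->
  \int[mu]_(x in D) f x <= c^-1%:E * \int[mu]_(x in D) (c%:E * f x).
Proof.
move=> c0 f0; have c0' := ltW c0; rewrite !ge0_integralE//; last first.
  by move=> x Dx; rewrite mule_ge0 ?lee_fin ?f0.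
apply: ge_ereal_sup => _ [h hf <-].
rewrite muleC lee_pdivlMr// muleC -sintegralrM.
apply: ereal_sup_ubound.
exists (scale_nnsfun h c0') => [x|] /=; last first.
  exact: eq_sintegral.
have := hf x; rewrite /patch; case: ifPn => xD hx; last first.
  have -> : h x = 0%R by apply: le_anti; rewrite -lee_fin hx fun_ge0.
  by rewrite mulr0.
by rewrite EFinM lee_pmul// lee_fin ?fun_ge0.
Qed.

(** The one-sided bound [ge_scale_integral], used for [c] and for [c^-1], gives both inequalities,
    so no approximation of [f] by measurable functions enters. *)
Lemma integral_scale (c : R) D f : (0 < c)%R -> (forall x, D x -> 0 <= f x) ->
  \int[mu]_(x in D) (c%:E * f x) = c%:E * \int[mu]_(x in D) f x.
Proof.
move=> c0 f0; apply/eqP; rewrite eq_le; apply/andP; split; last first.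
  by rewrite muleC -lee_pdivlMr// muleC ge_scale_integral.
have := @ge_scale_integral c^-1 D (fun x => c%:E * f x).
rewrite invr_gt0 invrK => /(_ c0 _)/le_trans; apply.
  by move=> x Dx; rewrite mule_ge0 ?f0// lee_fin ltW.
rewrite lee_pmul2l// (_ : (fun x => c^-1%:E * (c%:E * f x)) = f)//.
apply/funext => x; rewrite muleA -EFinM mulVf ?mul1e//; exact: lt0r_neq0.
Qed.

(** The constant [+oo] on the null set [A] dominates [f] and has integral [+oo * 0 = 0]. *)
Lemma integral0_off_null D A f : measurable A -> mu A = 0 ->
  (forall x, D x -> 0 <= f x) -> (forall x, D x -> ~ A x -> f x = 0) ->
  \int[mu]_(x in D) f x = 0.
Proof.
move=> mA muA f0 fA; apply/eqP; rewrite eq_le integral_ge0// andbT.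
have -> : 0 = \int[mu]_(x in A) +oo :> \bar R.
  by rewrite integral_cst// muA mule0.
rewrite (integral_mkcond D) (integral_mkcond A).
apply: le_lower_integral => x _; first exact: erestrict_ge0.
rewrite /patch; case: ifPn => xD; case: ifPn => xA //; rewrite ?leey//.
by rewrite (fA x (set_mem xD))// => /mem_set; exact/negP.
Qed.

Let pos_part_pinfty f A : measurable A -> 0 < mu A ->
  (forall x, A x -> f x = +oo) -> \int[mu]_x f^\+ x = +oo.
Proof.
move=> mA muA fA; apply/eqP; rewrite -leye_eq.
have <- : \int[mu]_(x in A) +oo = +oo :> \bar R by rewrite integral_cst// gt0_mulye.
rewrite (integral_mkcond A); apply: le_lower_integral => x _.
  by apply: erestrict_ge0 => *; exact: leey.
rewrite /patch; case: ifPn => [/set_mem xA|_]; last exact: funepos_ge0.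
by rewrite funeposE fA// max_l// leey.
Qed.

(** Both strict bounds count: if the positive part has infinite integral, the difference is [+oo],
    or [-oo] by the convention for [+oo - +oo] when the negative part is infinite too. *)
Lemma integral_pinfty_null f A : measurable A ->
  (forall x, A x -> f x = +oo) -> -oo < \int[mu]_x f x < +oo -> mu A = 0.
Proof.
move=> mA fA; rewrite integralE => lt_int; apply/eqP; apply: contraTT lt_int.
rewrite -measure_gt0 => muA; rewrite (pos_part_pinfty mA muA fA).
by case: (\int[mu]_x f^\- x) => [r| |] /=; rewrite ?ltxx ?andbF.
Qed.

(** The negative part lives on a null set, so its integral vanishes and no [+oo - +oo] can occur. *)
Lemma integral_pinfty_ae f A : measurable A -> 0 < mu A -> mu (~` A) = 0 ->
  (forall x, A x -> f x = +oo) -> \int[mu]_x f x = +oo.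
Proof.
move=> mA muA muAC fA; rewrite integralE (pos_part_pinfty mA muA fA).
rewrite (@integral0_off_null _ (~` A))// ?sube0//; first exact: measurableC.
by move=> x _ /contrapT Ax; rewrite funenegE fA// max_r// leNye.
Qed.

Lemma le_abse_lower_integral (D : set T) (f : T -> \bar R) g :
  (forall x, D x -> `|f x| <= g x) ->
  `|\int[mu]_(x in D) f x| <= \int[mu]_(x in D) g x.
Proof.
move=> fg; rewrite integralE.
have p0 : 0 <= \int[mu]_(x in D) f^\+ x by exact: integral_ge0.
have n0 : 0 <= \int[mu]_(x in D) f^\- x by exact: integral_ge0.
have lep : \int[mu]_(x in D) f^\+ x <= \int[mu]_(x in D) g x.
  apply: le_lower_integral => // x Dx; apply: le_trans (fg x Dx).
  by rewrite funeposE ge_max abse_ge0 andbT lee_abs.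
have len : \int[mu]_(x in D) f^\- x <= \int[mu]_(x in D) g x.
  apply: le_lower_integral => // x Dx; apply: le_trans (fg x Dx).
  by rewrite funenegE ge_max abse_ge0 andbT -abseN lee_abs.
case: (\int[mu]_(x in D) g x) lep len => [G| |] lep len; last 2 first.
- by rewrite leey.
- by move: (le_trans p0 lep).
move: p0 n0 lep len.
case: (\int[mu]_(x in D) f^\+ x) => [p| |]//.
case: (\int[mu]_(x in D) f^\- x) => [n| |]//.
by rewrite -EFinB abse_EFin !lee_fin ler_norml => p0 n0 pG nG; apply/andP; split; lra.
Qed.

End one_space.

Section image.
Context d1 d2 (T1 : measurableType d1) (T2 : measurableType d2) (R : realType).
Variables (m1 : {measure set T1 -> \bar R}) (m2 : {measure set T2 -> \bar R}).
Variable phi : T1 -> T2.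
Hypothesis mphi : measurable_fun setT phi.
Hypothesis m2E : forall B, measurable B -> m2 B = m1 (phi @^-1` B).

Let nnsfun_comp (h : {nnsfun T2 >-> R}) :
  exists h' : {nnsfun T1 >-> R}, h' = h \o phi :> (T1 -> R).
Proof.
have m : measurable_fun setT (h \o phi) by exact: measurableT_comp.
have fi : finite_set (range (h \o phi)).
  by apply: sub_finite_set (@fimfunP _ _ h) => _ [x _ <-]; exists (phi x).
have p x : (0 <= (h \o phi) x)%R by exact: fun_ge0.
pose mM := @isMeasurableFun.Build _ _ T1 R (h \o phi) m.
pose fM := @FiniteImage.Build T1 R (h \o phi) fi.
pose nM := @isNonNegFun.Build T1 R (h \o phi) p.
pose h' : {nnsfun T1 >-> R} := HB.pack (h \o phi) mM fM nM.
by exists h'.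
Qed.

(** Simple functions pull back along [phi] but do not push forward: for non-measurable [f] this is
    the only inequality that holds in general. *)
Lemma le_integral_image D (f : T2 -> \bar R) : (forall y, D y -> 0 <= f y) ->
  \int[m2]_(y in D) f y <= \int[m1]_(x in phi @^-1` D) f (phi x).
Proof.
move=> f0; rewrite !ge0_integralE//; last by move=> x; exact: f0.
apply: ge_ereal_sup => _ [h hf <-]; apply: ereal_sup_ubound.
have [h' h'E] := nnsfun_comp h.
exists h' => [x|]; first by rewrite h'E; exact: hf.
rewrite /sintegral h'E; apply: eq_fsbigr => r _.
by rewrite m2E//; exact: measurable_funPTI.
Qed.

Lemma integral_image (psi : T2 -> T1) D (f : T2 -> \bar R) :
  cancel phi psi -> cancel psi phi -> measurable_fun setT psi ->
  (forall (D' : set T1) (f' : T1 -> \bar R), (forall x, D' x -> 0 <= f' x) ->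
    \int[m1]_(x in D') f' x <= \int[m2]_(y in psi @^-1` D') f' (psi y)) ->
  \int[m2]_(y in D) f y = \int[m1]_(x in phi @^-1` D) f (phi x).
Proof.
move=> phiK psiK mpsi le_inv.
have ge0E (g : T2 -> \bar R) : (forall y, 0 <= g y) ->
    \int[m2]_(y in D) g y = \int[m1]_(x in phi @^-1` D) g (phi x).
  move=> g0; apply/eqP; rewrite eq_le le_integral_image//= (le_trans (le_inv _ _ _))//.
  rewrite -comp_preimage (_ : phi \o psi = id) ?preimage_id//; last exact/funext.
  by under eq_integral do rewrite psiK.
rewrite integralE [RHS]integralE !ge0E//; congr (_ - _); apply: eq_integral => x _.
  by rewrite !funeposE.
by rewrite !funenegE.
Qed.

End image.

(** Pulling back along the measurable inverse [psi] supplies the missing inequality. *)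
Lemma integral_image_bij d1 d2 (T1 : measurableType d1) (T2 : measurableType d2)
    (R : realType) (m1 : {measure set T1 -> \bar R})
    (m2 : {measure set T2 -> \bar R}) (phi : T1 -> T2) (psi : T2 -> T1) D
    (f : T2 -> \bar R) :
  measurable_fun setT phi -> measurable_fun setT psi ->
  cancel phi psi -> cancel psi phi ->
  (forall B, measurable B -> m2 B = m1 (phi @^-1` B)) ->
  \int[m2]_(y in D) f y = \int[m1]_(x in phi @^-1` D) f (phi x).
Proof.
move=> mphi mpsi phiK psiK m2E; apply: (@integral_image _ _ _ _ _ m1 m2 phi mphi m2E psi D f) => //.
move=> D' f' f'0.
have m1E B : measurable B -> m1 B = m2 (psi @^-1` B).
  move=> mB; rewrite m2E; last by rewrite -[X in measurable X]setTI; exact: mpsi.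
  by rewrite -comp_preimage (_ : psi \o phi = id) ?preimage_id//; exact/funext.
exact: (le_integral_image mpsi m1E f'0).
Qed.

Definition image_measure d1 d2 (T1 : measurableType d1) (T2 : measurableType d2)
    (R : realFieldType) (mu : {measure set T1 -> \bar R}) (phi : T1 -> T2)
    (mphi : measurable_fun setT phi) : {measure set T2 -> \bar R} :=
  measure_function_pushforward__canonical__measure_function_Measure mu mphi.

End lower_integral.

(** * The Borel structure of the space of configurations *)

Section configuration_evaluations.
Context (R : realType).
Local Notation RB := (measurableTypeR R).
Implicit Types (g h : conf R).

(** The records carry values on non-measurable sets as well, hence the quantification over every
    [B]; image configurations are given by preimages on all sets, which makes it checkable. *)
Lemma conf_eq g h : (forall B, g B = h B) -> g = h.
Proof.
case: g h => [m p] [m' p'] /= /funext/eq_measure mm'.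
by rewrite -mm' in p' *; congr Conf; exact: Prop_irrelevance.
Qed.

Lemma conf_fin_num g (B : set RB) : measurable B -> bounded_set (B : set R) ->
  g B \is a fin_num.
Proof. by move=> mB bB; have [n ->] := conf_nat g mB bB. Qed.

Lemma bounded_itv (a b : bool) (x y : R) :
  bounded_set [set` Interval (BSide a x) (BSide b y)].
Proof.
apply/bounded_setP; exists (`|x| + `|y|) => z /= /andP[xz zy].
have {}xz : x <= z by move: xz; case: a => // /ltW.
have {}zy : z <= y by move: zy; case: b => // /ltW.
rewrite ler_norml; have := ler_norm y; have := ler_norm (- x).
by rewrite normrN => *; apply/andP; split; have := normr_ge0 x; have := normr_ge0 y; lra.
Qed.

Lemma sub_bounded (A B : set R) : A `<=` B -> bounded_set B -> bounded_set A.
Proof.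
by move=> AB /bounded_setP[M BM]; apply/bounded_setP; exists M => x /AB; exact: BM.
Qed.

Lemma measurable_vague_eval (f : Cc R) :
  measurable_fun setT (fun g : conf R => vague_eval g f).
Proof.
apply: (measurability _ (RGenOpens.measurableE R)) => _ [B oB <-].
rewrite setTI; apply: sub_sigma_algebra.
apply: open_comp => [x _|]; [exact: vague_eval_continuous|].
by case: oB => a [b ->]; exact: interval_open.
Qed.

(** A trapezoid with slopes [n] and [- n]: a continuous function of compact support that increases
    with [n] to the indicator of []a, b[]. *)
Definition tent (n : nat) (a b x : R) : R :=
  Num.max 0 (Num.min 1 (n%:R * Num.min (x - a) (b - x))).

Lemma tent_continuous n a b : continuous (tent n a b).
Proof.
have cmin : continuous (fun x => Num.min (x - a) (b - x)).
  move=> x; apply: (@continuous_min _ _ (fun x => x - a) (fun x => b - x)).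
  - by apply: cvgB; [exact: cvg_id|exact: cvg_cst].
  - by apply: cvgB; [exact: cvg_cst|exact: cvg_id].
move=> x; apply: (@continuous_max _ _ (cst 0) (fun x => Num.min 1 _)).
  exact: cvg_cst.
apply: (@continuous_min _ _ (cst 1) (fun x => n%:R * _)); first exact: cvg_cst.
by apply: cvgM; [exact: cvg_cst|exact: cmin].
Qed.

Lemma tent_out n a b x : ~ (a < x < b) -> tent n a b x = 0.
Proof.
move=> axb; rewrite /tent max_l// ge_min mulr_ge0_le0 ?orbT// ge_min !subr_le0.
by apply: contrapT => /negP; rewrite negb_or -!ltNge.
Qed.

Lemma tent_Cc n a b : continuous (tent n a b) /\
  exists r, forall x : R, r < `|x| -> tent n a b x = 0.
Proof.
split; first exact: tent_continuous.
have /bounded_setP[M bM] := @bounded_itv true false a b.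
exists M => x Mx; apply: tent_out => /andP[/ltW ax /ltW xb].
have := bM x; rewrite /= in_itv/= ax xb => /(_ isT).
by rewrite leNgt Mx.
Qed.

Lemma conf_itvoo_fin g (a b : R) : g (`]a, b[%classic : set RB) \is a fin_num.
Proof. by apply: conf_fin_num; [exact: measurable_itv|exact: bounded_itv]. Qed.

Lemma measurable_tent n a b : measurable_fun [set: RB] (tent n a b).
Proof.
have m : measurable_fun [set: R] (tent n a b).
  by apply: continuous_measurable_fun; exact: tent_continuous.
by move=> mT Y mY; exact: m.
Qed.

Lemma tent_ge0 n a b x : 0 <= tent n a b x.
Proof. by rewrite le_max lexx. Qed.

Lemma tent_le n a b x : tent n a b x <= \1_(`]a, b[%classic) x.
Proof.
rewrite indicE; have [xab|xab] := boolP (x \in `]a, b[%classic).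
  by rewrite ge_max ler01 ge_min lexx.
by rewrite tent_out// => axb; move: xab; rewrite notin_setE /= in_itv/= axb.
Qed.

Lemma EFin_vague_eval_tent g n a b :
  (vague_eval g (exist _ _ (tent_Cc n a b)))%:E = (\int[g]_x (tent n a b x)%:E)%E.
Proof.
rewrite /vague_eval/= /Rintegral fineK// ge0_fin_numE; last first.
  by apply: integral_ge0 => x _; rewrite lee_fin tent_ge0.
apply: (@le_lt_trans _ _ (\int[g]_x (\1_(`]a, b[%classic) x)%:E)%E).
  by apply: le_lower_integral => x _; rewrite lee_fin ?tent_ge0 ?tent_le.
rewrite integral_indic ?setIT//.
by rewrite -ge0_fin_numE ?conf_itvoo_fin.
Qed.

Lemma tent_cvg a b x : tent n a b x @[n --> \oo] --> (\1_(`]a, b[%classic) x : R).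
Proof.
rewrite indicE; have [xab|xab] := boolP (x \in `]a, b[%classic); last first.
  rewrite (_ : (fun n => tent n a b x) = cst 0); first exact: cvg_cst.
  apply/funext => n; rewrite tent_out// => axb.
  by move: xab; rewrite notin_setE /= in_itv/= axb.
apply: cvg_near_cst.
move: xab; rewrite inE/= in_itv/= => /andP[ax xb].
pose d := Num.min (x - a) (b - x).
have d0 : 0 < d by rewrite lt_min !subr_gt0 ax.
exists (Num.truncn d^-1).+1 => //= n dn; apply/eqP.
rewrite /tent -/d min_l ?max_r//.
rewrite -ler_pdivrMr// div1r; apply: le_trans (ltW (truncnS_gt _)) _.
by rewrite ler_nat.
Qed.

Lemma measurable_eval_itvoo (a b : R) :
  measurable_fun setT (fun g : conf R => g (`]a, b[%classic : set RB)).
Proof.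
apply: (emeasurable_fun_cvg
  (fun n g => (vague_eval g (exist _ _ (tent_Cc n a b)))%:E)) => [n|g _].
  by apply/measurable_EFinP; exact: measurable_vague_eval.
under eq_fun do rewrite EFin_vague_eval_tent.
rewrite (_ : g _ = \int[g]_x (\1_(`]a, b[%classic) x)%:E)%E; last first.
  by rewrite integral_indic ?setIT.
have lim x : limn (fun n => (tent n a b x)%:E) = (\1_(`]a, b[%classic) x)%:E.
  by apply/cvg_lim => //; apply: cvg_EFin; [exact: nearW|exact: tent_cvg].
under eq_integral do rewrite -lim.
apply: (@cvg_monotone_convergence _ _ _ g setT _ (fun n x => (tent n a b x)%:E)) => //.
- by move=> n; apply/measurable_EFinP; exact: measurable_tent.
- by move=> n x _; rewrite lee_fin tent_ge0.
- move=> x _ n m nm; rewrite lee_fin.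
  have [xab|xab] := pselect (a < x < b); last by rewrite !tent_out.
  rewrite /tent; set d := Num.min (x - a) _.
  have d0 : 0 <= d by rewrite le_min !subr_ge0; case/andP: xab => /ltW -> /ltW ->.
  rewrite ge_max le_max lexx/= le_max; apply/orP; right.
  by rewrite le_min !ge_min lexx /= ler_wpM2r ?ler_nat ?orbT.
Qed.

Lemma measurable_eval (B : set RB) : measurable B ->
  measurable_fun setT (fun g : conf R => g B).
Proof.
(* Inside a bounded window all masses are finite, as the complement step of the Dynkin induction
   requires; the window is then let grow. *)
pose W (k : nat) : set RB := `]- k%:R, k%:R[%classic.
have mW k : measurable (W k) by exact: measurable_itv.
have bW k : bounded_set (W k : set R) by exact: bounded_itv.
have mloc k : forall B : set RB, measurable B ->
    measurable_fun setT (fun g : conf R => g (B `&` W k)).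
  rewrite RGenOInfty.measurableE.
  apply: (@dynkin_induction _ RB (@RGenOInfty.G R) (fun B =>
    measurable_fun setT (fun g : conf R => g (B `&` W k)))) => /=.
  - exact: RGenOInfty.measurableE.
  - move=> _ _ [x ->] [y ->]; exists (Num.max x y).
    apply/seteqP; split => z /=; rewrite !in_itv/= !andbT gt_max.
      by case=> -> ->.
    by case/andP.
  - by rewrite setTI; exact: measurable_eval_itvoo.
  - move=> _ [x ->]; rewrite (_ : _ `&` _ = `]Num.max x (- k%:R), k%:R[%classic).
      exact: measurable_eval_itvoo.
    apply/seteqP; split => z; rewrite /W /= !in_itv/= andbT gt_max.
      by case=> xz /andP[kz zk]; rewrite xz kz zk.
    by case/andP => /andP[xz kz] zk; rewrite xz kz zk.
  - move=> S mS PS.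
    rewrite (_ : (fun g => _) = (fun g => g (W k) - g (S `&` W k)))%E.
      by apply: emeasurable_funB => //; exact: measurable_eval_itvoo.
    apply/funext => g.
    have -> : ~` S `&` W k = W k `\` S by rewrite setDE setIC.
    rewrite (measureD (mW k) mS) ?(setIC (W k))//.
    by rewrite -ge0_fin_numE// conf_fin_num.
  - move=> F mF tF PF.
    rewrite (_ : (fun g => _) = (fun g => \sum_(n <oo) g (F n `&` W k)))%E.
      by apply: ge0_emeasurable_sum => // n g _ _.
    apply/funext => g; rewrite setI_bigcupl measure_bigcup//.
    + by apply: eq_eseriesl => i; rewrite in_setT.
    + by move=> i _; exact: measurableI.
    + exact: trivIset_setIr.
move=> mB; apply: (emeasurable_fun_cvg (fun k g => g (B `&` W k))) => [k|g _].
  exact: mloc.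
have WT : \bigcup_k W k = setT.
  rewrite -subTset => x _; exists (Num.truncn `|x|).+1 => //=.
  by rewrite /W /= in_itv/= -ltr_norml truncnS_gt.
rewrite -[X in _ --> g X]setIT -WT setI_bigcupr.
apply: nondecreasing_cvg_mu => [i| |].
- exact: measurableI.
- by rewrite -setI_bigcupr WT setIT.
- move=> i j ij; apply/subsetPset; apply: setIS => x.
  rewrite /W /= !in_itv/= => /andP[ix xi].
  have ij' : (i%:R <= j%:R :> R) by rewrite ler_nat.
  by apply/andP; split; lra.
Qed.

End configuration_evaluations.

(** * Vaguely open sets through numbers of points in grid cells *)

Section vague_borel.
Context (R : realType).
Local Notation RB := (measurableTypeR R).
Implicit Types (g h : conf R).

Lemma uniform_continuity_itv (f : R -> R) (a b e : R) : continuous f -> 0 < e ->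
  exists2 d : R, 0 < d & forall x y : R, x \in `[a, b] -> `|x - y| < d -> `|f x - f y| <= e.
Proof.
move=> cf e0.
pose P (d x : R) := forall y, `|x - y| < d -> `|f x - f y| <= e.
have nearP (x : R) : \forall x' \near x & d \near at_right (0:R), P d x'.
  have e2 : 0 < e / 2 by rewrite divr_gt0.
  have /cvgrPdist_lt/(_ _ e2) := cf x.
  case=> d d0 fd; rewrite /= in d0.
  have d2 : 0 < d / 2 by rewrite divr_gt0.
  exists (ball x (d / 2), `]0, d / 2[%classic) => /=.
    split; first exact: nbhsx_ballx.
    by exists (d / 2) => //= z /= + z0; rewrite sub0r normrN gtr0_norm// in_itv/= z0.
  move=> [x' d'] [/= xx' ]; rewrite in_itv/= => /andP[d'0 d'd] y /= x'y.
  have xy := ler_distD x' x y.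
  have dpos : (0 : R) < d := d0.
  have dd : d / 2 < d by rewrite ltr_pdivrMr// mulr2n mulrDr mulr1 ltrDl.
  have fx' : `|f x - f x'| < e / 2 by apply: fd; exact: lt_trans dd.
  have fy : `|f x - f y| < e / 2.
    by apply: fd; apply: le_lt_trans xy _; rewrite (splitr d) ltrD// (lt_trans x'y).
  have := ler_distD (f x) (f x') (f y); rewrite (distrC (f x') (f x)) => /le_trans; apply.
  by rewrite (splitr e) ltW// ltrD.
have := @segment_compact R a b; rewrite compact_near_coveringP.
move=> /(_ R (at_right (0:R)) P _)[x _| r /= r0 rP]; first exact: nearP.
exists (r / 2); first by rewrite divr_gt0.
move=> x y xab; apply: rP => //=; last by rewrite divr_gt0.
by rewrite sub0r normrN gtr0_norm ?divr_gt0// ltr_pdivrMr// mulr2n mulrDr mulr1 ltrDl.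
Qed.

Lemma measure_partition g (K : nat) (I : nat -> set RB) (B : set RB) :
  (forall j, measurable (I j)) -> trivIset [set: nat] I ->
  \bigcup_(j < K) I j = B -> g B = (\sum_(j <- iota 0 K) g (I j))%E.
Proof.
move=> mI tI IB.
have BE : \big[setU/set0]_(j <- iota 0 K) I j = B.
  rewrite -bigcup_seq -IB; apply: eq_bigcupl; split => j /=;
    by rewrite mem_iota add0n.
have mB : measurable B by rewrite -IB; exact: bigcup_measurable.
have int1 A : measurable A -> (\int[g]_(x in A) (cst 1 x)%:E = g A)%E.
  by move=> mA; rewrite -[RHS]mul1e -integral_cst.
rewrite -int1// -BE integral_bigsetU_EFin ?iota_uniq//.
- by apply: eq_bigr => j _; rewrite int1.
- exact: sub_trivIset tI.
- exact/measurable_EFinP.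
Qed.

Lemma step_approx g (f : R -> R) (e : R) (K : nat) (I : nat -> set RB)
    (c : nat -> R) (B : set RB) :
  continuous f -> (forall j, measurable (I j)) ->
  trivIset [set: nat] I -> measurable B -> bounded_set (B : set R) ->
  \bigcup_(j < K) I j = B -> (forall x, ~ B x -> f x = 0) ->
  (forall j x, (j < K)%N -> I j x -> `|f x - c j| <= e) ->
  `|\int[g]_x f x - \sum_(j <- iota 0 K) c j * fine (g (I j))| <= e * fine (g B).
Proof.
move=> cf mI tI mB bB IB fB fc.
have IsubB j : (j < K)%N -> I j `<=` B by move=> jK x Ix; rewrite -IB; exists j.
have bI j : (j < K)%N -> bounded_set (I j : set R).
  by move=> jK; exact: sub_bounded (IsubB j jK) bB.
have gI j : (j < K)%N -> g (I j) \is a fin_num.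
  by move=> jK; exact: conf_fin_num (bI j jK).
have mf : measurable_fun [set: RB] f.
  have m : measurable_fun [set: R] f by exact: continuous_measurable_fun.
  by move=> mT Y mY; exact: m.
have BE : \big[setU/set0]_(j <- iota 0 K) I j = B.
  rewrite -bigcup_seq -IB; apply: eq_bigcupl; split => j /=;
    by rewrite mem_iota add0n.
have splitB (f' : R -> R) : measurable_fun [set: RB] f' ->
    (\int[g]_(x in B) (f' x)%:E = \sum_(j <- iota 0 K) \int[g]_(x in I j) (f' x)%:E)%E.
  move=> mf'; rewrite -BE integral_bigsetU_EFin ?iota_uniq//.
    exact: sub_trivIset tI.
  by apply/measurable_EFinP; exact: measurable_funTS.
have gB : fine (g B) = \sum_(j <- iota 0 K) fine (g (I j)).
  rewrite (measure_partition g mI tI IB).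
  rewrite big_seq [RHS]big_seq sum_fine; last first.
    by move=> j; rewrite mem_iota add0n => jK; rewrite gI.
  by rewrite -big_seq.
have intf j : (j < K)%N -> g.-integrable (I j) (EFin \o f).
  move=> jK; apply: measurable_bounded_integrable => //.
  - by rewrite ltey_eq gI.
  - exact: measurable_funTS.
  - exists (`|c j| + e); split; [exact: num_real|move=> M cM x Ix].
    have := fc j x jK Ix; have := ler_normD (f x - c j) (c j); rewrite subrK.
    by move=> *; apply: ltW; apply: le_lt_trans cM; lra.
have -> : \int[g]_x f x = \sum_(j <- iota 0 K) \int[g]_(x in I j) f x.
  rewrite (_ : \int[g]_x f x = \int[g]_(x in B) f x); last first.
    rewrite [RHS]Rintegral_mkcond; apply: eq_Rintegral => x _.
    by rewrite /patch; case: ifPn => //; rewrite notin_setE => /fB.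
  rewrite /Rintegral splitB// big_seq [RHS]big_seq sum_fine// => j.
  rewrite mem_iota add0n => jK.
  by apply: integrable_fin_num => //; exact: intf.
rewrite -sumrB gB mulr_sumr (le_trans (ler_norm_sum _ _ _))//.
rewrite big_seq [leRHS]big_seq; apply: ler_sum => j; rewrite mem_iota add0n => /= jK.
have intc : g.-integrable (I j) (EFin \o cst (c j)).
  apply: measurable_bounded_integrable => //; first by rewrite ltey_eq gI.
  by exists `|c j|; split; [exact: num_real|move=> M cM x _; exact: ltW].
have inte : g.-integrable (I j) (EFin \o cst e).
  apply: measurable_bounded_integrable => //; first by rewrite ltey_eq gI.
  by exists `|e|; split; [exact: num_real|move=> M cM x _; exact: ltW].
rewrite -Rintegral_cst// -RintegralB//; last exact: intf.
have intfc : g.-integrable (I j) (EFin \o (fun x => f x - c j)).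
  by have := integrableB (mI j) (intf j jK) intc; apply: eq_integrable.
rewrite (le_trans (le_normr_Rintegral _ intfc))//.
rewrite -Rintegral_cst//; apply: le_Rintegral => //.
  by have := integrable_abse intfc; apply: eq_integrable.
by move=> x Ix; exact: fc.
Qed.

Definition grid (r n j : nat) : set RB :=
  `[j%:R / n.+1%:R - r%:R, j.+1%:R / n.+1%:R - r%:R[%classic.

Lemma measurable_grid r n j : measurable (grid r n j).
Proof. exact: measurable_itv. Qed.

Lemma bounded_grid r n j : bounded_set (grid r n j : set R).
Proof. exact: bounded_itv. Qed.

Lemma grid_shift r s n j :
  (r <= s)%N -> grid r n j = grid s n (j + (s - r) * n.+1)%N.
Proof.
move=> rs; have n0 : n.+1%:R != 0 :> R by rewrite pnatr_eq0.
have E i : (i + (s - r) * n.+1)%N%:R / n.+1%:R - s%:R = i%:R / n.+1%:R - r%:R :> R.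
  by rewrite natrD natrM natrB// mulrDl mulfK//; ring.
by rewrite /grid -addSn !E.
Qed.

Lemma gridE r n j x : grid r n j x <->
  0 <= x + r%:R /\ Num.truncn ((x + r%:R) * n.+1%:R) = j.
Proof.
have n0 : 0 < n.+1%:R :> R by [].
rewrite /grid /= in_itv/= lerBlDr ltrBrDr ler_pdivrMr// ltr_pdivlMr//.
split=> [jx|[x0 <-]]; last by apply: truncn_itv; rewrite mulr_ge0.
split; last exact: truncn_def.
by case/andP: jx => jx _; rewrite -(pmulr_lge0 _ n0) (le_trans _ jx).
Qed.

Lemma trivIset_grid r n : trivIset [set: nat] (grid r n).
Proof. by move=> i j _ _ [x [/gridE[_ <-] /gridE[_ <-]]]. Qed.

Lemma bigcup_grid r n :
  \bigcup_(j < r.*2 * n.+1) grid r n j = `[- r%:R, r%:R[%classic.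
Proof.
have n0 : 0 < n.+1%:R :> R by [].
apply/seteqP; split=> x; rewrite /= in_itv/=.
  move=> [j jK /gridE[x0 xj]]; rewrite -subr_ge0 opprK x0/=.
  move: jK; rewrite /= -xj truncn_lt_nat ?mulr_ge0// natrM ltr_pM2r//.
  by rewrite -addnn natrD ltrD2r.
move=> /andP[rx xr]; have x0 : 0 <= x + r%:R by rewrite -lerBlDr sub0r.
exists (Num.truncn ((x + r%:R) * n.+1%:R)); last exact/gridE.
by rewrite /= truncn_lt_nat ?mulr_ge0// natrM ltr_pM2r// -addnn natrD ltrD2r.
Qed.

(** For [f] supported in [[- r, r[] and [n >= r], the cells of mesh [1 / n.+1] in [[- r, r[] are
    among those in [[- n, n[]. So [h n] and [g] give [f] the same Riemann sum, and each integral
    differs from it by at most the oscillation of [f] on a cell times the common mass. *)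
Lemma vague_cvg (h : nat -> conf R) g :
  (forall n j, (j < n.*2 * n.+1)%N -> h n (grid n n j) = g (grid n n j)) ->
  forall f : Cc R, vague_eval (h n) f @[n --> \oo] --> vague_eval g f.
Proof.
move=> hg [f /= [cf [r0 fr0]]]; rewrite /vague_eval/=.
have [r r0r] : exists r : nat, r0 < r%:R.
  by exists (Num.truncn `|r0|).+1; apply: le_lt_trans (truncnS_gt _); exact: ler_norm.
pose B : set RB := `[- r%:R, r%:R[%classic.
have mB : measurable B by exact: measurable_itv.
have bB : bounded_set (B : set R) by exact: bounded_itv.
have fB x : ~ B x -> f x = 0.
  move=> Bx; have [xr|] := ltP r0 `|x|; first exact: fr0.
  move=> /le_lt_trans/(_ r0r); rewrite ltr_norml => /andP[rx xr].
  by exfalso; apply: Bx; rewrite /B /= in_itv/= (ltW rx).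
apply/cvgrPdist_le => e e0.
pose C := fine (g B); have C0 : 0 <= C by exact: fine_ge0.
(* Two errors of size [e' * C] have to fit into [e]; the [+ 1] covers zero mass. *)
pose e' := e / (2 * (C + 1)).
have e'0 : 0 < e' by rewrite divr_gt0// mulr_gt0// ltr_wpDl.
have [d d0 fd] := uniform_continuity_itv (- r%:R) r%:R cf e'0.
(* The first bound puts the window [[- r, r[] inside [[- n, n[], the second makes the mesh
   [1 / n.+1] smaller than [d]. *)
exists (maxn r (Num.truncn d^-1)) => // n /=; rewrite geq_max => /andP[rn dn].
have n0 : 0 < n.+1%:R :> R by [].
have dn1 : n.+1%:R^-1 < d.
  rewrite invf_plt ?posrE//; apply: lt_le_trans (truncnS_gt _) _.
  by rewrite ler_nat.
pose c j := f (j%:R / n.+1%:R - r%:R).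
have BE := bigcup_grid r n.
have osc j x : (j < r.*2 * n.+1)%N -> grid r n j x -> `|f x - c j| <= e'.
  move=> jK jx; have Bx : x \in `[- r%:R, r%:R[ by have /seteqP[+ _] := BE; apply; exists j.
  apply: fd; first by move: Bx; rewrite !in_itv/= => /andP[-> /ltW].
  move: jx; rewrite /grid /= in_itv/= => /andP[jx xj].
  rewrite ger0_norm ?subr_ge0//; apply: lt_trans dn1.
  move: xj; rewrite -[j.+1]addn1 natrD mulrDl div1r.
  by move: (j%:R / _) => u; move: (_^-1) => v; lra.
have hgB j : (j < r.*2 * n.+1)%N -> h n (grid r n j) = g (grid r n j).
  move=> jK; rewrite (grid_shift _ _ rn); apply: hg.
  rewrite (@leq_trans (r.*2 * n.+1 + (n - r) * n.+1))// ?ltn_add2r//.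
  by rewrite -mulnDl leq_mul2r -!addnn -addnA leq_add// subnKC ?orbT.
have hB : h n B = g B.
  rewrite (measure_partition _ (measurable_grid r n) (@trivIset_grid r n) BE).
  rewrite (measure_partition g (measurable_grid r n) (@trivIset_grid r n) BE).
  by rewrite big_seq [RHS]big_seq; apply: eq_bigr => j; rewrite mem_iota add0n => /hgB.
have := step_approx (h n) cf (measurable_grid r n) (@trivIset_grid r n) mB bB BE fB osc.
have := step_approx g cf (measurable_grid r n) (@trivIset_grid r n) mB bB BE fB osc.
rewrite hB -/C.
have -> : \sum_(j <- iota 0 (r.*2 * n.+1)) c j * fine (h n (grid r n j)) =
    \sum_(j <- iota 0 (r.*2 * n.+1)) c j * fine (g (grid r n j)).
  by rewrite big_seq [RHS]big_seq; apply: eq_bigr => j; rewrite mem_iota add0n => /hgB ->.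
set s := \sum_(j <- _) _ => gs hs.
apply: (@le_trans _ _ (e' * C + e' * C)).
  have := ler_distD s (\int[g]_x f x) (\int[h n]_x f x); rewrite (distrC s).
  by move=> /le_trans; apply; exact: lerD.
have e'E : e' * (C + 1) = e / 2.
  by rewrite /e' invfM mulrA mulfVK// lt0r_neq0// ltr_wpDl.
have e'C : e' * C <= e / 2 by rewrite -e'E ler_pM2l// lerDl.
by rewrite [leRHS](splitr e) lerD.
Qed.

Lemma vague_cvg_open (h : nat -> conf R) g (O : set (conf R)) :
  (forall f : Cc R, vague_eval (h n) f @[n --> \oo] --> vague_eval g f) ->
  open O -> O g -> exists n, O (h n).
Proof.
move=> hg [V oV <-] /= Vg.
have : (vague_eval (h n) : {ptws Cc R -> R}) @[n --> \oo] --> vague_eval g.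
  apply/cvg_sup => f U [/= _ [[W oW <-] /= Wfg]] /filterS; apply.
  by apply: (hg f); exact: open_nbhs_nbhs.
move=> /(_ V (open_nbhs_nbhs (conj oV Vg))) [n _ nV].
by exists n; apply: nV => /=.
Qed.

(** The index packs a window and mesh size with a list of prescribed counts; its type is countable,
    which is the point of the encoding. *)
Definition grid_cell (i : nat * seq nat) : set (conf R) :=
  [set g | forall j, (j < i.1.*2 * i.1.+1)%N ->
     g (grid i.1 i.1 j) = (nth 0%N i.2 j)%:R%:E].

(** If no cell around [g] were contained in [O], choosing for each [n] a configuration outside [O]
    with the same counts as [g] would give a sequence outside [O] that converges vaguely to [g]. *)
Lemma open_grid_cells (O : set (conf R)) : open O ->
  O = \bigcup_(i in [set i | grid_cell i `<=` O]) grid_cell i.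
Proof.
move=> oO; apply/seteqP; split=> [g Og|g [i iO]]; last exact: iO.
pose count n j := Num.truncn (fine (g (grid n n j))).
have countE n j : g (grid n n j) = (count n j)%:R%:E.
  have [k gk] := conf_nat g (measurable_grid n n j) (bounded_grid n n j).
  by rewrite /count gk /= natrK.
pose cell n := (n, mkseq (count n) (n.*2 * n.+1)).
have gcell n : grid_cell (cell n) g.
  by move=> j /= jn; rewrite countE nth_mkseq.
apply: contrapT => notO.
have /choice[h hP] : forall n, exists h, grid_cell (cell n) h /\ ~ O h.
  move=> n; apply: contrapT => nex; apply: notO; exists (cell n) => // h ch.
  by apply: contrapT => Oh; apply: nex; exists h.
have [n Ohn] : exists n, O (h n).
  apply: (@vague_cvg_open h g O) => //; apply: vague_cvg => n j jn.
  by rewrite (gcell n)// (proj1 (hP n)).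
exact: (proj2 (hP n) Ohn).
Qed.

(** Open sets are countable unions of cells, and preimages of cells are countable intersections of
    events on counts. *)
Lemma measurable_to_conf d (T : measurableType d) (phi : T -> conf R) :
  (forall B : set RB, measurable B -> bounded_set (B : set R) ->
    measurable_fun setT (fun t => phi t B)) ->
  measurable_fun setT phi.
Proof.
move=> mphi; apply: (@measurability _ _ _ _ _ _ (@open (conf R))) => //.
move=> _ [V oV <-]; rewrite setTI (open_grid_cells oV) preimage_bigcup.
rewrite bigcup_mkcond; apply: countable_bigcupT_measurable => // i.
case: ifPn => // _.
rewrite (_ : _ @^-1` _ = \bigcap_j
    (if (j < i.1.*2 * i.1.+1)%N then
       (fun t => phi t (grid i.1 i.1 j)) @^-1` [set (nth 0%N i.2 j)%:R%:E]
     else setT)).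
  apply: bigcapT_measurable => j; case: ifPn => // _.
  rewrite -[X in measurable X]setTI.
  by apply: mphi => //; [exact: measurable_grid|exact: bounded_grid].
apply/seteqP; split=> t /= H j.
  by move=> _; case: ifPn => // /H.
by move=> ji; have := H j I; rewrite ji.
Qed.

End vague_borel.

(** * Compression and the atoms of a configuration *)

Section configuration_maps.
Context (R : realType).
Local Notation RB := (measurableTypeR R).
Implicit Types (g h : conf R).

Lemma measurable_conf_image (f : RB -> RB) (mf : measurable_fun setT f) bf :
  measurable_fun setT (@conf_image R f mf bf).
Proof.
apply: measurable_to_conf => B mB _; apply: measurable_eval.
by rewrite -[X in measurable X]setTI; exact: mf.
Qed.

Lemma measurable_expand (m : nat) :
  measurable_fun setT ((fun x => x * m%:R) : RB -> RB).
Proof.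
have mf : measurable_fun setT ((fun x => x * m%:R) : R -> R).
  by apply: measurable_funM.
by move=> mT Y mY; exact: mf.
Qed.

Lemma bounded_expand (m : nat) (hm : (1 < m)%N) (B : set R) :
  bounded_set B -> bounded_set ((fun x => x * m%:R) @^-1` B).
Proof.
have m0 : (0 : R) < m%:R by rewrite ltr0n; case: m hm.
move=> /bounded_setP[M bM]; apply/bounded_setP; exists (M / m%:R) => x /bM.
by rewrite normrM normr_nat ler_pdivlMr.
Qed.

(** The inverse of compression, along which non-measurable integrands, kernels and completions are
    carried over. *)
Definition conf_expand (m : nat) (hm : (1 < m)%N) : conf R -> conf R :=
  conf_image (measurable_expand m) (bounded_expand hm).

Lemma measurable_conf_expand m (hm : (1 < m)%N) :
  measurable_fun setT (conf_expand hm).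
Proof. exact: measurable_conf_image. Qed.

Lemma divmK m (hm : (1 < m)%N) : cancel (fun x : R => x / m%:R) (fun x => x * m%:R).
Proof. by move=> x; rewrite divfK// pnatr_eq0; case: m hm. Qed.

Lemma mulmK m (hm : (1 < m)%N) : cancel (fun x : R => x * m%:R) (fun x => x / m%:R).
Proof. by move=> x; rewrite mulfK// pnatr_eq0; case: m hm. Qed.

Lemma conf_compressK m (hm : (1 < m)%N) : cancel (conf_compress hm) (conf_expand hm).
Proof.
move=> g; apply: conf_eq => B.
change (g ((fun x => x / m%:R * m%:R) @^-1` B) = g B); congr (g _).
by rewrite (_ : (fun x => _) = id)//; apply/funext => x; exact: divmK.
Qed.

Lemma conf_expandK m (hm : (1 < m)%N) : cancel (conf_expand hm) (conf_compress hm).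
Proof.
move=> g; apply: conf_eq => B.
change (g ((fun x => x * m%:R / m%:R) @^-1` B) = g B); congr (g _).
by rewrite (_ : (fun x => _) = id)//; apply/funext => x; exact: mulmK.
Qed.

Lemma expand_preimageK m (hm : (1 < m)%N) (C : set (conf R)) :
  conf_compress hm @^-1` (conf_expand hm @^-1` C) = C.
Proof.
by rewrite -comp_preimage; rewrite (_ : _ \o _ = id)//; apply/funext; exact: conf_compressK.
Qed.

Lemma compress_add m (hm : (1 < m)%N) g h :
  conf_compress hm (conf_add g h) = conf_add (conf_compress hm g) (conf_compress hm h).
Proof.
apply: conf_eq => B; change (measure_add g h ((fun x => x / m%:R) @^-1` B) =
  measure_add (conf_compress hm g) (conf_compress hm h) B).
by rewrite !measure_addE.
Qed.

Lemma compress_conf0 m (hm : (1 < m)%N) : conf_compress hm (conf0 R) = conf0 R.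
Proof. exact: conf_eq. Qed.

Lemma compress_dirac m (hm : (1 < m)%N) x :
  conf_compress hm (conf_dirac x) = conf_dirac (x / m%:R : R).
Proof.
apply: conf_eq => B; change (@dirac _ RB x R ((fun x => x / m%:R) @^-1` B) =
  @dirac _ RB (x / m%:R) R B).
by rewrite !diracE; congr ((nat_of_bool _)%:R%:E); apply/idP/idP; rewrite !inE.
Qed.

Lemma compress_conf_of_seq m (hm : (1 < m)%N) (s : seq R) :
  conf_compress hm (conf_of_seq s) = conf_of_seq [seq (x / m%:R : R) | x <- s].
Proof.
elim: s => [|x s IH]; first exact: compress_conf0.
by rewrite /= compress_add compress_dirac IH.
Qed.

Lemma shift_compress m (hm : (1 < m)%N) t g :
  conf_shift t (conf_compress hm g) = conf_compress hm (conf_shift (t * m%:R) g).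
Proof.
apply: conf_eq => B.
change (g ((fun x => x / m%:R - t) @^-1` B) =
  g ((fun x => (x - t * m%:R) / m%:R) @^-1` B)).
suff -> : (fun x : R => x / m%:R - t) = (fun x => (x - t * m%:R) / m%:R) by [].
by apply/funext => x; rewrite mulrBl mulmK.
Qed.

Lemma conf_of_seqE (s : seq R) (B : set RB) :
  conf_of_seq s B = (\sum_(x <- s) \1_B x)%R%:E.
Proof.
elim: s => [|x s IH]; first by rewrite big_nil.
by rewrite big_cons EFinD -IH [LHS]measure_addE.
Qed.

Lemma measurable_conf_of_seq n :
  measurable_fun setT (fun t : n.-tuple RB => conf_of_seq t).
Proof.
apply: measurable_to_conf => B mB _.
under eq_fun do rewrite conf_of_seqE big_tuple.
apply/measurable_EFinP; apply: measurable_sum => i.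
apply: measurableT_comp; first exact: measurable_indic.
exact: measurable_tnth.
Qed.

Lemma measurable_conf_addl g : measurable_fun setT (fun h => conf_add h g).
Proof.
apply: measurable_to_conf => B mB bB.
rewrite (_ : (fun h => _) = (fun h => h B + g B))%E; last first.
  by apply/funext => h; exact: measure_addE.
by apply: emeasurable_funD => //; exact: measurable_eval.
Qed.

Lemma measurable_conf_restr (A : set RB) (mA : measurable A) :
  measurable_fun setT (fun g => conf_restr g mA).
Proof.
by apply: measurable_to_conf => B mB bB; apply: measurable_eval; exact: measurableI.
Qed.

Lemma conf_add0 g : conf_add (conf0 R) g = g.
Proof. by apply: conf_eq => B; rewrite [LHS]measure_addE; exact: add0e. Qed.

Lemma measurable_conf_in (A : set RB) : measurable A -> measurable (conf_in A : set (conf R)).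
Proof.
move=> mA; rewrite (_ : conf_in A = (fun g : conf R => g (~` A)) @^-1` [set 0%E])//.
rewrite -[X in measurable X]setTI; apply: measurable_eval => //; exact: measurableC.
Qed.

Lemma measurable_conf_n (A : set RB) n : measurable A -> measurable (conf_n A n : set (conf R)).
Proof.
move=> mA; apply: measurableI; first exact: measurable_conf_in.
have := @measurable_eval R A mA measurableT [set n%:R%:E] (emeasurable_set1 _).
by rewrite setTI.
Qed.

Lemma measurable_scale (c : R) :
  measurable_fun [set: RB] ((fun x => x / c) : RB -> RB).
Proof.
have m : measurable_fun setT ((fun x => x / c) : R -> R) by apply: measurable_funM.
by move=> mT Y mY; exact: m.
Qed.

Lemma lebesgue_measure_scale (c : R) (B : set RB) : 0 < c -> measurable B ->
  lebesgue_measure ((fun x : R => x / c) @^-1` B) = (c%:E * lebesgue_measure B)%E.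
Proof.
move=> c0 mB; have c0' : 0 <= c^-1 by rewrite invr_ge0 ltW.
pose nu := mscale (NngNum c0') (image_measure (@lebesgue_measure R) (measurable_scale c)).
rewrite (@lebesgue_measure_unique _ nu _ B mB).
  by rewrite /nu /mscale /= muleA -EFinM divff ?mul1e// lt0r_neq0.
move=> _ [[a b] _ <-]; change (lebesgue_measure (`]a, b]%classic : set R) =
  c^-1%:E * lebesgue_measure ((fun x : R => (x / c)%R) @^-1` `]a, b]%classic))%E.
rewrite (_ : _ @^-1` _ = `](a * c), (b * c)]%classic); last first.
  by apply/seteqP; split => x; rewrite /= !in_itv/= ltr_pdivlMr// ler_pdivrMr.
rewrite !lebesgue_measure_itv/= !lte_fin ltr_pM2r//; case: ifPn => _; last by rewrite mule0.
by rewrite -EFinB -EFinM -mulrBl mulrCA mulVf ?mulr1// lt0r_neq0.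
Qed.

Lemma restr_compress m (hm : (1 < m)%N) g (A : set RB) (mA : measurable A)
    (mA' : measurable ((fun x => x / m%:R) @^-1` A : set RB)) :
  conf_restr (conf_compress hm g) mA = conf_compress hm (conf_restr g mA').
Proof. exact: conf_eq. Qed.

Lemma conf_lt1 g (B : set RB) : measurable B -> bounded_set (B : set R) ->
  (g B < 1)%E -> g B = 0%E.
Proof.
move=> mB bB; have [[|k] ->//] := conf_nat g mB bB.
by rewrite lte_fin ltrn1.
Qed.

(** The masses of shrinking intervals around [x] tend to [0]; being integers, they vanish as soon as
    they drop below [1]. *)
Lemma null_near_non_atom g (B : set RB) (x : R) :
  measurable B -> bounded_set (B : set R) -> g (B `&` [set x]) = 0%E ->
  exists2 d : R, 0 < d & g (B `&` `]x - d, x + d[%classic) = 0%E.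
Proof.
move=> mB bB gx.
pose F n : set RB := B `&` `]x - n.+1%:R^-1, x + n.+1%:R^-1[%classic.
have mF n : measurable (F n) by apply: measurableI => //; exact: measurable_itv.
have bF n : bounded_set (F n : set R) by apply: sub_bounded bB => y [].
have FE : \bigcap_n F n = B `&` [set x].
  apply/seteqP; split=> [y Fy|y [+ /= yx] n _]; last first.
    rewrite yx => Bx.
    split=> //.
    by rewrite /= in_itv/= ltrBlDr ltrDl invr_gt0 ltr0n.
  split; first by have [] := Fy 0%N I.
  apply/eqP; rewrite eq_le; apply/andP; split; apply/ler_addgt0Pr => e e0.
  - have [n ne] : exists n : nat, n.+1%:R^-1 < e.
      by exists (Num.truncn e^-1); rewrite invf_plt ?posrE// truncnS_gt.
    have [_] := Fy n I; rewrite /= in_itv/= => /andP[_ /ltW/le_trans]; apply.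
    by rewrite lerD2l ltW.
  - have [n ne] : exists n : nat, n.+1%:R^-1 < e.
      by exists (Num.truncn e^-1); rewrite invf_plt ?posrE// truncnS_gt.
    have [_] := Fy n I; rewrite /= in_itv/= => /andP[/ltW + _].
    by rewrite lerBlDr => /le_trans; apply; rewrite lerD2l ltW.
have : g \o F @ \oo --> g (\bigcap_n F n).
  apply: nonincreasing_cvg_mu => //.
  - by rewrite ltey_eq conf_fin_num.
  - exact: bigcapT_measurable.
  - move=> i j ij; apply/subsetPset; apply: setIS => y; rewrite /= !in_itv/= => /andP[jy yj].
    have ji : j.+1%:R^-1 <= i.+1%:R^-1 :> R by rewrite lef_pV2 ?posrE// ler_nat.
    by rewrite (lt_le_trans yj) ?lerD2l// (le_lt_trans _ jy)// lerD2l lerN2.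
rewrite FE gx => /fine_cvgP[_ /cvgrPdist_lt/(_ _ ltr01)[n _ /(_ n (leqnn n))]].
rewrite /= sub0r normrN ger0_norm ?fine_ge0// => Fn.
exists n.+1%:R^-1; first by rewrite invr_gt0.
apply: (conf_lt1 (mF n) (bF n)).
by rewrite -[ltLHS]fineK ?lte_fin// conf_fin_num.
Qed.

(** Without atoms every point has a null neighbourhood in [B], and compactness yields one radius [d]
    for all of them. Finitely many grid cells shorter than [d] then cover [B] by null sets. *)
Lemma conf_atom g (B : set RB) : measurable B -> bounded_set (B : set R) ->
  g B != 0%E -> exists2 x : R, B x & g [set x] != 0%E.
Proof.
move=> mB bB /eqP gB; apply: contrapT => noatom; apply: gB.
have nullx (x : R) : g (B `&` [set x]) = 0%E.
  have [Bx|Bx] := pselect (B x); last first.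
    by rewrite (_ : _ `&` _ = set0) ?measure0//; apply/seteqP; split=> [y [+ yx]|//]; rewrite yx.
  rewrite (_ : _ `&` _ = [set x]); last by apply/seteqP; split=> [y []|y ->].
  by apply: contrapT => /eqP gx; apply: noatom; exists x.
have [r Br] : exists r : nat, B `<=` `[- r%:R, r%:R[%classic.
  have /bounded_setP[M BM] := bB; exists (Num.truncn `|M|).+1 => x /BM xM.
  rewrite /= in_itv/=; have : `|x| < (Num.truncn `|M|).+1%:R.
    by rewrite (le_lt_trans xM)// (le_lt_trans (ler_norm _))// truncnS_gt.
  by rewrite ltr_norml => /andP[/ltW -> ->].
pose P (d x : R) := g (B `&` `]x - d, x + d[%classic) = 0%E.
have nearP (x : R) : \forall x' \near x & d \near at_right (0:R), P d x'.
  have [d d0 gd] := null_near_non_atom mB bB (nullx x).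
  have d2 : 0 < d / 2 by rewrite divr_gt0.
  exists (ball x (d / 2), `]0, d / 2[%classic) => /=.
    split; first exact: nbhsx_ballx.
    by exists (d / 2) => //= z /= + z0; rewrite sub0r normrN gtr0_norm// in_itv/= z0.
  move=> [x' d'] [/= xx' ]; rewrite in_itv/= => /andP[d'0 d'd].
  apply/eqP; rewrite eq_le measure_ge0 andbT -gd; apply: le_measure.
  - by rewrite inE; apply: measurableI => //; exact: measurable_itv.
  - by rewrite inE; apply: measurableI => //; exact: measurable_itv.
  - apply: setIS => y; rewrite /= !in_itv/= => /andP[x'y yx'].
    have {}xx' : `|x - x'| < d / 2 by exact: xx'.
    move: xx'; rewrite ltr_norml => /andP[xx' x'x].
    have E := splitr d; apply/andP; split.
      by rewrite E opprD addrA; move: (d / 2) xx' x'x d'd {E} => e *; lra.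
    by rewrite E addrA; move: (d / 2) xx' x'x d'd {E} => e *; lra.
have := @segment_compact R (- r%:R) r%:R; rewrite compact_near_coveringP.
move=> /(_ R (at_right (0:R)) P _)[x _| d0 /= d00 dP]; first exact: nearP.
pose d : R := d0 / 2.
have dpos : 0 < d by rewrite divr_gt0.
have gP x : x \in `[- r%:R, r%:R] -> P d x.
  apply: dP => //=; rewrite sub0r normrN gtr0_norm//.
  by rewrite /d ltr_pdivrMr// mulr2n mulrDr mulr1 ltrDl.
pose n := Num.truncn d^-1.
have nd : n.+1%:R^-1 < d by rewrite invf_plt ?posrE// truncnS_gt.
have := measure_partition (conf_restr g mB) (measurable_grid r n) (@trivIset_grid _ r n) (bigcup_grid _ r n).
rewrite [LHS](_ : _ = g B); last by rewrite /= /mrestr (setIidr Br).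
move=> ->; rewrite big_seq big1// => j; rewrite mem_iota add0n => /andP[_ jK].
have n0 : 0 < n.+1%:R :> R by [].
have cellj : P d (j%:R / n.+1%:R - r%:R).
  apply: gP; rewrite in_itv/= -lerBlDr opprK addNr divr_ge0//= lerBlDr ler_pdivrMr//.
  by rewrite -natrD -natrM ler_nat addnn ltnW.
apply/eqP; rewrite eq_le measure_ge0 andbT -[leRHS]cellj; apply: le_measure.
- by rewrite inE; apply: measurableI => //; exact: measurable_grid.
- by rewrite inE; apply: measurableI => //; exact: measurable_itv.
rewrite /= setIC; apply: setIS => y; rewrite /grid /= !in_itv/=.
rewrite -[j.+1]addn1 natrD mulrDl div1r.
move: (j%:R / _) => u; move: (_^-1) nd => v nd /andP[uy yu].
by apply/andP; split; lra.
Qed.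

(** Induction on the mass: removing an atom lowers it by at least one. Integrals against
    configurations in bounded sets thereby become finite sums up to null sets. *)
Lemma conf_finite_support g (B : set RB) : measurable B -> bounded_set (B : set R) ->
  exists s : seq R, [/\ uniq s, forall x, x \in s -> B x /\ g [set x] != 0%E &
    g (B `\` [set` s]) = 0%E].
Proof.
move=> mB bB; have [n] := conf_nat g mB bB.
elim/ltn_ind: n B mB bB => n IH B mB bB gB.
have [gB0|/(conf_atom mB bB)[x Bx gx]] := eqVneq (g B) 0%E.
  by exists [::]; split=> //; rewrite set_nil setD0.
have mx : measurable ([set x] : set RB) by exact: measurable_set1.
have bx : bounded_set [set x] by apply: sub_bounded bB => y ->.
have mBx : measurable (B `\ x) by exact: measurableD.
have bBx : bounded_set ((B `\ x) : set R) by apply: sub_bounded bB => y [].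
have [k gk] := conf_nat g mx bx.
have [l gl] := conf_nat g mBx bBx.
have nE : n = (k + l)%N.
  apply/eqP; rewrite -(eqr_nat R) -eqe -gB natrD EFinD -gk -gl; apply/eqP.
  rewrite -measureU//; last by apply/seteqP; split=> [y [-> [_ /(_ erefl)]]|].
  congr (g _); apply/seteqP; split=> [y By|y [->|[]]//].
  by have [->|yx] := pselect (y = x); [left|right].
have k0 : (0 < k)%N by rewrite lt0n; apply: contraNneq gx => k0; rewrite gk k0.
have ln : (l < n)%N by rewrite nE -addn1 addnC leq_add2r.
have [s [us sB gs]] := IH l ln _ mBx bBx gl.
exists (x :: s); split.
- by rewrite /= us andbT; apply/negP => /sB[[_ /(_ erefl)]].
- by move=> y; rewrite inE => /predU1P[->//|/sB[[]]].
- rewrite -gs; congr (g _); apply/seteqP; split=> y /=.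
    move=> [By /negP]; rewrite inE negb_or => /andP[/eqP yx /negP ys].
    by split.
  by move=> [[By yx] ys]; split=> //; rewrite inE => /predU1P[].
Qed.

End configuration_maps.

(** * Scaling of the Gibbs kernels *)

Section log_gas_scaling.
Context (R : realType).
Local Notation RB := (measurableTypeR R).
Implicit Types (g h : conf R).

Lemma conf_sigma_finite g : sigma_finite setT g.
Proof.
exists (fun n => `[- n%:R, n%:R]%classic).
  apply/esym; rewrite -subTset => x _; exists (Num.truncn `|x|).+1 => //=.
  by rewrite in_itv/= -ler_norml ltW// truncnS_gt.
move=> n; split; first exact: measurable_itv.
by rewrite ltey_eq conf_fin_num//; exact: bounded_itv.
Qed.

(* [conf_measure g] is a projection, on which HB cannot hang an instance. *)
Definition conf_fun g : set RB -> \bar R := g.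

HB.instance Definition _ g := isMeasure.Build _ _ _ (conf_fun g)
  (measure0 g) (measure_ge0 g) (@measure_semi_sigma_additive _ _ _ g).
HB.instance Definition _ g := Measure_isSigmaFinite.Build _ _ _ (conf_fun g)
  (conf_sigma_finite g).

Definition conf_prod h g : {measure set (RB * RB) -> \bar R} := (h \x conf_fun g)%E.

Definition scale2 (c : R) (z : RB * RB) : RB * RB := ((z.1 : R) / c, (z.2 : R) / c).

Lemma measurable_scale2 c : measurable_fun setT (scale2 c).
Proof.
apply/measurable_fun_pairP; split.
  by apply: (measurableT_comp (measurable_scale c)); exact: measurable_fst.
by apply: (measurableT_comp (measurable_scale c)); exact: measurable_snd.
Qed.

Lemma scale2K (c : R) : c != 0 -> cancel (scale2 c) (scale2 c^-1).
Proof. by move=> c0 [x y]; rewrite /scale2 /= invrK !divfK. Qed.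

Lemma product_image_bij d1 d1' d2 d2' (T1 : measurableType d1) (T1' : measurableType d1')
    (T2 : measurableType d2) (T2' : measurableType d2')
    (m1 : {measure set T1 -> \bar R}) (m1' : {measure set T1' -> \bar R})
    (m2 : set T2 -> \bar R) (m2' : set T2' -> \bar R)
    (f1 : T1 -> T1') (f2 : T2 -> T2') (i1 : T1' -> T1) (C : set (T1' * T2')) :
  measurable_fun setT f1 -> measurable_fun setT i1 -> cancel f1 i1 -> cancel i1 f1 ->
  (forall B, measurable B -> m1' B = m1 (f1 @^-1` B)) ->
  (forall B, measurable B -> m2' B = m2 (f2 @^-1` B)) ->
  measurable C ->
  (m1' \x m2')%E C = (m1 \x m2)%E ((fun z => (f1 z.1, f2 z.2)) @^-1` C).
Proof.
move=> mf1 mi1 f1K i1K m1E m2E mC; rewrite /product_measure1.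
rewrite (integral_image_bij setT _ mf1 mi1 f1K i1K m1E) preimage_setT.
apply: eq_integral => x _ /=; rewrite m2E; last exact: measurable_xsection.
by congr (m2 _); apply/seteqP; split=> y; rewrite /xsection /= !inE.
Qed.

Lemma conf_prodE m (hm : (1 < m)%N) h g (C : set (RB * RB)) : measurable C ->
  conf_prod (conf_compress hm h) (conf_compress hm g) C =
  conf_prod h g (scale2 m%:R @^-1` C).
Proof.
move=> mC.
apply: (@product_image_bij _ _ _ _ RB RB RB RB h (conf_compress hm h) g
  (conf_compress hm g) (fun x : R => x / m%:R) (fun x : R => x / m%:R)
  (fun x : R => x * m%:R)) => //.
- exact: measurable_compress.
- exact: measurable_expand.
- exact: divmK.
- exact: mulmK.
Qed.

Lemma conf_prod_integral m (hm : (1 < m)%N) h g (D : set (RB * RB)) f :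
  (\int[conf_compress hm h \x conf_compress hm g]_(z in D) f z =
   \int[conf_prod h g]_(z in scale2 m%:R @^-1` D) f (scale2 m%:R z))%E.
Proof.
have m0 : m%:R != 0 :> R by rewrite pnatr_eq0; case: m hm.
apply: (@integral_image_bij _ _ _ _ _ (conf_prod h g)
  (conf_prod (conf_compress hm h) (conf_compress hm g)) (scale2 m%:R)
  (scale2 m%:R^-1)).
- exact: measurable_scale2.
- exact: measurable_scale2.
- exact: scale2K.
- by rewrite -{2}[m%:R]invrK; apply: scale2K; rewrite invr_eq0.
- exact: conf_prodE.
Qed.

(** The prescribed value at [0] agrees with the convention [ln 0 = 0]. *)
Lemma log_kernelE (x : R) : log_kernel x = - ln `|x|.
Proof. by rewrite /log_kernel; case: eqP => // ->; rewrite normr0 ln0 ?oppr0. Qed.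

Lemma measurable_sub2 : measurable_fun setT (fun z : RB * RB => (z.1 : R) - z.2).
Proof.
have m1 : measurable_fun setT (fun z : RB * RB => z.1 : R).
  by move=> mT Y mY; exact: measurable_fst.
have m2 : measurable_fun setT (fun z : RB * RB => z.2 : R).
  by move=> mT Y mY; exact: measurable_snd.
exact: measurable_funB.
Qed.

Lemma measurable_log_kernel2 :
  measurable_fun setT (fun z : RB * RB => log_kernel ((z.1 : R) - z.2)).
Proof.
under eq_fun do rewrite log_kernelE.
apply: measurableT_comp; first exact: oppr_measurable.
apply: measurableT_comp; first exact: measurable_ln.
by apply: measurableT_comp; [exact: normr_measurable|exact: measurable_sub2].
Qed.

Lemma measurable_diagonal : measurable (@diagonal_set R).
Proof.
rewrite (_ : @diagonal_set R = (fun z : RB * RB => (z.1 : R) - z.2) @^-1` [set 0]).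
  by rewrite -[X in measurable X]setTI; apply: measurable_sub2.
apply/seteqP; split=> z; rewrite /diagonal_set /=; first by move=> ->; rewrite subrr.
by move/eqP; rewrite subr_eq0 => /eqP.
Qed.

Lemma log_kernel_scale (c x y : R) : 0 < c -> x != y ->
  log_kernel (x / c - y / c) = log_kernel (x - y) + ln c.
Proof.
move=> c0 xy; rewrite !log_kernelE -mulrBl normrM normfV (gtr0_norm c0).
by rewrite ln_div ?posrE// ?normr_gt0 ?subr_eq0// opprB addrC.
Qed.

Lemma conf_prod_rect h g (A B : set RB) : measurable A -> measurable B ->
  conf_prod h g (A `*` B) = (h A * g B)%E.
Proof. by move=> mA mB; exact: (@product_measure1E _ _ RB RB R h (conf_fun g)). Qed.

Lemma measurable_seq (s : seq R) : measurable ([set` s] : set RB).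
Proof.
elim: s => [|x s IH]; first by rewrite set_nil; exact: measurable0.
rewrite (_ : [set` x :: s] = [set x] `|` [set` s]); last first.
  apply/seteqP; split=> y /=; rewrite inE; first by move=> /predU1P[->|]; [left|right].
  by move=> [->|ys]; rewrite ?eqxx ?ys ?orbT.
by apply: measurableU => //; exact: measurable_set1.
Qed.

(** Up to the null set [N], both configurations live on finite lists [s] and [t], so even a kernel
    unbounded near the diagonal is bounded by the sum of [|f|] over the pairs. *)
Lemma conf_prod_integrable h g (A B : set RB) (Z : set (RB * RB)) (f : RB * RB -> R) :
  measurable A -> bounded_set (A : set R) -> measurable B -> bounded_set (B : set R) ->
  measurable Z -> Z `<=` A `*` B -> measurable_fun setT f ->
  (conf_prod h g).-integrable Z (EFin \o f).
Proof.
move=> mA bA mB bB mZ ZAB mf.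
have [s [_ _ hs]] := conf_finite_support h mA bA.
have [t [_ _ gt]] := conf_finite_support g mB bB.
pose ms := measurable_seq s; pose mt := measurable_seq t.
pose N : set (RB * RB) := ((A `\` [set` s]) `*` B) `|` (A `*` (B `\` [set` t])).
have m1 : measurable ((A `\` [set` s]) `*` B).
  by apply: measurableX => //; exact: measurableD.
have m2 : measurable (A `*` (B `\` [set` t])).
  by apply: measurableX => //; exact: measurableD.
have N0 : conf_prod h g N = 0%E.
  apply: null_set_setU => //; rewrite conf_prod_rect//; try exact: measurableD.
    by rewrite hs mul0e.
  by rewrite gt mule0.
have mN : measurable N by exact: measurableU.
have mfZ : measurable_fun Z (EFin \o f).
  by apply: measurable_funTS; apply/measurable_EFinP.
apply/(negligible_integrable mN mZ mfZ N0).
apply: measurable_bounded_integrable.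
- exact: measurableD.
- apply: (@le_lt_trans _ _ (conf_prod h g (A `*` B))).
    by apply: le_measure; rewrite ?inE; [exact: measurableD|exact: measurableX|move=> z [/ZAB]].
  rewrite conf_prod_rect//.
  by have [k ->] := conf_nat h mA bA; have [l ->] := conf_nat g mB bB; rewrite -EFinM ltry.
- exact: measurable_funTS.
- pose M := \sum_(x <- s) \sum_(y <- t) `|f (x, y)|.
  exists M; split; first exact: num_real.
  move=> M' MM' [x y] [/ZAB[/= Ax By] Nxy]; apply: (le_trans _ (ltW MM')).
  have xs : x \in s.
    by apply: contrapT => xs; apply: Nxy; left; split=> //; split.
  have yt : y \in t.
    by apply: contrapT => yt; apply: Nxy; right; split=> //; split.
  rewrite /M (big_rem x xs) /= (big_rem y yt) /= -addrA lerDl addr_ge0// ?sumr_ge0//.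
  by move=> *; exact: sumr_ge0.
Qed.

Lemma log_integral_scale m (hm : (1 < m)%N) h g (A B : set RB) (Z : set (RB * RB)) :
  measurable A -> bounded_set (A : set R) -> measurable B -> bounded_set (B : set R) ->
  measurable Z -> Z `<=` A `*` B -> (forall z, Z z -> z.1 != z.2) ->
  (\int[conf_prod h g]_(z in Z) (log_kernel (((z.1 : R) / m%:R) - z.2 / m%:R))%:E =
   \int[conf_prod h g]_(z in Z) (log_kernel ((z.1 : R) - z.2))%:E +
     (ln m%:R)%:E * conf_prod h g Z)%E.
Proof.
move=> mA bA mB bB mZ ZAB Zd.
have m0 : 0 < m%:R :> R by rewrite ltr0n; case: m hm.
rewrite -integral_cst// -integralD//; last 2 first.
- exact: (conf_prod_integrable h g mA bA mB bB mZ ZAB measurable_log_kernel2).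
- exact: (conf_prod_integrable h g mA bA mB bB mZ ZAB (measurable_cst _)).
by apply: eq_integral => z /set_mem Zz; rewrite log_kernel_scale ?EFinD// Zd.
Qed.

End log_gas_scaling.

Section image_of_iid.
Context d (T : measurableType d) (R : realType).

Lemma iid_image (P Q : probability T R) (f i : T -> T) n (C : set (n.-tuple T)) :
  measurable_fun setT f -> measurable_fun setT i -> cancel f i -> cancel i f ->
  (forall B, measurable B -> Q B = P (f @^-1` B)) -> measurable C ->
  iid Q n C = iid P n ((fun t : n.-tuple T => [tuple of map f t]) @^-1` C).
Proof.
move=> mf mi fK iK QE; elim: n C => [|n IH] C mC.
  rewrite /= !diracE; congr ((nat_of_bool _)%:R%:E).
  apply/idP/idP; rewrite !inE /=.
    by rewrite (_ : [tuple of map f [tuple]] = [tuple])//; exact: val_inj.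
  by rewrite (_ : [tuple of map f [tuple]] = [tuple])//; exact: val_inj.
have mC' : measurable (@tuple_cons _ T n @^-1` C).
  by rewrite -[X in measurable X]setTI; exact: measurable_tuple_cons.
change ((Q \x iid Q n)%E (@tuple_cons _ T n @^-1` C) =
  (P \x iid P n)%E (@tuple_cons _ T n @^-1` ((fun t : n.+1.-tuple T => [tuple of map f t]) @^-1` C))).
rewrite (@product_image_bij _ _ _ _ _ _ _ _ _ P Q (iid P n) (iid Q n) f
  (fun t : n.-tuple T => [tuple of map f t]) i)//.
congr ((P \x iid P n)%E _); apply/funext => z; congr (C _).
exact: val_inj.
Qed.

End image_of_iid.

Lemma cvg_mulnr m : (0 < m)%N -> (p * m)%N @[p --> \oo] --> \oo.
Proof.
move=> m0 V [k _ kV]; exists k => // p /= kp; apply: kV => /=.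
by rewrite (leq_trans kp)// leq_pmulr.
Qed.

Section gibbs_scaling.
Context (R : realType).
Local Notation RB := (measurableTypeR R).
Local Notation mu := (@lebesgue_measure R).
Variables (m : nat) (hm : (1 < m)%N) (A : set RB) (mA : measurable A).
Hypothesis bA : bounded_set (A : set R).
Local Notation comp := (conf_compress hm).
Implicit Types (g h : conf R).

Let A' : set RB := (fun x : R => x / m%:R) @^-1` A.

Let m_gt0 : 0 < m%:R :> R. Proof. by rewrite ltr0n; case: m hm. Qed.

Lemma measurable_dilation : measurable A'.
Proof. by rewrite -[X in measurable X]setTI; exact: measurable_compress. Qed.

Lemma bounded_dilation : bounded_set (A' : set R).
Proof. exact: bounded_compress. Qed.

Let mA' := measurable_dilation.
Let bA' := bounded_dilation.

Lemma windowE p : (fun x : R => x / m%:R) @^-1` @window R p = @window R (p * m)%N.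
Proof.
have E (x u : R) : (- u <= x / m%:R <= u) = (- (u * m%:R) <= x <= u * m%:R).
  by rewrite ler_pdivlMr// ler_pdivrMr// mulNr.
by apply/seteqP; split => x; rewrite /window /= !in_itv/= natrM mulrAC E.
Qed.

Lemma measurable_window p : measurable (@window R p : set RB).
Proof. exact: measurable_itv. Qed.

Lemma bounded_window p : bounded_set (@window R p).
Proof. exact: bounded_itv. Qed.

Lemma pair_interaction_scale p h g :
  pair_interaction A p (comp h) (comp g) = pair_interaction A' (p * m) h g +
    ln m%:R * fine (h A') * fine (g (@window R (p * m)%N `\` A')).
Proof.
have mW : measurable (@window R (p * m)%N `\` A' : set RB).
  by apply: measurableD => //; exact: measurable_window.
have bW : bounded_set (@window R (p * m)%N `\` A').
  by apply: sub_bounded (bounded_window (p * m)) => x [].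
rewrite /pair_interaction conf_prod_integral.
rewrite (_ : _ @^-1` _ = A' `*` (@window R (p * m)%N `\` A')); last first.
  by rewrite -windowE.
have mZ : measurable (A' `*` (@window R (p * m)%N `\` A') : set (RB * RB)).
  exact: measurableX.
rewrite (log_integral_scale hm h g mA' bA' mW bW mZ (@subset_refl _ _)); last first.
  by move=> [x y] [/= Ax [_ Ay]]; apply/eqP => xy; rewrite xy in Ax.
have fi := conf_prod_integrable h g mA' bA' mW bW mZ (@subset_refl _ _)
  (measurable_log_kernel2 (R := R)).
rewrite conf_prod_rect// fineD//; first last.
- by rewrite !fin_numM// conf_fin_num.
- exact: (integrable_fin_num mZ fi).
by congr (_ + _); rewrite !fineM ?fin_numM ?conf_fin_num//= mulrA.
Qed.

(** Each pair interaction gains [ln m] times the number of pairs; equal numbers of points in [A']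
    make the two gains cancel. *)
Lemma move_cost_scale p h g : h A' = g A' ->
  move_cost mA p (comp h) (comp g) = move_cost mA' (p * m) h g.
Proof.
move=> hg; rewrite /move_cost (restr_compress hm g mA mA') !pair_interaction_scale.
have -> : conf_restr g mA' A' = g A' by rewrite /= /mrestr setIid.
by rewrite hg; ring.
Qed.

Lemma npointsE n g : g A' = n%:R%:E -> npoints g A' = n.
Proof. by move=> gA; rewrite /npoints gA /= natrK. Qed.

Lemma conf_npoints g : g A' = (npoints g A')%:R%:E.
Proof. by have [n gn] := conf_nat g mA' bA'; rewrite (npointsE gn). Qed.

Lemma conf_n_dilation n h : conf_n A' n h <-> conf_n A n (comp h).
Proof. by []. Qed.

(** The window of index [p] dilates to the window of index [p * m], so the new limit is the old one
    along a subsequence. The converse does not follow in this way. *)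
Lemma move_cost_limit_scale g M : is_move_cost_limit mA' g M ->
  is_move_cost_limit mA (comp g) (M \o conf_expand hm).
Proof.
move=> lim; rewrite /is_move_cost_limit.
rewrite (_ : (fun p => _) = (fun p => ereal_sup
  [set `|move_cost mA' p h g - M h|%:E | h in conf_n A' (npoints g A')])
    \o (fun p => p * m)%N).
  exact: (cvg_comp _ _ (cvg_mulnr (ltnW hm)) lim).
apply/funext => p /=; congr ereal_sup; apply/seteqP; split=> _ [h hn <-].
  have hn' : conf_n A' (npoints g A') (conf_expand hm h).
    by apply/conf_n_dilation; rewrite conf_expandK.
  exists (conf_expand hm h) => //; rewrite -move_cost_scale ?conf_expandK//.
  by rewrite (conf_npoints g); case: hn'.
exists (comp h); first exact/conf_n_dilation.
by rewrite /= conf_compressK move_cost_scale// (conf_npoints g); case: hn.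
Qed.

End gibbs_scaling.

Section move_cost_limits.
Context (R : realType).
Local Notation RB := (measurableTypeR R).

(** Pointwise limits are unique, so this determines [M] on [conf_n A (npoints g A)] and makes the
    Gibbs kernel independent of the choice of [M]. *)
Lemma move_cost_limit_cvg (A : set RB) (mA : measurable A) (g : conf R) M :
  is_move_cost_limit mA g M -> forall h, conf_n A (npoints g A) h ->
  move_cost mA p h g @[p --> \oo] --> M h.
Proof.
move=> lim h hn; apply/cvgrPdist_le => e e0.
have := lim; rewrite /is_move_cost_limit => /fine_cvgP[fin].
move=> /cvgrPdist_le/(_ _ e0); apply: filter_app2 fin.
near=> p; rewrite sub0r normrN => fin /(le_trans (ler_norm _)); apply: le_trans.
rewrite distrC -lee_fin fineK//; apply: ereal_sup_ubound.
by exists h.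
Unshelve. all: by end_near. Qed.

End move_cost_limits.

(** * Pairs of points in a simple configuration *)

Section simple_configurations.
Context (R : realType).
Local Notation RB := (measurableTypeR R).
Implicit Types (g h : conf R).

Lemma conf_atom_simple h (x : R) : simple_conf h -> h [set x] != 0%E -> h [set x] = 1%E.
Proof.
move=> /(_ x); have mx : measurable ([set x] : set RB) by exact: measurable_set1.
have bx : bounded_set [set x] by apply/bounded_setP; exists `|x| => y ->.
have [[|[|k]] ->] := conf_nat h mx bx => //; first by rewrite eqxx.
by rewrite lee_fin lern1.
Qed.

(** The section of the diagonal at an atom [x] is [[set x]], of mass [1] by simplicity; points other
    than the atoms form a null set. *)
Lemma conf_prod_diagonal h (A : set RB) : measurable A -> bounded_set (A : set R) ->
  simple_conf h -> conf_prod h h (A `*` A `&` @diagonal_set R) = h A.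
Proof.
move=> mA bA sh; have [s [_ sA hs]] := conf_finite_support h mA bA.
have mAd : measurable (A `*` A `&` @diagonal_set R).
  by apply: measurableI; [exact: measurableX|exact: measurable_diagonal].
have -> : h A = (\int[h]_x (\1_A x)%:E)%E by rewrite integral_indic ?setIT.
apply: ae_eq_integral => //.
- exact: (@measurable_fun_xsection _ _ RB RB R (conf_fun h)).
- by apply/measurable_EFinP; exact: measurable_indic.
exists (A `\` [set` s]); split.
- by apply: measurableD => //; exact: measurable_seq.
- exact: hs.
move=> x /= nx.
have [Ax|Ax] := pselect (A x); last first.
  exfalso; apply: nx => _; rewrite indicE memNset//=.
  rewrite (_ : xsection _ _ = set0) ?measure0//.
  by apply/seteqP; split=> y //; rewrite /xsection /= inE => -[[/= xA _] _].
split=> // xs; apply: nx => _; have [_ hx] := sA x xs.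
rewrite indicE mem_set//= (_ : xsection _ _ = [set x]).
  exact: conf_atom_simple.
apply/seteqP; split=> y; rewrite /xsection /= inE.
  by move=> [_]; rewrite /diagonal_set /= => ->.
by move=> ->.
Qed.

Lemma conf_prod_offdiagonal h (A : set RB) n : measurable A -> bounded_set (A : set R) ->
  simple_conf h -> h A = n%:R%:E ->
  conf_prod h h (A `*` A `\` @diagonal_set R) = (n%:R * n%:R - n%:R)%:E.
Proof.
move=> mA bA sh hA.
have mAA : measurable (A `*` A : set (RB * RB)) by exact: measurableX.
have fin : (conf_prod h h (A `*` A) < +oo)%E by rewrite conf_prod_rect// hA -EFinM ltry.
rewrite (measureD mAA (@measurable_diagonal R) fin).
rewrite EFinB EFinM -hA -(conf_prod_rect h h mA mA); congr (_ - _)%E.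
exact: conf_prod_diagonal.
Qed.

End simple_configurations.

(** * Binomial laws and Boltzmann weights under dilation *)

Section boltzmann_scaling.
Context (R : realType).
Local Notation RB := (measurableTypeR R).
Local Notation mu := (@lebesgue_measure R).

Definition bin_measure n (A : set RB) (mA : measurable A) : {measure set (conf R) -> \bar R} :=
  image_measure (iid (uniform_on mA) n) (@measurable_conf_of_seq R n).

Lemma lebesgue_bounded_lty (A : set RB) : measurable A -> bounded_set (A : set R) ->
  (mu A < +oo)%E.
Proof.
move=> mA /bounded_setP[M AM].
apply: (@le_lt_trans _ _ (mu (`[- M, M]%classic : set RB))).
  apply: le_measure; rewrite ?inE//.
  by move=> x /AM; rewrite /= in_itv/= -ler_norml.
by rewrite lebesgue_measure_itv/=; case: ifPn => _; rewrite -?EFinB ltry.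
Qed.

Lemma uniform_onE (A B : set RB) (mA : measurable A) : (0 < mu A)%E -> (mu A < +oo)%E ->
  uniform_on mA B = (mu (B `&` A) * (fine (mu A))^-1%:E)%E.
Proof.
move=> A0 Aoo.
have TE : mrestr mu mA setT = mu A by rewrite /mrestr setTI.
change (mnormalize (mrestr mu mA) (\d_(0 : RB)) B = (mu (B `&` A) * (fine (mu A))^-1%:E)%E).
by rewrite /mnormalize /= TE gt_eqF//= lt_eqF.
Qed.

Variables (m : nat) (hm : (1 < m)%N) (A : set RB) (mA : measurable A).
Hypothesis bA : bounded_set (A : set R).
Hypothesis A_gt0 : (0 < mu A)%E.
Local Notation comp := (conf_compress hm).
Implicit Types (g h : conf R).

Let A' : set RB := (fun x : R => x / m%:R) @^-1` A.
Let mA' : measurable A' := measurable_dilation m mA.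
Let bA' : bounded_set (A' : set R) := bounded_dilation hm bA.

Let m_gt0 : 0 < m%:R :> R. Proof. by rewrite ltr0n; case: m hm. Qed.

Lemma dilation_gt0 : (0 < mu A')%E.
Proof. by rewrite lebesgue_measure_scale// mule_gt0// lte_fin. Qed.

Lemma uniform_on_dilation (B : set RB) : measurable B ->
  uniform_on mA B = uniform_on mA' ((fun x : R => x / m%:R) @^-1` B).
Proof.
move=> mB.
rewrite !uniform_onE ?dilation_gt0 ?lebesgue_bounded_lty//.
have mBA : measurable (B `&` A) by exact: measurableI.
have -> : (fun x : R => x / m%:R) @^-1` B `&` A' = (fun x : R => x / m%:R) @^-1` (B `&` A).
  by [].
rewrite !lebesgue_measure_scale//.
have Afin : mu A \is a fin_num by rewrite ge0_fin_numE ?lebesgue_bounded_lty.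
rewrite fineM// invfM [X in (_ = _ * X)%E]EFinM muleACA -EFinM divff ?mul1e//.
exact: lt0r_neq0.
Qed.

Lemma Bin_dilation n (C : set (conf R)) : measurable C ->
  Bin n mA C = Bin n mA' (comp @^-1` C).
Proof.
move=> mC.
have mC' : measurable ((fun t : n.-tuple RB => conf_of_seq t) @^-1` C).
  by rewrite -[X in measurable X]setTI; exact: measurable_conf_of_seq.
rewrite /Bin /pushforward.
rewrite (@iid_image _ RB R (uniform_on mA') (uniform_on mA) (fun x : R => x / m%:R)
  (fun x : R => x * m%:R))//.
- congr (iid _ _ _); apply/funext => t; congr (C _).
  by rewrite /= compress_conf_of_seq.
- exact: measurable_compress.
- exact: measurable_expand.
- exact: divmK.
- exact: mulmK.
- exact: uniform_on_dilation.
Qed.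

Lemma Bin_integral n (D : set (conf R)) f :
  (\int[Bin n mA]_(h in D) f h = \int[Bin n mA']_(h in comp @^-1` D) f (comp h))%E.
Proof.
apply: (@integral_image_bij _ _ _ _ _ (bin_measure n mA') (bin_measure n mA) comp
  (conf_expand hm)).
- exact: measurable_conf_compress.
- exact: measurable_conf_expand.
- exact: conf_compressK.
- exact: conf_expandK.
- exact: Bin_dilation.
Qed.

Lemma simple_compress h : simple_conf (comp h) <-> simple_conf h.
Proof.
have E x : comp h [set x / m%:R] = h [set x].
  change (h ((fun y : R => y / m%:R) @^-1` [set x / m%:R]) = h [set x]).
  congr (h _); apply/seteqP; split=> y /=; last by move=> ->.
  by move=> /(congr1 (fun z => z * m%:R)); rewrite !divmK.
split=> sh x; first by rewrite -E.
by rewrite -[x](mulmK hm) E.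
Qed.

(** A gain of [ln m] for each of the [n (n - 1) / 2] unordered pairs of distinct points. *)
Definition energy_shift (n : nat) : R := 2^-1 * (ln m%:R * (n%:R * n%:R - n%:R)).

Lemma energy_H_scale n h : conf_n A' n h ->
  energy_H A (comp h) = (energy_H A' h + (energy_shift n)%:E)%E.
Proof.
move=> [_ hn]; rewrite /energy_H.
case: asboolP => [/simple_compress sh|nsh]; last first.
  by case: asboolP => // /simple_compress.
case: asboolP => // _.
have mZ : measurable (A' `*` A' `\` @diagonal_set R).
  by apply: measurableD; [exact: measurableX|exact: measurable_diagonal].
rewrite conf_prod_integral (_ : _ @^-1` _ = A' `*` A' `\` @diagonal_set R); last first.
  apply/seteqP; split=> -[x y] [/= Axy xy]; split=> //= xy'; apply: xy.
    by rewrite /diagonal_set /= /scale2 /=; rewrite /diagonal_set /= in xy'; rewrite xy'.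
  have /= := congr1 (fun z => z * m%:R) xy'.
  by rewrite !divmK.
have ZA : A' `*` A' `\` @diagonal_set R `<=` A' `*` A' by move=> z [].
rewrite (log_integral_scale hm h h mA' bA' mA' bA' mZ ZA); last first.
  by move=> z [_ /eqP].
rewrite (conf_prod_offdiagonal mA' bA' sh hn) muleDr//.
exact: fin_num_adde_defl.
Qed.

Lemma boltzmann_scale (beta : R) M M' n h : 0 < beta -> conf_n A' n h -> M (comp h) = M' h ->
  boltzmann beta A M (comp h) =
  ((expR (- beta * energy_shift n))%:E * boltzmann beta A' M' h)%E.
Proof.
move=> b0 hn Mh; rewrite /boltzmann (energy_H_scale hn) Mh.
have nb : - beta < 0 by rewrite oppr_lt0.
case: (energy_H A' h) => [r| |] /=.
- by rewrite -?EFinM -expRD; congr (expR _)%:E; ring.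
- by rewrite -?EFinN lt0_muley ?lte_fin//= mule0.
- by rewrite -?EFinN lt0_muleNy ?lte_fin//= gt0_muley// lte_fin expR_gt0.
Qed.

Lemma boltzmann_ge0 (beta : R) (B : set RB) M h : (0 <= boltzmann beta B M h)%E.
Proof. exact: expeR_ge0. Qed.

Lemma boltzmann_integral_scale (beta : R) M M' n (D : set (conf R)) : 0 < beta ->
  D `<=` conf_n A n -> (forall h, conf_n A' n h -> M (comp h) = M' h) ->
  (\int[Bin n mA]_(h in D) boltzmann beta A M h =
   (expR (- beta * energy_shift n))%:E *
   \int[Bin n mA']_(h in comp @^-1` D) boltzmann beta A' M' h)%E.
Proof.
move=> b0 Dn MM'; rewrite Bin_integral.
rewrite -(@integral_scale _ _ _ (bin_measure n mA')) ?expR_gt0//; last first.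
  by move=> *; exact: boltzmann_ge0.
apply: (@eq_integral _ _ _ (bin_measure n mA')) => h /set_mem Dh.
have hn : conf_n A' n h by exact: (Dn _ Dh).
by rewrite (boltzmann_scale b0 hn (MM' h hn)).
Qed.

Lemma partition_function_scale (beta : R) M M' g : 0 < beta ->
  (forall h, conf_n A' (npoints g A') h -> M (comp h) = M' h) ->
  partition_function beta mA (comp g) M =
  ((expR (- beta * energy_shift (npoints g A')))%:E *
   partition_function beta mA' g M')%E.
Proof.
move=> b0 MM'.
exact: (@boltzmann_integral_scale beta M M' (npoints g A') (conf_n A (npoints g A'))).
Qed.

Lemma gibbs_scale (beta : R) M M' g C : 0 < beta ->
  (forall h, conf_n A' (npoints g A') h -> M (comp h) = M' h) ->
  gibbs beta mA (comp g) M C = gibbs beta mA' g M' (comp @^-1` C).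
Proof.
move=> b0 MM'; rewrite /gibbs (partition_function_scale b0 MM').
have Dn : C `&` conf_n A (npoints g A') `<=` conf_n A (npoints g A') by move=> h [].
have -> : (\int[Bin (npoints (comp g) A) mA]_(h in C `&` conf_n A (npoints (comp g) A))
    boltzmann beta A M h = _)%E := boltzmann_integral_scale b0 Dn MM'.
set k := expR _; have k0 : 0 < k by exact: expR_gt0.
rewrite muleA; congr (_ * _)%E.
(* The identity includes infinite partition functions, for which [fine] returns [0] on both
   sides. *)
rewrite (_ : fine _ = k * fine (partition_function beta mA' g M')); last first.
  case: (partition_function beta mA' g M') => [z| |] //=.
    by rewrite gt0_muley ?lte_fin// mulr0.
  by rewrite gt0_muleNy ?lte_fin// mulr0.
by rewrite -EFinM invfM mulrAC mulVf ?mul1r// lt0r_neq0.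
Qed.

End boltzmann_scaling.

(** * Compressed laws *)

Section compressed_DLR.
Context (R : realType).
Local Notation RB := (measurableTypeR R).
Local Notation mu := (@lebesgue_measure R).

HB.instance Definition _ m (hm : (1 < m)%N) :=
  isMeasurableFun.Build _ _ _ _ (@conf_expand R m hm) (measurable_conf_expand hm).

Section sigma_fields.
Variables (m : nat) (hm : (1 < m)%N) (A : set RB).
Let A' : set RB := (fun x : R => x / m%:R) @^-1` A.

Let expandE (g : conf R) (B : set RB) :
  conf_expand hm g B = g ((fun x : R => x * m%:R) @^-1` B).
Proof. by []. Qed.

(** The sets whose preimage lies in the target form a sigma-algebra, so it is enough to check the
    generators; expanding turns a count on [B] into a count on its compression. *)
Lemma sigma_local_expand (C : set (conf R)) :
  sigma_local (~` A') C -> sigma_local (~` A) (conf_expand hm @^-1` C).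
Proof.
pose H := image_set_system setT (conf_expand hm) (@sigma_local R (~` A)).
have sH : sigma_algebra setT H.
  by apply: sigma_algebra_image; exact: smallest_sigma_algebra.
suff : @sigma_local R (~` A') `<=` H by move=> /(_ C) HC /HC; rewrite /H /image_set_system /= setTI.
apply: smallest_sub => // _ [B [Y [mB bB BA mY ->]]]; rewrite /H /image_set_system /= setTI.
apply: sub_sigma_algebra.
exists ((fun x : R => x * m%:R) @^-1` B), Y; split => //.
- by rewrite -[X in measurable X]setTI; exact: measurable_expand.
- exact: bounded_expand.
- by move=> x /BA; rewrite /A' /= mulmK.
Qed.

Lemma sigma_can_expand (C : set (conf R)) :
  sigma_can A' C -> sigma_can A (conf_expand hm @^-1` C).
Proof.
pose H := image_set_system setT (conf_expand hm) (@sigma_can R A).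
have sH : sigma_algebra setT H.
  by apply: sigma_algebra_image; exact: smallest_sigma_algebra.
suff : @sigma_can R A' `<=` H by move=> /(_ C) HC /HC; rewrite /H /image_set_system /= setTI.
apply: smallest_sub => // D [|[Y mY <-]]; rewrite /H /image_set_system /= setTI.
  by move=> /sigma_local_expand ?; apply: sub_sigma_algebra; left.
apply: sub_sigma_algebra; right; exists Y => //; apply/funext => g.
rewrite /preimage /= (_ : conf_expand hm g A' = g A)// expandE; congr (g _).
by apply/seteqP; split=> x; rewrite /A' /= mulmK.
Qed.

End sigma_fields.

Lemma completion_expand m (hm : (1 < m)%N) (S : probability (conf R) R)
    (G G' : set (set (conf R))) (C : set (conf R)) :
  (forall B, G' B -> G (conf_expand hm @^-1` B)) ->
  completion S G' C -> completion (compressed_law hm S) G (conf_expand hm @^-1` C).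
Proof.
move=> GG' [B1 [B2 [GB1 GB2 B1C CB2 B12]]].
exists (conf_expand hm @^-1` B1), (conf_expand hm @^-1` B2); split.
- exact: GG'.
- exact: GG'.
- by move=> g; exact: B1C.
- by move=> g; exact: CB2.
- by rewrite -[RHS]B12; exact: (congr1 S (expand_preimageK hm (B2 `\` B1))).
Qed.

Lemma compressed_integral m (hm : (1 < m)%N) (S : probability (conf R) R) D f :
  (\int[compressed_law hm S]_(g in D) f g =
   \int[S]_(g in conf_compress hm @^-1` D) f (conf_compress hm g))%E.
Proof.
apply: (@integral_image_bij _ _ _ _ _ S (compressed_law hm S) (conf_compress hm)
  (conf_expand hm)).
- exact: measurable_conf_compress.
- exact: measurable_conf_expand.
- exact: conf_compressK.
- exact: conf_expandK.
- by [].
Qed.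

Lemma compressed_DLR m (hm : (1 < m)%N) (beta : R) (S : probability (conf R) R) :
  0 < beta -> canonical_DLR beta S -> canonical_DLR beta (compressed_law hm S).
Proof.
move=> b0 DLR A mA bA A0.
pose A' : set RB := (fun x : R => x / m%:R) @^-1` A.
pose mA' : measurable A' := measurable_dilation m mA.
have bA' : bounded_set (A' : set R) := bounded_dilation hm bA.
have A'0 : (0 < mu A')%E := dilation_gt0 hm mA A0.
have [U [uU aeU admU [K [K1 K2 K3]]]] := DLR A' mA' bA' A'0.
exists (conf_expand hm @^-1` U); split.
- move=> Q.
  have [B1 [B2 [mB1 mB2 B1U UB2 B12]]] := uU (distribution Q (conf_expand hm)).
  exists (conf_expand hm @^-1` B1), (conf_expand hm @^-1` B2); split.
  + by rewrite -[X in measurable X]setTI; exact: measurable_conf_expand.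
  + by rewrite -[X in measurable X]setTI; exact: measurable_conf_expand.
  + by move=> g; exact: B1U.
  + by move=> g; exact: UB2.
  + exact: B12.
- have [N [mN N0 UN]] := aeU; exists (conf_expand hm @^-1` N); split.
  + by rewrite -[X in measurable X]setTI; exact: measurable_conf_expand.
  + by rewrite -[RHS]N0; exact: (congr1 S (expand_preimageK hm _)).
  + by move=> g /= gU; exact: UN.
- move=> g Ug; have [M [Mlim Z]] := admU _ Ug.
  exists (M \o conf_expand hm); rewrite -[g](conf_expandK hm); split.
    exact: move_cost_limit_scale.
  rewrite (@partition_function_scale _ m hm A mA bA A0 beta _ M)//; last first.
    by move=> h _ /=; rewrite conf_compressK.
  case/andP: Z => Z0 Zoo; rewrite mule_gt0 ?lte_fin ?expR_gt0//=.
  by rewrite lte_mul_pinfty// ?lee_fin ?expR_ge0.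
exists (fun g => distribution (K (conf_expand hm g)) (conf_compress hm)); split.
- move=> g M Ug Mlim C mC.
  (* The given [M] controls the dilated set only along windows of index [p * m], too little to apply
     [K1] directly. Admissibility supplies a limit [M'] along all windows, and the two agree by
     uniqueness of limits along the subsequence. *)
  have [M' [M'lim _]] := admU _ Ug.
  rewrite -(conf_expandK hm g) in Mlim *; set g' := conf_expand hm g in Ug M'lim Mlim *.
  rewrite conf_compressK.
  rewrite (@gibbs_scale _ m hm A mA bA A0 beta M M' g' C b0); last first.
    move=> h hn.
    have hn' : conf_n A (npoints (conf_compress hm g') A) (conf_compress hm h) by exact: hn.
    have lim1 := move_cost_limit_cvg Mlim hn'.
    have hg : h A' = g' A' by rewrite (conf_npoints hm mA bA g'); case: hn.
    have lim2 : move_cost mA p (conf_compress hm h) (conf_compress hm g') @[p --> \oo]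
        --> M' h.
      under eq_fun do rewrite (move_cost_scale hm mA bA _ hg).
      exact: (cvg_comp _ _ (cvg_mulnr (ltnW hm)) (move_cost_limit_cvg M'lim hn)).
    exact: (cvg_unique _ lim1 lim2).
  have mC' : measurable (conf_compress hm @^-1` C).
    by rewrite -[X in measurable X]setTI; exact: measurable_conf_compress.
  exact: (K1 _ _ Ug M'lim _ mC').
- move=> C mC Y mY.
  have mC' : measurable (conf_compress hm @^-1` C).
    by rewrite -[X in measurable X]setTI; exact: measurable_conf_compress.
  have := K2 _ mC' Y mY; apply: (@completion_expand m hm S) => B.
  exact: sigma_can_expand.
- move=> F mF [c Fc]; rewrite compressed_integral preimage_setT.
  rewrite (K3 (F \o conf_compress hm)); first last.
  + by exists c => g; exact: Fc.
  + by apply: measurableT_comp => //; exact: measurable_conf_compress.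
  rewrite compressed_integral preimage_setT; apply: eq_integral => g _.
  rewrite conf_compressK [RHS](compressed_integral hm (K g)).
  apply: eq_integral => h _ /=; congr (F _)%:E.
  by rewrite compress_add (restr_compress hm g (measurableC mA) (measurableC mA')).
Qed.

Lemma compressed_stationary m (hm : (1 < m)%N) (S : probability (conf R) R) :
  stationary S -> stationary (compressed_law hm S).
Proof.
move=> statS t C mC.
have mC' : measurable (conf_compress hm @^-1` C).
  by rewrite -[X in measurable X]setTI; exact: measurable_conf_compress.
rewrite -[RHS](statS (t * m%:R) _ mC').
apply: (congr1 S); apply/funext => g; apply: (congr1 C); exact: shift_compress.
Qed.

Lemma compressed_intensity m (hm : (1 < m)%N) (S : probability (conf R) R) :
  has_intensity 1 S -> has_intensity m%:R (compressed_law hm S).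
Proof.
move=> intS B mB bB; rewrite compressed_integral preimage_setT.
rewrite -lebesgue_measure_scale//; last by rewrite ltr0n; case: m hm.
rewrite -[RHS]mul1e; apply: intS.
  by rewrite -[X in measurable X]setTI; exact: measurable_compress.
exact: bounded_compress.
Qed.

Lemma vacuum_intensity : has_intensity 0 (vacuum R).
Proof.
move=> B mB bB; rewrite mul0e integral_dirac//; last exact: measurable_eval.
by rewrite diracT mul1e.
Qed.

Lemma intensity_neq_law (a b : R) (P Q : probability (conf R) R) :
  has_intensity a P -> has_intensity b Q -> a != b -> ~ same_law P Q.
Proof.
move=> Pa Qb ab PQ; pose B : set RB := `[0, 1]%classic.
have mB : measurable B by exact: measurable_itv.
have bB : bounded_set (B : set R) by exact: bounded_itv.
have : (\int[P]_g g B = \int[Q]_g g B)%E.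
  by apply: eq_measure_integral => C mC _; exact: PQ.
rewrite Pa// Qb// lebesgue_measure_itv/= lte_fin ltr01 oppr0 adde0 !mule1.
by move=> [/eqP]; exact/negP.
Qed.

End compressed_DLR.

(** * Simplicity *)

Section almost_sure_simplicity.
Context (R : realType).
Local Notation RB := (measurableTypeR R).
Local Notation mu := (@lebesgue_measure R).
Implicit Types (g h : conf R).

(** A measurable substitute for a multiple point in [[- k, k[]: at every mesh some cell holds two
    points, which finitely many distinct simple points cannot achieve. *)
Definition crowded (k : nat) : set (conf R) :=
  \bigcap_n \bigcup_(j in [set j | (j < k.*2 * n.+1)%N])
    [set h | (2%:R%:E <= h (@grid R k n j))%E].

Lemma measurable_crowded k : measurable (crowded k).
Proof.
apply: bigcapT_measurable => n; apply: bigcup_measurable => j _.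
have := @emeasurable_fun_c_infty _ _ _ _ _ measurableT
  (measurable_eval (@measurable_grid R k n j)) 2%:R%:E.
by rewrite setTI.
Qed.

Lemma separation (s : seq R) :
  exists2 d : R, 0 < d & forall x, x \in s -> x != 0 -> d <= `|x|.
Proof.
elim: s => [|x s [d d0 sd]]; first by exists 1.
have [->|x0] := eqVneq x 0.
  by exists d => // y; rewrite inE => /predU1P[->|]; [rewrite eqxx|exact: sd].
exists (Num.min d `|x|); first by rewrite lt_min d0 normr_gt0.
move=> y; rewrite inE => /predU1P[->|ys y0]; first by rewrite ge_min lexx orbT.
by rewrite ge_min sd.
Qed.

Lemma crowded_not_simple k h : crowded k h -> ~ simple_conf h.
Proof.
move=> ck sh; pose A : set RB := `[- k%:R, k%:R[%classic.
have mA : measurable A by exact: measurable_itv.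
have bA : bounded_set (A : set R) by exact: bounded_itv.
have [s [_ sA hs]] := conf_finite_support h mA bA.
have [d d0 sd] := separation [seq x - y | x <- s, y <- s].
(* The mesh is now below the least distance between two atoms in [s], so no cell contains two of
   them. *)
pose n := Num.truncn d^-1.
have nd : n.+1%:R^-1 < d by rewrite invf_plt ?posrE// truncnS_gt.
have [j /= jk] := ck n I; apply/negP; rewrite -ltNge.
have gA : grid k n j `<=` A by rewrite /A -(bigcup_grid R k n) => x gx; exists j.
have mg := @measurable_grid R k n j.
have le1 : (h (grid k n j `&` [set` s]) <= 1)%E.
  have [[x [gx /= xs]]|no] := pselect (exists x, grid k n j x /\ x \in s); last first.
    rewrite (_ : _ `&` _ = set0) ?measure0//.
    by apply/seteqP; split=> // x [gx xs]; apply: no; exists x.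
  rewrite (_ : _ `&` _ = [set x]); first exact: sh.
  apply/seteqP; split=> [y [gy /= ys]|y -> //].
  apply/eqP; apply: contraTT isT => yx; rewrite -[~~ _]/(false) -(ltxx (n.+1%:R^-1 : R)).
  have := sd (y - x); rewrite subr_eq0 => /(_ (allpairs_f _ ys xs) yx) dyx.
  apply: (lt_trans nd); apply: (le_lt_trans dyx).
  move: gx gy; rewrite /grid /= !in_itv/= -[j.+1]addn1 natrD mulrDl div1r.
  move: (j%:R / _) => u; move: (_^-1) => v /andP[ux xu] /andP[uy yu].
  by rewrite ltr_norml; apply/andP; split; lra.
apply: (@le_lt_trans _ _ (h (grid k n j `&` [set` s]) + h (A `\` [set` s]))%E).
  apply: (@le_trans _ _ (h ((grid k n j `&` [set` s]) `|` (A `\` [set` s])))%E).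
    apply: le_measure; rewrite ?inE//.
      apply: measurableU; first by apply: measurableI => //; exact: measurable_seq.
      by apply: measurableD => //; exact: measurable_seq.
    move=> x gx; have [xs|xs] := pselect (x \in s); first by left.
    by right; split=> //; exact: gA.
  rewrite measureU2//; first by apply: measurableI => //; exact: measurable_seq.
  by apply: measurableD => //; exact: measurable_seq.
by rewrite hs adde0 (le_lt_trans le1)// lte_fin ltr1n.
Qed.

Lemma not_simple_crowded h : ~ simple_conf h -> exists k, crowded k.+1 h.
Proof.
move=> /existsNP[x /negP]; rewrite -ltNge => hx.
exists (Num.truncn `|x|) => n _; set k := (_).+1.
have xk : `|x| < k%:R by exact: truncnS_gt.
have : (`[- k%:R, k%:R[%classic : set R) x.
  by rewrite /= in_itv/=; move: xk; rewrite ltr_norml => /andP[/ltW -> ->].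
rewrite -(bigcup_grid R k n) => -[j /= jk gx]; exists j => //=.
have mx : measurable ([set x] : set RB) by exact: measurable_set1.
apply: (@le_trans _ _ (h [set x])).
  have bx : bounded_set [set x] by apply/bounded_setP; exists `|x| => y ->.
  have [l hl] := conf_nat h mx bx; move: hx; rewrite hl lte_fin lee_fin.
  by rewrite ltr1n ler_nat.
by apply: le_measure; rewrite ?inE//; [exact: measurable_grid|move=> y ->].
Qed.

(** All cells involved lie in [A], where the outer configuration has no points. In the DLR equation
    the event thus concerns the resampled configuration alone. *)
Lemma crowded_local k h g (A : set RB) (mA : measurable A) :
  A = `[- k%:R, k%:R[%classic ->
  crowded k (conf_add h (conf_restr g (measurableC mA))) <-> crowded k h.
Proof.
move=> AE; suff E n j : (j < k.*2 * n.+1)%N ->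
    conf_add h (conf_restr g (measurableC mA)) (grid k n j) = h (grid k n j).
  by split=> ck n _; have [j jk hj] := ck n I; exists j => //; move: hj;
    rewrite /= E.
move=> jk; rewrite [LHS]measure_addE /= /mrestr (_ : _ `&` _ = set0).
  by rewrite measure0 adde0.
apply/seteqP; split=> // x [gx]; apply; rewrite AE -(bigcup_grid R k n).
by exists j.
Qed.

Lemma DLR_simple (beta : R) (P : probability (conf R) R) :
  0 < beta -> canonical_DLR beta P -> {ae P, forall g, simple_conf g}.
Proof.
move=> b0 DLR.
have null k : P (crowded k.+1) = 0%E.
  pose A : set RB := `[- k.+1%:R, k.+1%:R[%classic.
  have mA : measurable A by exact: measurable_itv.
  have bA : bounded_set (A : set R) by exact: bounded_itv.
  have A0 : (0 < mu A)%E.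
    by rewrite lebesgue_measure_itv/= lte_fin gtrN// -EFinB lte_fin subr_gt0 gtrN.
  have [U [_ [N [mN N0 UN]] adm [K [K1 _ K3]]]] := DLR A mA bA A0.
  have mD := measurable_crowded k.+1.
  (* On a crowded configuration the energy is [+oo], so the Gibbs weight is zero throughout the
     event. *)
  have K0 g : U g -> K g (crowded k.+1) = 0%E.
    move=> Ug; have [M [Mlim _]] := adm g Ug.
    rewrite (K1 g M Ug Mlim _ mD) /gibbs.
    rewrite (@integral0_eq _ _ _ (bin_measure _ mA)) ?mule0// => h [ch _].
    rewrite /boltzmann /energy_H asboolF; last exact: crowded_not_simple ch.
    by rewrite addye// -EFinN lt0_muley// lte_fin oppr_lt0.
  have mF : measurable_fun setT (\1_(crowded k.+1) : conf R -> R) by exact: measurable_indic.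
  have bF : exists c : R, forall g, `|\1_(crowded k.+1) g| <= c.
    by exists 1 => g; rewrite indicE; case: (_ \in _); rewrite ?normr1 ?normr0.
  have := K3 _ mF bF; rewrite integral_indic// setIT => ->.
  (* The outer integrand is controlled only on [U], that is, off the measurable null set [N]. *)
  apply: (@integral0_off_null _ _ _ P setT N) => //.
    by move=> g _; apply: integral_ge0 => h _; rewrite lee_fin.
  move=> g _ Ng; have Ug : U g by apply: contrapT => /UN.
  apply/eqP; rewrite eq_le; apply/andP; split; last first.
    by apply: integral_ge0 => h _; rewrite lee_fin.
  rewrite -(K0 g Ug) -[X in (_ <= K g X)%E]setIT -integral_indic//.
  rewrite [leLHS]integral_mkcond; apply: le_lower_integral => h _.
    by apply: erestrict_ge0 => *; rewrite lee_fin.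
  rewrite /patch; case: ifPn => _; last by rewrite lee_fin.
  rewrite lee_fin !indicE; case: (pselect (crowded k.+1 h)) => ch.
    by rewrite (mem_set ch) lern1 leq_b1.
  by rewrite !memNset// => /crowded_local -/(_ erefl).
suff : P.-negligible (\bigcup_k crowded k.+1).
  by apply: negligibleS => g /not_simple_crowded[k ck]; exists k.
apply: negligible_bigcup => k; exists (crowded k.+1); split => //; last exact: null.
exact: measurable_crowded.
Qed.

End almost_sure_simplicity.

(** * The vacuum *)

Section vacuum.
Context (R : realType).
Local Notation RB := (measurableTypeR R).
Local Notation mu := (@lebesgue_measure R).
Implicit Types (g h : conf R).

Lemma vacuum_stationary : stationary (vacuum R).
Proof.
move=> t C mC; change (@dirac _ _ (conf0 R) R (conf_shift t @^-1` C) =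
  @dirac _ _ (conf0 R) R C); rewrite !diracE; congr ((nat_of_bool _)%:R%:E).
have E : conf_shift t (conf0 R) = conf0 R by exact: conf_eq.
by apply/idP/idP; rewrite !inE /preimage /= E.
Qed.

(** Replaces the singleton of [conf0 R]: this is a measurable event, and it also contains the
    records that vanish on Borel sets but differ from [conf0 R] elsewhere. *)
Definition empty_confs : set (conf R) := [set g | g setT = 0%E].

Lemma measurable_empty_confs : measurable empty_confs.
Proof.
have := @measurable_eval R setT measurableT measurableT [set 0%E] (emeasurable_set1 _).
by rewrite setTI.
Qed.

Lemma empty_conf_eval g (B : set RB) : empty_confs g -> measurable B -> g B = 0%E.
Proof.
move=> g0 mB; apply/eqP; rewrite eq_le measure_ge0 andbT -g0.
by apply: le_measure; rewrite ?inE.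
Qed.

Lemma empty_conf_n g (A : set RB) h : measurable A -> empty_confs g ->
  conf_n A (npoints g A) h -> empty_confs h.
Proof.
move=> mA g0; rewrite /npoints (empty_conf_eval g0 mA) /= truncn0.
move=> [hAC hA]; rewrite /empty_confs /= -(setUv A).
rewrite (measureU h mA (measurableC mA) (setICr A)).
by rewrite -[RHS]adde0; congr (_ + _)%E; [exact: hA|exact: hAC].
Qed.

Lemma conf0_empty : empty_confs (conf0 R). Proof. by []. Qed.

Lemma empty_conf_integral h (D : set RB) f : empty_confs h -> (\int[h]_(x in D) f x = 0)%E.
Proof.
move=> h0; rewrite -[RHS](integral_measure_zero D f).
by apply: eq_measure_integral => B mB _; rewrite empty_conf_eval.
Qed.

Lemma empty_conf_prod h g (D : set (RB * RB)) f : empty_confs h ->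
  (\int[h \x g]_(z in D) f z = 0)%E.
Proof.
move=> h0; rewrite -[RHS](integral_measure_zero D f).
apply: (@eq_measure_integral _ _ _ D mzero (conf_prod h g)) => B mB _.
exact: empty_conf_integral.
Qed.

Lemma empty_move_cost h g (A : set RB) (mA : measurable A) p :
  empty_confs h -> empty_confs g -> move_cost mA p h g = 0.
Proof.
move=> h0 g0; rewrite /move_cost /pair_interaction !empty_conf_prod ?subrr//.
exact: (empty_conf_eval g0 (measurableI _ _ measurableT mA)).
Qed.

Lemma empty_boltzmann (beta : R) (A : set RB) M h : empty_confs h -> M h = 0 ->
  boltzmann beta A M h = 1%E.
Proof.
move=> h0 Mh; rewrite /boltzmann /energy_H asboolT; last first.
  by move=> x; rewrite (empty_conf_eval h0 (measurable_set1 x)).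
by rewrite empty_conf_prod// mule0 Mh adde0 mule0 expeR0.
Qed.

Lemma Bin0 (A : set RB) (mA : measurable A) (C : set (conf R)) :
  Bin 0 mA C = \d_(conf0 R) C.
Proof.
by rewrite /Bin /pushforward /= !diracE; congr ((nat_of_bool _)%:R%:E).
Qed.

Lemma vacuum_boltzmann_integral (beta : R) (A : set RB) (mA : measurable A) g M C :
  empty_confs g -> measurable C -> (forall h, empty_confs h -> M h = 0) ->
  (\int[Bin (npoints g A) mA]_(h in C `&` conf_n A (npoints g A))
     boltzmann beta A M h = \d_(conf0 R) C)%E.
Proof.
move=> g0 mC M0.
have np : npoints g A = 0%N by rewrite /npoints (empty_conf_eval g0 mA) /= truncn0.
have mn := @measurable_conf_n R A 0 mA.
rewrite (@eq_integral _ _ _ (bin_measure (npoints g A) mA) _ (cst 1%E)); last first.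
  move=> h /set_mem[_ /(empty_conf_n mA g0) h0].
  by rewrite empty_boltzmann// M0.
rewrite np (integral_cst (bin_measure 0 mA)); last exact: measurableI.
rewrite mul1e; change (Bin 0 mA (C `&` conf_n A 0) = \d_(conf0 R) C).
rewrite Bin0 !diracE; congr ((nat_of_bool _)%:R%:E).
by apply/idP/idP; rewrite !inE; first by case.
Qed.

Lemma sigma_canT (A : set RB) : @sigma_can R A setT.
Proof.
have [G0 GD _] := smallest_sigma_algebra setT
  (sigma_local (~` A) `|` [set (fun g : conf R => g A) @^-1` Y | Y in measurable]).
by have := GD _ G0; rewrite setD0.
Qed.

(** On empty configurations energy and move cost vanish, so the Boltzmann weight and the partition
    function are [1] and the Gibbs kernel is constantly the vacuum law. *)
Lemma vacuum_DLR (beta : R) : canonical_DLR beta (vacuum R).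
Proof.
move=> A mA bA A0; exists empty_confs.
have limE g M : empty_confs g -> is_move_cost_limit mA g M ->
    forall h, empty_confs h -> conf_n A (npoints g A) h -> M h = 0.
  move=> g0 /move_cost_limit_cvg lim h h0 /lim.
  under eq_fun do rewrite empty_move_cost//.
  by move=> lim0; apply: (cvg_unique _ lim0) => //; exact: cvg_cst.
have limE' g M : empty_confs g -> is_move_cost_limit mA g M ->
    forall h, empty_confs h -> M h = 0.
  move=> g0 lim h h0; apply: (limE g) => //; split.
    by apply: empty_conf_eval => //; exact: measurableC.
  by rewrite /npoints !(empty_conf_eval _ mA) /= ?truncn0.
have lim0 g : empty_confs g -> is_move_cost_limit mA g (cst 0).
  move=> g0; rewrite /is_move_cost_limit.
  rewrite (_ : (fun p => _) = cst 0%E); first exact: cvg_cst.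
  apply/funext => p; rewrite (_ : [set _ | _ in _] = [set 0%E]) ?ereal_sup1//.
  apply/seteqP; split=> [_ [h hn <-]|_ ->].
    by rewrite empty_move_cost ?subrr ?normr0//; exact: (empty_conf_n mA g0 hn).
  exists (conf0 R); last by rewrite empty_move_cost ?subrr ?normr0.
  by split => //; rewrite /npoints (empty_conf_eval g0 mA) /= truncn0.
have Z1 g M : empty_confs g -> (forall h, empty_confs h -> M h = 0) ->
    partition_function beta mA g M = 1%E.
  move=> g0 M0; rewrite /partition_function -[conf_n _ _]setTI.
  by rewrite vacuum_boltzmann_integral// diracT.
split.
- move=> Q; exists empty_confs, empty_confs; split=> //; try exact: measurable_empty_confs.
  by rewrite setDv measure0.
- exists (~` empty_confs); split=> //; first by apply: measurableC; exact: measurable_empty_confs.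
  change (@dirac _ _ (conf0 R) R (~` empty_confs) = 0%E).
  by rewrite diracE memNset// => /(_ conf0_empty).
- move=> g g0; exists (cst 0); split; first exact: lim0.
  by rewrite Z1// lte01 ltry.
exists (cst (vacuum R)); split.
- move=> g M g0 Mlim C mC; have M0 := limE' g M g0 Mlim.
  by rewrite /gibbs vacuum_boltzmann_integral// Z1// invr1 mul1e.
- move=> C mC Y mY /=.
  have [VC|VC] := pselect (Y (vacuum R C)).
    rewrite (_ : _ @^-1` _ = setT); last by apply/seteqP; split=> // g _; exact: VC.
    exists setT, setT; split=> //; try exact: sigma_canT.
    by rewrite setDv measure0.
  rewrite (_ : _ @^-1` _ = set0); last by apply/seteqP; split=> // g /VC.
  exists set0, set0; split=> //; try exact: sigma_algebra0.
  by rewrite setDv measure0.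
- move=> F mF _.
  have mF' g : measurable_fun setT (fun h => (F (conf_add h (conf_restr g (measurableC mA))))%:E).
    apply/measurable_EFinP; apply: measurableT_comp => //; exact: measurable_conf_addl.
  have in0 : conf_in A (conf0 R) by [].
  have inner g : (\int[vacuum R]_(h in conf_in A)
      (F (conf_add h (conf_restr g (measurableC mA))))%:E =
      (F (conf_restr g (measurableC mA)))%:E)%E.
    rewrite integral_dirac; last 2 first.
    + exact: measurable_conf_in.
    + exact: measurable_funTS.
    by rewrite diracE mem_set// mul1e conf_add0.
  under [RHS]eq_integral do rewrite inner.
  rewrite !integral_dirac//.
  + by rewrite diracT !mul1e; congr (F _)%:E; exact: conf_eq.
  + apply/measurable_EFinP; apply: measurableT_comp => //; exact: measurable_conf_restr.
  + exact/measurable_EFinP.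
Qed.

End vacuum.

(** * Bump functions *)

Section smooth_functions.
Context (R : realType).
Implicit Types (a b : R -> R).

(** Differentiability [k + 1] times, with derivatives as witnesses; the additional order gives
    continuity already at [k = 0]. *)
Fixpoint smooth (k : nat) (a : R -> R) : Prop :=
  exists a', (forall x : R, is_derive x 1 a (a' x)) /\
    (if k is k'.+1 then smooth k' a' else True).

Lemma smooth_derivable k a x : smooth k a -> derivable a x 1.
Proof. by case: k => [|k] [a' [+ _]] => /(_ x) []. Qed.

Lemma smooth_continuous k a : smooth k a -> continuous a.
Proof.
move=> sa x; apply: differentiable_continuous; apply/derivable1_diffP.
exact: smooth_derivable sa.
Qed.

Lemma smoothW k a : smooth k.+1 a -> smooth k a.
Proof.
elim: k a => [|k IH] a [a' [da sa]]; exists a'; split=> //.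
exact: IH.
Qed.

Lemma smooth0 k : smooth k (fun=> 0).
Proof. by elim: k => [|k IH]; exists (fun=> 0); split=> // x; exact: is_derive_cst. Qed.

Lemma smoothD k a b : smooth k a -> smooth k b -> smooth k (fun x => a x + b x).
Proof.
elim: k a b => [|k IH] a b [a' [da sa]] [b' [db sb]];
  exists (fun x => a' x + b' x); split=> //; first by move=> x; exact: is_deriveD.
  by move=> x; exact: is_deriveD.
exact: IH.
Qed.

Lemma smoothM k a b : smooth k a -> smooth k b -> smooth k (fun x => a x * b x).
Proof.
elim: k a b => [|k IH] a b sa sb.
  have [a' [da _]] := sa; have [b' [db _]] := sb.
  exists (fun x => a x * b' x + b x * a' x); split=> // x.
  by apply: is_derive_eq (is_deriveM (da x) (db x)) _.
have [a' [da sa']] := sa; have [b' [db sb']] := sb.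
exists (fun x => a x * b' x + b x * a' x); split=> [x|].
  by apply: is_derive_eq (is_deriveM (da x) (db x)) _.
by apply: smoothD; apply: IH => //; exact: smoothW.
Qed.

Lemma smooth_cst k (c : R) : smooth k (fun=> c).
Proof.
case: k => [|k]; exists (fun=> 0); split=> //; try exact: smooth0.
  by move=> x; exact: is_derive_cst.
by move=> x; exact: is_derive_cst.
Qed.

Lemma is_derive_affine a a' (c d x : R) : (forall x : R, is_derive x 1 a (a' x)) ->
  is_derive x 1 (fun x => a (c * x + d)) (c * a' (c * x + d)).
Proof.
move=> da; have dl : is_derive x 1 (fun x : R => c * x + d) c.
  apply: is_derive_eq (is_deriveD (is_deriveZ c (is_derive_id x 1)) (is_derive_cst d x 1)) _.
  by rewrite addr0 /GRing.scale /= mulr1.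
by have := @is_derive1_comp R a (fun x => c * x + d) x (a' (c * x + d)) c (da _) dl;
  rewrite mulrC.
Qed.

Lemma smooth_affine k a (c d : R) : smooth k a -> smooth k (fun x => a (c * x + d)).
Proof.
elim: k a => [|k IH] a [a' [da sa]].
  by exists (fun x => c * a' (c * x + d)); split=> // x; exact: is_derive_affine.
exists (fun x => c * a' (c * x + d)); split; first by move=> x; exact: is_derive_affine.
by apply: smoothM; [exact: smooth_cst|exact: IH].
Qed.

(** Each order provides its own witness for the derivative; uniqueness of derivatives identifies
    them. *)
Lemma smooth_deriv a : (forall k, smooth k a) ->
  exists a', (forall x : R, is_derive x 1 a (a' x)) /\ (forall k, smooth k a').
Proof.
move=> sa; have [a' [da _]] := sa 0%N; exists a'; split=> // k.
have [a'' [da'' sa'']] := sa k.+1; rewrite (_ : a' = a'')//.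
by apply/funext => x; rewrite -(@derive_val _ _ _ _ _ _ _ (da x)) -(@derive_val _ _ _ _ _ _ _ (da'' x)).
Qed.

(** The partial derivatives of a product of one-variable functions are again of this form, so the
    induction closes. *)
Lemma Ck_prod a b : (forall k, smooth k a) -> (forall k, smooth k b) ->
  forall k, Ck k (fun X : R * R => a X.1 * b X.2).
Proof.
move=> sa sb k; elim: k a b sa sb => [|k IH] a b sa sb.
  split=> // X; apply: cvgM.
    by apply: (cvg_comp _ _ cvg_fst); exact: (smooth_continuous (sa 0%N)).
  by apply: (cvg_comp _ _ cvg_snd); exact: (smooth_continuous (sb 0%N)).
have [a' [da sa']] := smooth_deriv sa; have [b' [db sb']] := smooth_deriv sb.
have d1 (X : R * R) : is_derive X.1 1 (fun s : R => a s * b X.2) (a' X.1 * b X.2).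
  apply: is_derive_eq (is_deriveM (da X.1) (is_derive_cst (b X.2) X.1 1)) _.
  by rewrite scaler0 add0r /GRing.scale /= mulrC.
have d2 (X : R * R) : is_derive X.2 1 (fun s : R => a X.1 * b s) (a X.1 * b' X.2).
  apply: is_derive_eq (is_deriveM (is_derive_cst (a X.1) X.2 1) (db X.2)) _.
  by rewrite scaler0 addr0.
have cab : continuous (fun X : R * R => a X.1 * b X.2).
  by case: k IH => [|k] /(_ a b sa sb) [].
split=> //; split.
- by move=> X; case: (d1 X).
- by move=> X; case: (d2 X).
- rewrite (_ : partial1 _ = fun X : R * R => a' X.1 * b X.2); first exact: IH.
  by apply/funext => X; rewrite /partial1 derive1E; case: (d1 X).
- rewrite (_ : partial2 _ = fun X : R * R => a X.1 * b' X.2); first exact: IH.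
  by apply/funext => X; rewrite /partial2 derive1E; case: (d2 X).
Qed.

(* The family is closed under differentiation up to linear combinations, which
   makes [exp (-1 / x)], extended by [0], smooth. *)
Definition flat (n : nat) (x : R) : R :=
  if 0 < x then x^-1 ^+ n * expR (- x^-1) else 0.

Lemma flat_le0 n x : x <= 0 -> flat n x = 0.
Proof. by rewrite /flat ltNge => ->. Qed.

Lemma flat_ge0 n x : 0 <= flat n x.
Proof.
by rewrite /flat; case: ifPn => // x0; rewrite mulr_ge0 ?exprn_ge0 ?invr_ge0 ?expR_ge0// ltW.
Qed.

Lemma flat_gt0 n x : 0 < x -> 0 < flat n x.
Proof. by rewrite /flat => x0; rewrite x0 mulr_gt0 ?exprn_gt0 ?invr_gt0 ?expR_gt0. Qed.

(** With [t = x^-1] this is [t ^ n <= n! * exp t], from a single term of the exponential series. *)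
Lemma flat_le n x : flat n x <= n`!%:R.
Proof.
rewrite /flat; case: ifPn => // x0; rewrite expRN ler_pdivrMr ?expR_gt0//.
have t0 : 0 <= x^-1 by rewrite invr_ge0 ltW.
case: n => [|n]; first by rewrite expr0 mul1r -expR0 ler_expR.
have : x^-1 ^+ n.+1 / n.+1`!%:R <= expR x^-1.
  by apply: le_trans (expR_ge1Dxn n t0); rewrite lerDr.
by rewrite ler_pdivrMr ?ltr0n ?fact_gt0// mulrC.
Qed.

Lemma is_derive_flat n (x : R) :
  is_derive x 1 (flat n) (flat n.+2 x - n%:R * flat n.+1 x).
Proof.
have [x0|x0|->] := ltgtP x 0.
- rewrite !flat_le0 ?(ltW x0)// mulr0 subr0.
  apply: (@near_eq_is_derive _ _ _ (cst 0)).
    near=> y; rewrite flat_le0//; apply: ltW; near: y; exact: lt_nbhsl.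
- have xne : x != 0 by rewrite gt_eqF.
  have dV : is_derive x 1 (fun y : R => y^-1) (- (x^-1 ^+ 2)).
    have := @is_deriveV R id x 1 1 xne (is_derive_id x 1).
    by rewrite /GRing.scale /= mulr1 -exprVn.
  have dE : is_derive x 1 (fun y : R => expR (- y^-1)) (expR (- x^-1) * x^-1 ^+ 2).
    have := @is_derive1_comp R expR (fun y => - y^-1) x _ _ (is_derive_expR (- x^-1))
      (is_deriveN dV).
    by rewrite opprK.
  apply: (@near_eq_is_derive _ _ _ (fun y : R => y^-1 ^+ n * expR (- y^-1))).
    near=> y; rewrite /flat ifT//; near: y; exact: lt_nbhsr.
  have dX : is_derive x 1 (fun y : R => y^-1 ^+ n)
      (n%:R * x^-1 ^+ n.-1 * - (x^-1 ^+ 2)).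
    by have := is_deriveX n dV; rewrite exprfctE.
  have dXE := is_deriveM dX dE.
  apply: (is_derive_eq dXE).
  rewrite /flat x0 /GRing.scale /=; case: n {dX dXE} => [|n].
    by ring.
  by rewrite /= !exprS; ring.
- rewrite !flat_le0// mulr0 subr0.
  suff cv : h^-1 *: ((flat n \o shift 0) (h *: 1) - flat n 0) @[h --> (0:R)^'] --> (0:R).
    by apply: DeriveDef; [apply/cvg_ex; exists 0|exact/cvg_lim].
  (* For [h > 0] the quotient is [flat n.+1 h = h * flat n.+2 h], and [flat n.+2] is bounded; for
     [h <= 0] it is zero. *)
  have bound (h : R) : `|h^-1 *: ((flat n \o shift 0) (h *: 1) - flat n 0)| <=
      n.+2`!%:R * `|h|.
    rewrite /= [h *: 1]mulr1 addr0 (flat_le0 n (lexx 0)) subr0.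
    have [h0|h0] := leP h 0; first by rewrite (flat_le0 n h0) scaler0 normr0 mulr_ge0.
    rewrite normrM normfV (gtr0_norm h0) ger0_norm ?flat_ge0// -ler_pdivrMr//.
    apply: le_trans (flat_le n.+2 h); rewrite /flat h0 !exprS mulrC -!mulrA.
    by rewrite le_eqVlt; apply/orP; left; apply/eqP; ring.
  apply/cvgrPdist_le => e e0; near=> h; rewrite sub0r normrN (le_trans (bound h))//.
  rewrite -ler_pdivlMl ?ltr0n ?fact_gt0//; near: h.
  apply: dnbhs0_le; rewrite mulr_gt0// invr_gt0 ltr0n fact_gt0.
Unshelve. all: by end_near. Qed.

Lemma smooth_flat k n : smooth k (flat n).
Proof.
elim: k n => [|k IH] n; exists (fun x => flat n.+2 x - n%:R * flat n.+1 x); split=> //;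
  try exact: is_derive_flat.
apply: smoothD; first exact: IH.
rewrite (_ : (fun x => _) = (fun x => - n%:R * flat n.+1 x)).
  by apply: smoothM; [exact: smooth_cst|exact: IH].
by apply/funext => x; rewrite mulNr.
Qed.

(** The coefficients [1] and [-1] stay explicit so that [smooth_affine] and [is_derive_affine] apply
    as they are. *)
Definition bump (x : R) : R := flat 0 (1 * x + 1) * flat 0 (-1 * x + 1).

Definition dbump (x : R) : R :=
  flat 2 (1 * x + 1) * flat 0 (-1 * x + 1) - flat 0 (1 * x + 1) * flat 2 (-1 * x + 1).

Lemma smooth_bump k : smooth k bump.
Proof. by apply: smoothM; apply: smooth_affine; exact: smooth_flat. Qed.

Lemma is_derive_bump (x : R) : is_derive x 1 bump (dbump x).
Proof.
have d0 (y : R) : is_derive y 1 (flat 0) (flat 2 y).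
  by apply: is_derive_eq (is_derive_flat 0 y) _; rewrite mul0r subr0.
apply: is_derive_eq (is_deriveM (is_derive_affine 1 1 x d0) (is_derive_affine (-1) 1 x d0)) _.
by rewrite /dbump /GRing.scale /=; ring.
Qed.

Lemma bump_out x : 1 <= `|x| -> bump x = 0.
Proof.
rewrite /bump ler_normr => /orP[x1|x1].
  by rewrite [X in _ * X]flat_le0 ?mulr0//; lra.
by rewrite [X in X * _]flat_le0 ?mul0r//; lra.
Qed.

Lemma dbump_out x : 1 <= `|x| -> dbump x = 0.
Proof.
rewrite /dbump ler_normr => /orP[x1|x1].
  by rewrite !(@flat_le0 _ (-1 * x + 1)) ?mulr0 ?subr0//; lra.
by rewrite !(@flat_le0 _ (1 * x + 1)) ?mul0r ?subr0//; lra.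
Qed.

Lemma bump_ge0 x : 0 <= bump x.
Proof. by rewrite mulr_ge0 ?flat_ge0. Qed.

Lemma bump_le1 x : bump x <= 1.
Proof. by rewrite -[leRHS]mulr1 ler_pM ?flat_ge0 ?flat_le. Qed.

Lemma bump_gt0 x : `|x| < 1 -> 0 < bump x.
Proof.
by rewrite ltr_norml => /andP[x1 x2]; rewrite mulr_gt0 ?flat_gt0//; lra.
Qed.

Lemma dbump_le x : `|dbump x| <= 4.
Proof.
have := flat_le 0 (1 * x + 1); have := flat_le 0 (-1 * x + 1).
have := flat_le 2 (1 * x + 1); have := flat_le 2 (-1 * x + 1).
have := flat_ge0 0 (1 * x + 1); have := flat_ge0 0 (-1 * x + 1).
have := flat_ge0 2 (1 * x + 1); have := flat_ge0 2 (-1 * x + 1).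
rewrite /dbump (_ : 0`!%:R = 1)// (_ : 2`!%:R = 2)//.
move: (flat 0 (1 * x + 1)) (flat 0 (-1 * x + 1)) (flat 2 (1 * x + 1)) (flat 2 (-1 * x + 1)).
move=> a b c d d0 c0 b0 a0 d2 c2 b1 a1.
have : 0 <= c * b <= 2 by rewrite mulr_ge0//= -[2]mulr1 ler_pM.
have : 0 <= a * d <= 2 by rewrite mulr_ge0//= -[2]mul1r ler_pM.
by rewrite ler_norml => /andP[? ?] /andP[? ?]; apply/andP; split; lra.
Qed.

Definition test_bump (r : R) (X : R * R) : R := bump (X.1 / r) * bump (X.2 / r).

Let bump_scaledE r : (fun x => bump (x / r)) = (fun x => bump (r^-1 * x + 0)).
Proof. by apply/funext => x; rewrite addr0 mulrC. Qed.

Lemma partial1_test_bump r X :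
  partial1 (test_bump r) X = r^-1 * dbump (X.1 / r) * bump (X.2 / r).
Proof.
have d : is_derive X.1 1 (fun s : R => bump (s / r)) (r^-1 * dbump (X.1 / r)).
  have := is_derive_affine r^-1 0 X.1 is_derive_bump.
  by rewrite -(bump_scaledE r) addr0 (mulrC r^-1 X.1).
have dM := is_deriveM d (is_derive_cst (bump (X.2 / r)) X.1 1).
rewrite /partial1 derive1E; apply: (etrans (@derive_val _ _ _ _ _ _ _ dM)).
by rewrite scaler0 add0r /GRing.scale /= mulrC.
Qed.

Lemma partial2_test_bump r X :
  partial2 (test_bump r) X = r^-1 * bump (X.1 / r) * dbump (X.2 / r).
Proof.
have d : is_derive X.2 1 (fun s : R => bump (s / r)) (r^-1 * dbump (X.2 / r)).
  have := is_derive_affine r^-1 0 X.2 is_derive_bump.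
  by rewrite -(bump_scaledE r) addr0 (mulrC r^-1 X.2).
have dM := is_deriveM (is_derive_cst (bump (X.1 / r)) X.2 1) d.
rewrite /partial2 derive1E; apply: (etrans (@derive_val _ _ _ _ _ _ _ dM)).
by rewrite scaler0 addr0 /GRing.scale /= mulrCA mulrA.
Qed.

Lemma test_function_bump r : 0 < r -> test_function (test_bump r).
Proof.
move=> r0; split.
  apply: (@Ck_prod (fun x => bump (x / r)) (fun x => bump (x / r))) => k;
  by rewrite bump_scaledE; apply: smooth_affine; exact: smooth_bump.
(* The support lies in the square of half-side [r], which the disc of radius [2 * r] contains. *)
exists (2 * r) => X; rewrite /norm2 => Xr; rewrite /test_bump.
have [x1|x1] := leP 1 `|X.1 / r|; first by rewrite bump_out// mul0r.
have [x2|x2] := leP 1 `|X.2 / r|; first by rewrite [X in _ * X]bump_out// mulr0.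
exfalso; move: Xr x1 x2; rewrite !normrM !normfV (gtr0_norm r0) !ltr_pdivrMr// !mul1r.
move=> + x1 x2; apply/negP; rewrite -leNgt -(@ler_pXn2r _ 2) ?nnegrE ?sqrtr_ge0//; last first.
  by rewrite mulr_ge0// ltW.
rewrite sqr_sqrtr ?addr_ge0 ?sqr_ge0// -(real_normK (num_real X.1)) -(real_normK (num_real X.2)).
by have := normr_ge0 X.1; have := normr_ge0 X.2; nra.
Qed.

Lemma measurable_bump : measurable_fun setT bump.
Proof. by apply: continuous_measurable_fun; exact: smooth_continuous (smooth_bump 0). Qed.

Lemma bump_scaled_Cc (r : R) : 0 < r -> continuous (fun x : R => bump (x / r)) /\
  exists s, forall x : R, s < `|x| -> bump (x / r) = 0.
Proof.
move=> r0; split.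
  by rewrite bump_scaledE; apply: smooth_continuous (smooth_affine _ _ (smooth_bump 0)).
exists r => x rx; rewrite bump_out// normrM normfV (gtr0_norm r0) ler_pdivlMr// mul1r.
exact: ltW.
Qed.

End smooth_functions.

(** * The truncated logarithm *)

Section logarithm_truncation.
Context (R : realType).
Local Notation RB := (measurableTypeR R).
Local Notation mu := (@lebesgue_measure R).

(** The bound also covers points without a derivative, where [derive1] takes the default value [0];
    the truncated logarithm has such points. *)
Lemma derive1_lipschitz (F : R -> R) (u L d : R) : 0 < d -> 0 <= L ->
  (forall s, `|s - u| < d -> `|F s - F u| <= L * `|s - u|) -> `|derive1 F u| <= L.
Proof.
move=> d0 L0 FL; rewrite /derive1.
set G := fun h : R => h^-1 *: (F (h + u) - F u).
have [cG|dG] := pselect (cvg (G @ (0:R)^')); last by rewrite dvgP// normr0.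
have : `|G h| @[h --> (0:R)^'] --> `|lim (G @ (0:R)^')| by exact: cvg_norm.
move=> /cvgr_to_le; apply; near=> h.
have h0 : h != 0 by near: h; exact: nbhs_dnbhs_neq.
have hd : `|h| < d by near: h; exact: dnbhs0_lt.
rewrite /G normrM normfV mulrC ler_pdivrMr ?normr_gt0//.
by have := FL (h + u); rewrite addrK; apply.
Unshelve. all: by end_near. Qed.

Lemma ln_lipschitz (c a b : R) : 0 < c -> c <= a -> c <= b ->
  `|ln a - ln b| <= c^-1 * `|a - b|.
Proof.
move=> c0; wlog ba : a b / b <= a => [hw ca cb|ca cb].
  have [/hw|/ltW/hw] := leP b a; first exact.
  by rewrite distrC [`|a - b|]distrC; exact.
have b0 := lt_le_trans c0 cb; have a0 := lt_le_trans c0 ca.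
rewrite ger0_norm ?subr_ge0 ?ler_ln ?posrE// ger0_norm ?subr_ge0//.
rewrite -ln_div ?posrE// (_ : a / b = 1 + (a - b) / b); last first.
  by rewrite mulrBl divff ?gt_eqF// addrC subrK.
apply: le_trans (le_ln1Dx _) _.
  by rewrite (lt_le_trans (ltrN10 _))// divr_ge0 ?subr_ge0 ?(ltW b0).
by rewrite mulrC ler_wpM2r ?subr_ge0// lef_pV2 ?posrE.
Qed.

Lemma norm2_ge1 (x y : R) : `|x| <= norm2 (x, y).
Proof. by rewrite -sqrtr_sqr ler_wsqrtr// lerDl sqr_ge0. Qed.

Lemma norm2C (x y : R) : norm2 (x, y) = norm2 (y, x).
Proof. by rewrite /norm2 addrC. Qed.

Lemma norm2_ge2 (x y : R) : `|y| <= norm2 (x, y).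
Proof. by rewrite norm2C norm2_ge1. Qed.

Lemma norm2_dist (s u v : R) : `|norm2 (s, v) - norm2 (u, v)| <= `|s - u|.
Proof.
have key (a b : R) : norm2 (a, v) <= norm2 (b, v) + `|a - b|.
  rewrite -(@ler_pXn2r _ 2) ?nnegrE ?addr_ge0 ?sqrtr_ge0//.
  rewrite sqrrD !sqr_sqrtr ?addr_ge0 ?sqr_ge0// real_normK ?num_real//.
  have h : b * (a - b) <= norm2 (b, v) * `|a - b|.
    by rewrite (le_trans (ler_norm _))// normrM ler_wpM2r// norm2_ge1.
  by rewrite -mulr_natr /=; move: h; move: (norm2 _ * _) => z; lra.
rewrite ler_norml; apply/andP; split.
  by have := key u s; rewrite (distrC u s); lra.
by have := key s u; lra.
Qed.

Lemma trunc_log_lipschitz (e c s u v : R) : 0 < e -> 0 < c ->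
  c <= norm2 (s, v) -> c <= norm2 (u, v) ->
  `|Defs.trunc_log e (s, v) - Defs.trunc_log e (u, v)| <= c^-1 * `|s - u|.
Proof.
move=> e0 c0 cs cu.
apply: le_trans (_ : `|ln (e / norm2 (s, v)) - ln (e / norm2 (u, v))| <= _).
  rewrite /Defs.trunc_log; move: (ln _) (ln _) => a b.
  have key (x y : R) : Num.max x 0 - Num.max y 0 <= `|x - y|.
    rewrite lerBlDr ge_max addr_ge0 ?le_max ?lexx ?orbT// andbT.
    have := ler_norm (x - y); have : y <= Num.max y 0 by rewrite le_max lexx.
    by lra.
  by rewrite ler_norml key andbT lerNl opprB distrC key.
have s0 := lt_le_trans c0 cs; have u0 := lt_le_trans c0 cu.
rewrite !ln_div ?posrE// opprD addrACA subrr add0r opprK addrC distrC.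
apply: le_trans (ln_lipschitz c0 cs cu) _.
by rewrite ler_wpM2l ?invr_ge0 ?(ltW c0)// norm2_dist.
Qed.

Lemma trunc_log0 (e : R) X : 0 < e -> e <= norm2 X -> Defs.trunc_log e X = 0.
Proof.
move=> e0 eX; rewrite /Defs.trunc_log max_r// ln_le0// ler_pdivrMr ?mul1r//.
exact: lt_le_trans eX.
Qed.

(** A dyadic form of the bound [O(1 / |X|)] on the gradient near the origin: away from it [2 ^- k]
    is the dyadic size of [r = max(|u|, |v|)], and [2 / r <= 4 * 2 ^ k]. For [r > e] the function
    vanishes nearby along the first coordinate. *)
Lemma partial1_trunc_log (e u v : R) : 0 < e < 1 ->
  partial1 (Defs.trunc_log e) (u, v) = 0 \/
  exists k : nat, [/\ `|u| <= 2^-1 ^+ k, `|v| <= 2^-1 ^+ k &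
    `|partial1 (Defs.trunc_log e) (u, v)| <= 4 * 2 ^+ k].
Proof.
move=> /andP[e0 e1]; pose r := Num.max `|u| `|v|.
have ur : `|u| <= r by rewrite le_max lexx.
have vr : `|v| <= r by rewrite le_max lexx orbT.
rewrite /partial1 /=; set F := fun s => _.
have r0 : 0 <= r by exact: le_trans ur.
have [r_eq0|rneq0] := eqVneq r 0.
  (* At the origin the derivative is some fixed number, and [2 ^ k] exceeds it for this [k]. *)
  right; exists (Num.truncn `|derive1 F u|).
  move: ur vr; rewrite r_eq0 !normr_le0 => /eqP u0 /eqP v0.
  rewrite u0 v0 normr0 exprn_ge0//; split=> //.
  set D := `|_|; rewrite (le_trans (ltW (truncnS_gt D)))//.
  rewrite -natrX -natrM ler_nat (leq_trans (ltn_expl (Num.truncn D) (isT : (1 < 2)%N)))//.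
  by rewrite leq_pmull.
have {rneq0}r0 : 0 < r by rewrite lt_neqAle eq_sym rneq0.
have rn : r <= norm2 (u, v) by rewrite ge_max norm2_ge1 norm2_ge2.
have [er|re] := ltP e r.
  left; apply/eqP; rewrite -normr_le0.
  have [ev|ve] := ltP e `|v|.
    apply: (@derive1_lipschitz F u 0 1) => // s _; rewrite mul0r normr_le0 subr_eq0.
    by rewrite /F !trunc_log0// (le_trans (ltW ev)) ?norm2_ge2.
  have eu : e < `|u| by move: er; rewrite lt_max [_ < `|v|]ltNge ve orbF.
  apply: (@derive1_lipschitz F u 0 (`|u| - e)) => //; first by rewrite subr_gt0.
  move=> s su; rewrite mul0r normr_le0 subr_eq0 /F !trunc_log0//.
    by rewrite (le_trans (ltW eu)) ?norm2_ge1.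
  apply: le_trans (norm2_ge1 _ _).
  by have := lerB_dist u s; rewrite distrC; lra.
right.
have [k /andP[k1 k2]] : exists k, 2^-1 ^+ k.+1 < r <= 2^-1 ^+ k.
  have ex : exists k, 2^-1 ^+ k.+1 < r.
    exists (Num.truncn r^-1); rewrite exprVn invf_plt ?posrE ?exprn_gt0//.
    rewrite (lt_le_trans (truncnS_gt _))// -natrX ler_nat ltnW//.
    exact: ltn_expl.
  have [k kr kmin] := ex_minnP ex; exists k; rewrite kr /=.
  case: k kr kmin => [|k] _ kmin; first by rewrite expr0 (le_trans re)// ltW.
  by rewrite leNgt; apply/negP => /kmin; rewrite ltnn.
exists k; split; [exact: le_trans k2|exact: le_trans k2|].
have r2 : 0 < r / 2 by rewrite divr_gt0.
apply: le_trans (_ : (r / 2)^-1 <= _); last first.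
  rewrite invf_ple ?posrE ?mulr_gt0 ?exprn_gt0//.
  rewrite invfM -exprVn; move: k1; rewrite exprS.
  by move: (2^-1 ^+ k) => z; lra.
(* Moving the first coordinate by less than [r / 2] keeps the norm at least [r / 2], where the
   logarithm has Lipschitz constant [2 / r]. *)
apply: (@derive1_lipschitz F u _ (r / 2)) => //; first by rewrite invr_ge0 ltW.
move=> s su; apply: trunc_log_lipschitz => //; last by apply: le_trans rn; lra.
have [uv|vu] := leP `|u| `|v|.
  have rv : r = `|v| by rewrite /r max_r.
  by apply: le_trans (norm2_ge2 _ _); rewrite -rv; lra.
have ru : r = `|u| by rewrite /r max_l// ltW.
by apply: le_trans (norm2_ge1 _ _); have := lerB_dist u s; rewrite distrC -ru; lra.
Qed.

Lemma partial2_trunc_log (e u v : R) : partial2 (Defs.trunc_log e) (u, v) =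
  partial1 (Defs.trunc_log e) (v, u).
Proof.
have E : (fun s => Defs.trunc_log e (u, s)) = (fun s => Defs.trunc_log e (s, u)).
  by apply/funext => s; rewrite /Defs.trunc_log norm2C.
exact: (congr1 (fun f => derive1 f v) E).
Qed.

End logarithm_truncation.

(** * Integrability of the dyadic singular kernel *)

Section singular_kernel.
Context (R : realType).
Local Notation RB := (measurableTypeR R).
Local Notation mu := (@lebesgue_measure R).
Local Notation mu2 := (mu \x mu)%E.

Definition square (k : nat) (x : R) : set (RB * RB) :=
  `[x - 2^-1 ^+ k, x + 2^-1 ^+ k]%classic `*` `[- 2^-1 ^+ k, 2^-1 ^+ k]%classic.

Lemma measurable_square k x : measurable (square k x).
Proof. by apply: measurableX; exact: measurable_itv. Qed.

(* Dominates, up to a constant, [1 / |X - (x, 0)|] near [(x, 0)]: a dyadic sum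
   whose integral is a geometric series. *)
Definition singular (x : R) (X : RB * RB) : \bar R :=
  (\sum_(k <oo) (4 * 2 ^+ k * \1_(square k x) X)%:E)%E.

Let term_ge0 x X k : (0 <= (4 * 2 ^+ k * \1_(square k x) X : R)%:E)%E.
Proof. by rewrite lee_fin !mulr_ge0 ?exprn_ge0. Qed.

Lemma singular_ge0 x X : (0 <= singular x X)%E.
Proof. by apply: nneseries_ge0 => k _ _; exact: term_ge0. Qed.

Lemma singular_ge k x X : square k x X -> ((4 * 2 ^+ k : R)%:E <= singular x X)%E.
Proof.
move=> qX; apply: (@le_trans _ _ (\sum_(0 <= i < k.+1) (4 * 2 ^+ i * \1_(square i x) X : R)%:E)%E).
  rewrite big_nat_recr//= indicE mem_set// mulr1 leeDr//.
  by apply: sume_ge0 => i _; exact: term_ge0.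
by apply: nneseries_lim_ge => i _ _; exact: term_ge0.
Qed.

Lemma partial1_singular (e x : R) (X : RB * RB) : 0 < e < 1 ->
  (`|partial1 (Defs.trunc_log e) ((X.1 : R) - x, X.2 : R)|%:E <= singular x X)%E.
Proof.
move=> e01; have [->|[k [x1 x2 d]]] := partial1_trunc_log (X.1 - x) X.2 e01.
  by rewrite normr0 singular_ge0.
apply: le_trans (@singular_ge k x X _); first by rewrite lee_fin.
move: x1 x2; rewrite !ler_norml => /andP[a b] /andP[c f]; split=> /=;
  by rewrite in_itv/=; apply/andP; split; lra.
Qed.

Lemma partial2_singular (e x : R) (X : RB * RB) : 0 < e < 1 ->
  (`|partial2 (Defs.trunc_log e) ((X.1 : R) - x, X.2 : R)|%:E <= singular x X)%E.
Proof.
move=> e01; rewrite partial2_trunc_log.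
have [->|[k [x1 x2 d]]] := partial1_trunc_log X.2 (X.1 - x) e01.
  by rewrite normr0 singular_ge0.
apply: le_trans (@singular_ge k x X _); first by rewrite lee_fin.
move: x1 x2; rewrite !ler_norml => /andP[a b] /andP[c f]; split=> /=;
  by rewrite in_itv/=; apply/andP; split; lra.
Qed.

Lemma measurable_singular2 :
  measurable_fun setT (fun p : (RB * RB) * RB => singular p.2 p.1).
Proof.
apply: ge0_emeasurable_sum => [k X _ _|k _]; first exact: term_ge0.
apply/measurable_EFinP; apply: measurable_funM => //.
pose D : set ((RB * RB) * RB) := [set p | square k p.2 p.1].
rewrite (_ : (fun p => _) = \1_D).
  apply: measurable_indic.
  have m1 : measurable_fun setT (fun p : (RB * RB) * RB => (p.1.1 : R) - p.2).
    have p11 : measurable_fun setT (fun p : (RB * RB) * RB => p.1.1 : R).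
      move=> mT Y mY; have := measurableT_comp (@measurable_fst _ _ RB RB)
        (@measurable_fst _ _ (RB * RB)%type RB); exact.
    have p2 : measurable_fun setT (fun p : (RB * RB) * RB => p.2 : R).
      by move=> mT Y mY; exact: measurable_snd.
    exact: measurable_funB.
  have m2 : measurable_fun setT (fun p : (RB * RB) * RB => p.1.2 : R).
    move=> mT Y mY; have := measurableT_comp (@measurable_snd _ _ RB RB)
      (@measurable_fst _ _ (RB * RB)%type RB); exact.
  rewrite (_ : D = (fun p => (p.1.1 : R) - p.2) @^-1` `[- 2^-1 ^+ k, 2^-1 ^+ k]%classic
      `&` (fun p => p.1.2 : R) @^-1` `[- 2^-1 ^+ k, 2^-1 ^+ k]%classic).
    by apply: measurableI; rewrite -[X in measurable X]setTI; [apply: m1|apply: m2] => //;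
      exact: measurable_itv.
  apply/seteqP; split=> -[[a b] c]; rewrite /D /square /= !in_itv/=.
    by move=> [/andP[h1 h2] ->]; split=> //; apply/andP; split; lra.
  by move=> [/andP[h1 h2] ->]; split=> //; apply/andP; split; lra.
by apply/funext => p; rewrite !indicE; congr ((nat_of_bool _)%:R);
  apply/idP/idP; rewrite !inE.
Qed.

Lemma geometric_half_le (M : R) : 0 <= M ->
  (\sum_(k <oo) (M * 2^-1 ^+ k)%:E <= (2 * M)%:E)%E.
Proof.
move=> M0; apply: lime_le.
  by apply: is_cvg_nneseries => k _ _; rewrite lee_fin mulr_ge0 ?exprn_ge0 ?invr_ge0.
apply: nearW => n; rewrite sumEFin lee_fin -mulr_sumr mulrC ler_wpM2r//.
have -> : \sum_(0 <= i < n) 2^-1 ^+ i = 2 - 2 * 2^-1 ^+ n :> R.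
  elim: n => [|n IH]; first by rewrite big_nil expr0; ring.
  by rewrite big_nat_recr//= IH exprS; field.
by rewrite gerBl mulr_ge0 ?exprn_ge0 ?invr_ge0.
Qed.

Lemma integral_singular x : (\int[mu2]_X singular x X <= 32%:E)%E.
Proof.
have mterm k : measurable_fun setT (fun X : RB * RB => (4 * 2 ^+ k * \1_(square k x) X : R)%:E).
  apply/measurable_EFinP; apply: measurable_funM => //.
  by apply: measurable_indic; exact: measurable_square.
rewrite /singular integral_nneseries//.
(* The square has area [4 * 4 ^- k], so the integral of the term is [16 * 2 ^- k]; these sum to at
   most [32]. *)
have E k : (\int[mu2]_X (4 * 2 ^+ k * \1_(square k x) X : R)%:E = (16 * 2^-1 ^+ k)%:E)%E.
  under eq_integral do rewrite EFinM.
  have msq := @measurable_square k x.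
  have mi : measurable_fun setT (fun X : RB * RB => (\1_(square k x) X : R)%:E).
    by apply/measurable_EFinP; exact: measurable_indic.
  rewrite (integral_scale mu2); [|by rewrite mulr_gt0 ?exprn_gt0|by move=> *; rewrite lee_fin].
  rewrite integral_indic//.
  rewrite setIT /square /= (@product_measure1E _ _ RB RB R mu mu); try exact: measurable_itv.
  have p0 : 0 < 2^-1 ^+ k :> R by rewrite exprn_gt0// invr_gt0.
  rewrite /= !lebesgue_measure_itv/= !lte_fin.
  rewrite !ifT; [|by rewrite gtrN|by rewrite ltrD2l gtrN].
  rewrite -!EFinB -!EFinM; congr EFin.
  have : 2 ^+ k * 2^-1 ^+ k = 1 :> R by rewrite -exprMn divff ?expr1n.
  move: (2 ^+ k) (2^-1 ^+ k) => a b ab.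
  by transitivity (16 * (a * b) * b); [ring|rewrite ab mulr1].
rewrite (eq_eseriesr (fun k _ => E k)).
by rewrite (le_trans (geometric_half_le _))// lee_fin; lra.
Qed.

End singular_kernel.

(** * Finite energy and density *)

Section electric_estimate.
Context (R : realType).
Local Notation RB := (measurableTypeR R).
Local Notation mu := (@lebesgue_measure R).
Local Notation mu2 := (mu \x mu)%E.

(* Neither [w] nor [z] is assumed measurable: only the minorant [(|w| - H)^+] of
   [|z|] enters the integrals. *)
Lemma integral_split_le d (T : measurableType d) (nu : {measure set T -> \bar R})
    (w z : T -> R) (H : T -> \bar R) (Q S : set T) (a K : R) :
  measurable_fun setT w -> measurable_fun setT H -> (forall X, (0 <= H X)%E) ->
  (forall X, (`|w X|%:E <= `|z X|%:E + H X)%E) ->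
  measurable Q -> Q `<=` S -> 0 < a ->
  (\int[nu]_(X in S) (z X ^+ 2)%:E <= K%:E)%E ->
  (\int[nu]_(X in Q) `|w X|%:E <=
    (a^-1 * K)%:E + a%:E * nu Q + \int[nu]_(X in Q) H X)%E.
Proof.
move=> mw mH H0 wzH mQ QS a0 SK.
pose G X := fine (maxe (`|w X|%:E - H X)%E 0%E).
have mnw : measurable_fun setT (fun X => `|w X|) by exact: measurableT_comp.
have mG : measurable_fun setT G.
  apply: measurableT_comp => //; apply: measurable_maxe => //.
  by apply: emeasurable_funB => //; exact/measurable_EFinP.
have G0 X : 0 <= G X by rewrite fine_ge0// le_max lexx orbT.
have GH X : (`|w X|%:E <= (G X)%:E + H X)%E.
  rewrite /G; move: (H0 X); case: (H X) => [h| |] h0 //=.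
    rewrite -EFinB -EFin_max /= -EFinD lee_fin -lerBlDr.
    by rewrite le_max lexx.
  by rewrite leey.
have Gz X : G X <= `|z X|.
  move: (wzH X) (H0 X); rewrite /G; case: (H X) => [h| |] h0 //= _.
    by rewrite -EFinB -EFin_max /= ge_max normr_ge0 andbT lerBlDr -lee_fin EFinD.
  by rewrite max_r ?leNye//=.
apply: (@le_trans _ _ (\int[nu]_(X in Q) ((a^-1%:E * (G X ^+ 2)%:E + a%:E) + H X))%E).
  apply: le_lower_integral => //.
  move=> X _; apply: le_trans (GH X) _; apply: leeD => //.
  rewrite -EFinM -EFinD lee_fin.
  (* The inequality [t <= t ^ 2 / a + a] for [t >= 0]: the summand [a] suffices when [t <= a], and
     [t ^ 2 / a] otherwise. *)
  have [Ga|aG] := leP (G X) a.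
    by rewrite (le_trans Ga)// lerDr mulr_ge0 ?sqr_ge0// invr_ge0 ltW.
  by rewrite -[leLHS]addr0 lerD ?(ltW a0)// mulrC ler_pdivlMr// expr2 ler_wpM2l// ltW.
have mGG : measurable_fun Q (fun X => (G X ^+ 2)%:E).
  by apply/measurable_EFinP/measurable_funTS; exact: measurable_funX.
have ia : 0 <= a^-1 by rewrite invr_ge0 ltW.
have GG0 X : (0 <= (G X ^+ 2)%:E)%E by rewrite lee_fin sqr_ge0.
rewrite ge0_integralD//; first last.
- exact: measurable_funTS.
- by apply: emeasurable_funD => //; exact: measurable_funeM.
- by move=> X _; rewrite adde_ge0// ?mule_ge0// lee_fin ltW.
apply: leeD => //.
rewrite ge0_integralD//; first last.
- by move=> X _; rewrite lee_fin ltW.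
- exact: measurable_funeM.
- by move=> X _; rewrite mule_ge0.
apply: leeD; last by rewrite integral_cst.
rewrite integral_scale ?invr_gt0// EFinM lee_pmul2l ?lte_fin ?invr_gt0//.
apply: le_trans SK; rewrite (integral_mkcond Q) (integral_mkcond S).
apply: le_lower_integral => X _; first exact: erestrict_ge0.
rewrite /patch; case: ifPn => [/set_mem /QS /mem_set ->|_].
  by rewrite lee_fin -[leRHS]real_normK ?num_real// lerXn2r ?nnegrE ?Gz.
by case: ifPn => // _; rewrite lee_fin sqr_ge0.
Qed.

(** Dominates both components of the correction in [truncated_field], uniformly in the truncation
    level. *)
Definition singular_field (g : conf R) (X : RB * RB) : \bar R :=
  (\int[g]_x singular x X)%E.

Lemma singular_field_ge0 g X : (0 <= singular_field g X)%E.
Proof. by apply: integral_ge0 => x _; exact: singular_ge0. Qed.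

Lemma measurable_singular_field g : measurable_fun setT (singular_field g).
Proof.
apply: (@measurable_fun_fubini_tonelli_F _ _ (RB * RB)%type RB R (conf_fun g)
  (fun p => singular p.2 p.1)); first exact: measurable_singular2.
by move=> p; exact: singular_ge0.
Qed.

Definition box (r : R) : set (RB * RB) := `[- r, r]%classic `*` `[- r, r]%classic.

Lemma measurable_box r : measurable (box r).
Proof. by apply: measurableX; exact: measurable_itv. Qed.

Lemma box_measure r : 0 < r -> mu2 (box r) = (4 * r ^+ 2)%:E.
Proof.
move=> r0; rewrite /box /= (@product_measure1E _ _ RB RB R mu mu); try exact: measurable_itv.
rewrite /= !lebesgue_measure_itv/= !lte_fin !gtrN// -!EFinB -!EFinM; congr EFin.
by ring.
Qed.

Let mu2_sigma_finite : sigma_finite setT (mu2 : set (RB * RB)%type -> \bar R).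
Proof.
exists (fun n => box n.+1%:R).
  apply/esym; rewrite -subTset => -[x y] _.
  exists (Num.truncn (Num.max `|x| `|y|)) => //=.
  have h := truncnS_gt (Num.max `|x| `|y|).
  split=> /=; rewrite in_itv/= -ler_norml (le_trans _ (ltW h))// le_max lexx ?orbT//.
by move=> n; rewrite box_measure// ltey; split=> //; exact: measurable_box.
Qed.

(* The library attaches the sigma-finite instance of a product measure to the
   product of subprobabilities only. *)
Definition lebesgue2 : set (RB * RB)%type -> \bar R := mu2.

HB.instance Definition _ := Measure.on lebesgue2.
HB.instance Definition _ :=
  Measure_isSigmaFinite.Build _ _ _ lebesgue2 mu2_sigma_finite.

(** By Tonelli each point of [g] costs at most [32], and since the squares have half-side at most
    [1], only points within distance [1] of [[- r, r]] contribute. *)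
Lemma integral_singular_field g r : (\int[mu2]_(X in box r) singular_field g X <=
  32%:E * g `[(- (r + 1))%R, (r + 1)%R]%classic)%E.
Proof.
pose f (p : (RB * RB) * RB) := (singular p.2 p.1 * (\1_(box r) p.1)%:E)%E.
have f0 p : (0 <= f p)%E by rewrite mule_ge0 ?singular_ge0.
have mf : measurable_fun setT f.
  apply: emeasurable_funM; first exact: measurable_singular2.
  apply/measurable_EFinP; apply: (measurableT_comp _ measurable_fst).
  by apply: measurable_indic; exact: measurable_box.
rewrite integral_mkcond.
rewrite (_ : _ \_ _ = fun X => (\int[conf_fun g]_x f (X, x))%E); last first.
  apply/funext => X; rewrite /patch /f /= indicE; case: ifPn => XB /=.
    by apply: eq_integral => x _; rewrite mule1.
  by rewrite integral0_eq// => x _; rewrite mule0.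
rewrite (@fubini_tonelli _ _ (RB * RB)%type RB R lebesgue2 (conf_fun g) f)//.
have mW : measurable (`[- (r + 1), r + 1]%classic : set RB) by exact: measurable_itv.
rewrite -integral_cst// integral_mkcond.
apply: le_lower_integral => x _; first exact: integral_ge0.
rewrite /patch; case: ifPn => [_|xW].
  apply: le_trans (integral_singular x); apply: le_lower_integral => // X _.
  rewrite /f /= -[leRHS]mule1 lee_wpmul2l ?singular_ge0// lee_fin indicE.
  by case: (_ \in _).
rewrite integral0_eq// => X _; rewrite /f /= indicE.
have [/set_mem XB|_] := boolP (X \in box r); last by rewrite mule0.
rewrite mule1; apply: eseries0 => k _ _; rewrite indicE memNset ?mulr0// => -[qX _].
move/negP: xW; apply; apply: mem_set; move: qX; case: XB => /=; rewrite !in_itv/=.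
have : 2^-1 ^+ k <= 1 :> R by rewrite exprn_ile1// ?invr_le1 ?unitfE ?ler1n.
move: (2^-1 ^+ k) => z z1 /andP[? ?] _ /andP[? ?]; apply/andP; split; lra.
Qed.

End electric_estimate.

Section flux_estimate.
Context (R : realType).
Local Notation RB := (measurableTypeR R).
Local Notation mu := (@lebesgue_measure R).
Local Notation mu2 := (mu \x mu)%E.

Lemma le_abse_fine (t : \bar R) : (`|fine t|%:E <= `|t|)%E.
Proof. by case: t => [r| |] /=; rewrite ?abse_EFin ?normr0// leey. Qed.

Lemma le_abs_Rintegral d (T : measurableType d) (nu : {measure set T -> \bar R})
    (f : T -> R) (h : T -> \bar R) : (forall x, (`|f x|%:E <= h x)%E) ->
  (`|\int[nu]_x f x|%:E <= \int[nu]_x h x)%E.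
Proof.
move=> fh; apply: le_trans (le_abse_fine _) _.
by apply: le_abse_lower_integral => x _; rewrite abse_EFin.
Qed.

Lemma Rintegral_scale d (T : measurableType d) (nu : {measure set T -> \bar R})
    (k : R) (f : T -> R) : 0 < k -> (forall x, 0 <= f x) ->
  \int[nu]_x (k * f x) = k * \int[nu]_x f x.
Proof.
move=> k0 f0; rewrite /Rintegral; under eq_integral do rewrite EFinM.
rewrite integral_scale//; last by move=> x _; rewrite lee_fin.
case: (integral _ _ _) => [t| |] //=; first by rewrite mulr0 gt0_muley ?lte_fin.
by rewrite mulr0 gt0_muleNy ?lte_fin.
Qed.

Lemma truncated_field_split (g : conf R) e E X : 0 < e < 1 ->
  (`|(E X).1|%:E <= `|(truncated_field g e E X).1|%:E + singular_field g X)%E /\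
  (`|(E X).2|%:E <= `|(truncated_field g e E X).2|%:E + singular_field g X)%E.
Proof.
move=> e01; rewrite /truncated_field /=.
have key (s u : R) : (`|u|%:E <= singular_field g X)%E ->
    (`|s|%:E <= `|s - u|%:E + singular_field g X)%E.
  move=> uH; apply: le_trans (_ : (`|s - u|%:E + `|u|%:E <= _)%E); last exact: leeD.
  by rewrite -EFinD lee_fin -[X in `|X| <= _](subrK u) ler_normD.
split; apply: key; apply: le_abs_Rintegral => x.
  exact: partial1_singular.
exact: partial2_singular.
Qed.

Lemma partial_test_bump_le (r : R) X : 0 < r ->
  `|partial1 (test_bump r) X| <= 4 / r /\ `|partial2 (test_bump r) X| <= 4 / r.
Proof.
move=> r0; rewrite partial1_test_bump partial2_test_bump.
have key (d b : R) : `|d| <= 4 -> 0 <= b -> b <= 1 -> `|r^-1 * (d * b)| <= 4 / r.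
  move=> d4 b0 b1; rewrite normrM normfV (gtr0_norm r0) mulrC.
  rewrite ler_wpM2r ?invr_ge0 ?(ltW r0)// normrM (ger0_norm b0).
  by rewrite -[leRHS]mulr1 ler_pM.
by split; rewrite -mulrA; [|rewrite [bump _ * _]mulrC];
  apply: key; rewrite ?dbump_le ?bump_ge0 ?bump_le1.
Qed.

Lemma partial_test_bump_out (r : R) X : 0 < r -> ~ box r X ->
  partial1 (test_bump r) X = 0 /\ partial2 (test_bump r) X = 0.
Proof.
move=> r0 nX; rewrite partial1_test_bump partial2_test_bump.
have out x : ~ `[- r, r]%classic x -> 1 <= `|x / r|.
  move=> nx; rewrite normrM normfV (gtr0_norm r0) ler_pdivlMr// mul1r leNgt.
  by apply/negP => /ltW xr; apply: nx; rewrite /= in_itv/= -ler_norml.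
have [X1|X1] := pselect (`[- r, r]%classic X.1); last first.
  have o1 := out _ X1.
  by rewrite (dbump_out o1) (bump_out o1) !mulr0 !mul0r.
have X2 : ~ `[- r, r]%classic X.2 by move=> X2; exact: nX.
have o2 := out _ X2.
by rewrite (dbump_out o2) (bump_out o2) !mulr0.
Qed.

(** The factor [8 / r] counts the two components of the field, each against a partial derivative of
    size [4 / r] supported in the box; [4 * a * r ^+ 2] is [a] times the area of the box. *)
Lemma flux_estimate (q : R) (g : conf R) (E : RB * RB -> RB * RB) (e a r K : R) :
  div_compatible q g E -> 0 < e < 1 -> 0 < a -> 0 < r ->
  (\int[mu2]_(X in `[(- r)%R, r]%classic `*` setT)
     (norm2 (truncated_field g e E X) ^+ 2)%:E <= K%:E)%E ->
  ((2 * @pi R * @bump R 0 * `|\int[g]_x @bump R (x / r) - \int[mu]_x @bump R (x / r)|)%:E <=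
   (8 / r)%:E * ((K / a + 4 * a * r ^+ 2)%:E +
                 32%:E * g `[(- (r + 1))%R, (r + 1)%R]%classic))%E.
Proof.
move=> [[mE _] dE] e01 a0 r0 TK.
have b0 : 0 < bump (0 : R) by rewrite bump_gt0// normr0.
have p0 : 0 < 2 * pi :> R by rewrite mulr_gt0// pi_gt0.
(* On the axis the test function is [bump 0] times the scaled bump, and [2 * pi] comes from the
   divergence equation. *)
have -> : 2 * @pi R * @bump R 0 * `|\int[g]_x @bump R (x / r) - \int[mu]_x @bump R (x / r)| =
    `|\int[mu2]_X ((E X).1 * partial1 (test_bump r) X + (E X).2 * partial2 (test_bump r) X)|.
  rewrite (dE _ (test_function_bump r0)) normrM (gtr0_norm p0) -mulrA; congr (_ * _).
  have bE (nu : {measure set RB -> \bar R}) :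
      \int[nu]_x test_bump r (x, 0) = bump 0 * \int[nu]_x @bump R (x / r).
    rewrite -Rintegral_scale//; last by move=> x; exact: bump_ge0.
    by apply: eq_Rintegral => x _; rewrite /test_bump /= mul0r mulrC.
  by rewrite !bE// -mulrBr normrM (gtr0_norm b0).
have mE1 : measurable_fun setT (fun X => (E X).1 : R).
  by move=> mT Y mY; exact: (measurableT_comp measurable_fst mE).
have mE2 : measurable_fun setT (fun X => (E X).2 : R).
  by move=> mT Y mY; exact: (measurableT_comp measurable_snd mE).
have mB := measurable_box r.
have mAB (w : RB * RB -> R) : measurable_fun setT w ->
    measurable_fun (box r) (fun X => `|w X|%:E).
  move=> mw; apply/measurable_EFinP; apply: measurable_funTS.
  exact: measurableT_comp.
have r40 : 0 < 4 / r by rewrite divr_gt0.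
pose h X := ((4 / r)%:E * (`|(E X).1|%:E + `|(E X).2|%:E))%E.
have h0 X : (0 <= h X)%E by rewrite mule_ge0 ?adde_ge0// lee_fin ltW.
apply: le_trans (_ : (\int[mu2]_X (h \_ (box r)) X <= _)%E).
  apply: (le_abs_Rintegral mu2) => X; rewrite /patch; case: ifPn => [_|/negP XB].
    have [d1 d2] := partial_test_bump_le X r0.
    rewrite /h -EFinD -EFinM lee_fin (le_trans (ler_normD _ _))// mulrDr !normrM.
    by apply: lerD; rewrite mulrC ler_wpM2r.
  have [|-> ->] := @partial_test_bump_out r X r0.
    by move=> /mem_set.
  by rewrite !mulr0 addr0 normr0.
rewrite -integral_mkcond (integral_scale mu2)//; last by move=> X _; rewrite adde_ge0.
have -> : ((8 / r)%:E = (4 / r)%:E * 2%:E)%E by rewrite -EFinM; congr EFin; lra.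
rewrite -muleA lee_pmul2l ?lte_fin//.
rewrite ge0_integralD//; [|exact: mAB|exact: mAB].
set B := (_ + _ * g _)%E.
suff bound (w z : RB * RB -> R) : measurable_fun setT w ->
    (forall X, (`|w X|%:E <= `|z X|%:E + singular_field g X)%E) ->
    (forall X, z X ^+ 2 <= norm2 (truncated_field g e E X) ^+ 2) ->
    (\int[mu2]_(X in box r) `|w X|%:E <= B)%E.
  rewrite (_ : 2%:E * B = B + B)%E; last by rewrite mule_natl mule2n.
  have T1 X := proj1 (truncated_field_split g E X e01).
  have T2 X := proj2 (truncated_field_split g E X e01).
  have N X : norm2 (truncated_field g e E X) ^+ 2 =
      (truncated_field g e E X).1 ^+ 2 + (truncated_field g e E X).2 ^+ 2.
    by rewrite sqr_sqrtr// addr_ge0 ?sqr_ge0.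
  apply: leeD.
    by apply: (bound _ _ mE1 T1) => X; rewrite N lerDl sqr_ge0.
  by apply: (bound _ _ mE2 T2) => X; rewrite N lerDr sqr_ge0.
move=> mw wz zT.
have QS : box r `<=` `[(- r)%R, r]%classic `*` setT by move=> X [].
apply: le_trans (integral_split_le mw (measurable_singular_field g)
  (singular_field_ge0 g) wz mB QS a0 _) _.
  apply: le_trans TK; apply: le_lower_integral => X _; rewrite lee_fin ?sqr_ge0//.
rewrite /B EFinD leeD//; last exact: integral_singular_field.
have -> : (4 * a * r ^+ 2)%:E = (a%:E * mu2 (box r))%E.
  by rewrite box_measure// -EFinM; congr EFin; ring.
by rewrite (mulrC a^-1).
Qed.

End flux_estimate.

(** * From finite energy to unit density of one configuration *)

Section density_of_finite_energy.
Context (R : realType).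
Local Notation RB := (measurableTypeR R).
Local Notation mu := (@lebesgue_measure R).
Local Notation mu2 := (mu \x mu)%E.

(** A single truncation level [e] is enough for the flux, since [ln e] is then a constant absorbed
    in [K]. *)
Lemma Wdiv_conf_lty (q : R) (g : conf R) : (Wdiv_conf q g < +oo)%E ->
  exists (E : RB * RB -> RB * RB) (e K r0 : R),
  [/\ div_compatible q g E, 0 < e < 1, 0 < r0 & forall r, r0 <= r ->
    (\int[mu2]_(X in `[(- r)%R, r]%classic `*` setT)
       (norm2 (truncated_field g e E X) ^+ 2)%:E <= (K * r)%:E)%E].
Proof.
move=> /ereal_inf_lt[l [E [dE cE]] loo].
(* The limit [l] may be [-oo], in which case any real [C] will do. *)
have [C lC] : exists C : R, (l < C%:E)%E.
  case: l loo {cE} => [l| |]// _; last by exists 0; rewrite ltNyr.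
  by exists (l + 1); rewrite lte_fin ltrDl.
have [e [e0 e1 eC]] : exists e : R, [/\ 0 < e, e < 1 &
    (limf_esup (strip_energy g E e) (pinfty_nbhs R) < C%:E)%E].
  have nC : nbhs l [set y | (y < C%:E)%E].
    by apply: open_nbhs_nbhs; split => //; exact: open_ereal_lt_ereal.
  have : \forall e \near (0:R)^'+, [/\ 0 < e, e < 1 &
      (limf_esup (strip_energy g E e) (pinfty_nbhs R) < C%:E)%E].
    near=> e; split; [by []|by near: e; exact: nbhs_right_lt|].
    by near: e; exact: (cE _ nC).
  by move=> /filter_ex.
move: eC => /ereal_inf_lt[_ [A [M [_ MA]] <-]] supC.
(* Solving [J / (2 r * 2 pi) + ln e <= C] for [J] gives the constant. The bound on [r] must exceed
   [M] strictly and keep [r] positive. *)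
exists E, e, ((C - ln e) * (4 * pi)), (Num.max (M + 1) 1).
split=> //; [by rewrite e0|by rewrite lt_max ltr01 orbT|] => r.
rewrite ge_max => /andP[Mr r1].
have r0 : 0 < r := lt_le_trans ltr01 r1.
have : (strip_energy g E e r < C%:E)%E.
  apply: le_lt_trans supC; apply: ereal_sup_ubound; exists r => //.
  by apply: MA; rewrite (lt_le_trans _ Mr)// ltrDl.
rewrite /strip_energy; set J := (integral _ _ _).
have k0 : 0 < (2 * r)^-1 * (2 * pi)^-1 by rewrite mulr_gt0// invr_gt0 mulr_gt0// pi_gt0.
move=> /ltW; rewrite -leeBrDr// -EFinB -lee_pdivlMl// => /le_trans; apply.
rewrite -EFinM lee_fin le_eqVlt; apply/orP; left; apply/eqP.
have pine0 : (pi : R) != 0 by rewrite gt_eqF ?pi_gt0.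
by move: (pi : R) pine0 => p p0; field; rewrite p0 gt_eqF.
Unshelve. all: by end_near. Qed.

(** Scale [c = m] before compression corresponds to scale [c = 1] after it. *)
Definition dyadic (c k : nat) : R := c%:R * 2 ^+ k.

Lemma dyadic_gt0 c k : (0 < c)%N -> 0 < dyadic c k.
Proof. by move=> c0; rewrite mulr_gt0 ?exprn_gt0// ltr0n. Qed.

(** With [r = dyadic c k], the weight [4 ^- k] is [c ^ 2 / r ^ 2]: up to a constant, the truncation
    error of the flux divided by [r]. *)
Definition window_term (c k : nat) (g : conf R) : \bar R :=
  ((4^-1 ^+ k)%:E * g `[(- (dyadic c k + 1))%R, (dyadic c k + 1)%R]%classic)%E.

Lemma window_term_ge0 c k g : (0 <= window_term c k g)%E.
Proof. by rewrite mule_ge0// lee_fin exprn_ge0// invr_ge0. Qed.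

(* A measurable event of full probability under any intensity, on which the
   truncation errors at scale [dyadic c k] are [o(4^k)]. *)
Definition subquadratic (c : nat) : set (conf R) :=
  [set g | (\sum_(k <oo) window_term c k g < +oo)%E].

Lemma subquadratic_cvg c g : subquadratic c g ->
  fine (window_term c k g) @[k --> \oo] --> 0.
Proof.
have E k : window_term c k g = (fine (window_term c k g))%:E.
  rewrite fineK// fin_numM//; apply: conf_fin_num; first exact: measurable_itv.
  exact: bounded_itv.
rewrite /subquadratic /= => gc; apply: cvg_series_cvg_0; apply: nnseries_is_cvg => [k|].
  by rewrite fine_ge0 ?window_term_ge0.
by rewrite -(eq_eseriesr (fun k _ => E k)).
Qed.

Definition bump_mean (c k : nat) (g : conf R) : R :=
  (dyadic c k)^-1 * \int[g]_x @bump R (x / dyadic c k).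

Lemma dyadic_near c (M : R) : (0 < c)%N -> \forall k \near \oo, M <= dyadic c k.
Proof.
move=> c0; near=> k.
apply: (@le_trans _ _ k%:R).
  rewrite (le_trans (ltW (truncnS_gt M)))// ler_nat; near: k.
  exact: nbhs_infty_ge.
rewrite /dyadic -natrX -natrM ler_nat (leq_trans (ltnW (ltn_expl k (isT : (1 < 2)%N))))//.
by rewrite leq_pmull.
Unshelve. all: by end_near. Qed.

Lemma Rintegral_bump_scale (r : R) : 0 < r ->
  \int[mu]_x @bump R (x / r) = r * \int[mu]_x bump x.
Proof.
move=> r0; have rne := lt0r_neq0 r0.
rewrite -Rintegral_scale//; last by move=> x; exact: bump_ge0.
rewrite /Rintegral; congr fine.
pose nu : {measure set RB -> \bar R} := mscale (NngNum (ltW r0)) mu.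
transitivity (\int[nu]_x (@bump R x)%:E)%E.
  apply/esym.
  apply: (@integral_image_bij _ _ RB RB R mu nu (fun x : RB => (x : R) / r : RB)
    (fun x : RB => (x : R) / r^-1 : RB) setT).
  - exact: measurable_scale.
  - exact: measurable_scale.
  - by move=> x; rewrite invrK divfK.
  - by move=> x; rewrite invrK mulfK.
  - by move=> B mB; apply/esym; exact: lebesgue_measure_scale.
rewrite ge0_integral_mscale//.
- under [RHS]eq_integral do rewrite EFinM.
  by rewrite integral_scale// => x _; rewrite lee_fin bump_ge0.
- by apply/measurable_EFinP; exact: measurable_bump.
- by move=> x _; rewrite lee_fin bump_ge0.
Qed.

Lemma Rintegral_bump_gt0 : 0 < \int[mu]_x @bump R x.
Proof.
have b0 x : (0 <= (@bump R x)%:E)%E by rewrite lee_fin bump_ge0.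
have upper : (\int[mu]_x (@bump R x)%:E <= 2%:E)%E.
  apply: (@le_trans _ _ (\int[mu]_(x in `[(-1)%R, 1%R]%classic) 1%:E)%E).
    rewrite [leRHS]integral_mkcond; apply: le_lower_integral => // x _.
    rewrite /patch; case: ifPn => [_|/negP x1]; first by rewrite lee_fin bump_le1.
    rewrite bump_out// leNgt; apply/negP => /ltW; rewrite ler_norml => x2.
    by apply: x1; apply: mem_set; rewrite /= in_itv.
  rewrite integral_cst//= mul1e lebesgue_measure_itv/= lte_fin gtrN// -EFinB lee_fin.
  by lra.
(* On [[- 1 / 2, 1 / 2]], an interval of length one, both arguments of [flat 0] are at least
   [1 / 2], where [flat 0] is at least [exp (- 2)]. *)
have lower : ((expR (-2) * expR (-2))%:E <= \int[mu]_x (@bump R x)%:E)%E.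
  apply: (@le_trans _ _ (\int[mu]_(x in `[(- 2^-1)%R, 2^-1%R]%classic)
      (expR (-2) * expR (-2))%:E)%E).
    rewrite integral_cst//= lebesgue_measure_itv/= lte_fin gtrN ?invr_gt0//.
    rewrite -EFinB -EFinM lee_fin ler_peMr ?mulr_ge0 ?expR_ge0//; lra.
  rewrite integral_mkcond; apply: le_lower_integral => x _.
    by apply: erestrict_ge0 => y _; rewrite lee_fin mulr_ge0 ?expR_ge0.
  rewrite /patch; case: ifPn => // /set_mem; rewrite /= in_itv/= => /andP[x1 x2].
  have fl (y : R) : 2^-1 <= y -> expR (-2) <= flat 0 y.
    move=> y1; have y0 : 0 < y by apply: lt_le_trans y1; rewrite invr_gt0.
    by rewrite /flat y0 expr0 mul1r ler_expR lerN2 invf_ple ?posrE.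
  by rewrite lee_fin ler_pM ?expR_ge0// fl//; lra.
rewrite fine_gt0//; apply/andP; split.
  by apply: lt_le_trans lower; rewrite lte_fin mulr_gt0 ?expR_gt0.
exact: le_lt_trans upper (ltey _).
Qed.

Lemma finite_energy_density (q : R) (c : nat) (g : conf R) : (0 < c)%N ->
  (Wdiv_conf q g < +oo)%E -> subquadratic c g ->
  bump_mean c k g @[k --> \oo] --> \int[mu]_x @bump R x.
Proof.
move=> c0 /Wdiv_conf_lty[E [e [K [r0 [dE e01 r00 EK]]]]] gc.
set I := \int[mu]_x _.
have p0 : 0 < 2 * @pi R * bump 0.
  by rewrite mulr_gt0 ?bump_gt0 ?normr0// mulr_gt0// pi_gt0.
move: p0; set D := 2 * pi * _ => D0.
apply/cvgrPdist_le => ep ep0.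
have Dep : 0 < D * ep / 3 by rewrite divr_gt0// mulr_gt0.
(* Divided by [r], the three errors are [8 K / (a r)], [32 a] and [256 N / r ^ 2], with [N] the
   number of points in the window. Each may use [D * ep / 3], which fixes [a]; the other two are
   small for large [k]. *)
pose a := D * ep / 96; have a0 : 0 < a by rewrite divr_gt0// mulr_gt0.
have c2 : 0 < (c%:R : R) ^+ 2 by rewrite exprn_gt0// ltr0n.
have s0 : 0 < D * ep / 3 * c%:R ^+ 2 / 256 by rewrite divr_gt0// mulr_gt0.
near=> k.
have r0r : r0 <= dyadic c k by near: k; exact: dyadic_near.
have rK : 8 * K / a / (D * ep / 3) <= dyadic c k by near: k; exact: dyadic_near.
have small : fine (window_term c k g) <= D * ep / 3 * c%:R ^+ 2 / 256.
  near: k; have /cvgrPdist_le/(_ _ s0) := subquadratic_cvg gc.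
  apply: filterS => n; rewrite sub0r normrN.
  by move=> /(le_trans (ler_norm _)).
set r := dyadic c k in r0r rK *; have rp : 0 < r by exact: dyadic_gt0.
have flux := flux_estimate dE e01 a0 rp (EK r r0r).
pose N := g `[(- (r + 1))%R, (r + 1)%R]%classic.
have NE : N = (fine N)%:E.
  by rewrite fineK//; apply: conf_fin_num; [exact: measurable_itv|exact: bounded_itv].
have wE : fine (window_term c k g) = c%:R ^+ 2 * (fine N / r ^+ 2).
  rewrite /window_term -/r -/N NE -EFinM /= /r /dyadic exprMn.
  have -> : 4^-1 ^+ k = ((2 ^+ k) ^+ 2)^-1 :> R.
    by rewrite exprVn -exprM mulnC exprM expr2 -natrM.
  field; rewrite expf_neq0//= pnatr_eq0 -lt0n c0//.
rewrite -/N NE -EFinM lee_fin (Rintegral_bump_scale rp) -/D -/I in flux.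
have -> : I - bump_mean c k g = - (r^-1 * (\int[g]_x bump (x / r) - r * I)).
  by rewrite /bump_mean -/r mulrBr mulKf ?lt0r_neq0// opprB.
rewrite normrN normrM gtr0_norm ?invr_gt0//.
rewrite -(ler_pM2l D0) mulrCA -ler_pdivlMl ?invr_gt0// invrK.
apply: le_trans flux _.
have h1 : 8 * K / a <= r * (D * ep / 3) by rewrite -ler_pdivrMr.
have h3 : fine N / r ^+ 2 <= D * ep / 3 / 256.
  rewrite -(ler_pM2l c2) -wE (le_trans small)// le_eqVlt.
  by apply/orP; left; apply/eqP; ring.
have -> : 8 / r * (K * r / a + 4 * a * r ^+ 2 + 32 * fine N) =
    8 * K / a + 32 * a * r + 256 * (r * (fine N / r ^+ 2)).
  by field; rewrite !lt0r_neq0.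
have -> : 32 * a * r = r * (D * ep / 3) by rewrite /a; field.
rewrite -(ler_pM2l rp) [leRHS]mulrA in h3; move: h1 h3.
have -> : r * (D * ep) = 3 * (r * (D * ep / 3)) by field.
move: (r * (D * ep / 3)) (r * (fine N / r ^+ 2)) (8 * K / a) => t x y; lra.
Unshelve. all: by end_near. Qed.

End density_of_finite_energy.

(** * Density of points under a law and infinite energy *)

Section density.
Context (R : realType).
Local Notation RB := (measurableTypeR R).
Local Notation mu := (@lebesgue_measure R).
Implicit Types (g : conf R) (P : probability (conf R) R).

(** A measurable event through which finiteness of the energy is compared under different laws. *)
Definition unit_density (c : nat) : set (conf R) :=
  [set g | bump_mean c k g @[k --> \oo] --> \int[mu]_x @bump R x].

Lemma measurable_bump_mean c k : (0 < c)%N ->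
  measurable_fun setT (fun g => bump_mean c k g).
Proof.
move=> c0; pose f : Cc R := exist _ _ (bump_scaled_Cc (dyadic_gt0 R k c0)).
rewrite (_ : (fun g => _) = fun g => (dyadic R c k)^-1 * vague_eval g f)//.
by apply: measurable_funM => //; exact: measurable_vague_eval.
Qed.

Lemma measurable_unit_density c : (0 < c)%N -> measurable (unit_density c).
Proof.
move=> c0; set I := \int[mu]_x @bump R x.
rewrite (_ : unit_density c = \bigcap_n \bigcup_N \bigcap_k
    (if (N <= k)%N then (fun g => I - bump_mean c k g) @^-1`
       [set x | `|x| <= n.+1%:R^-1] else setT)).
  apply: bigcapT_measurable => n; apply: bigcupT_measurable => N.
  apply: bigcapT_measurable => k; case: ifP => // _.
  rewrite -[X in measurable X]setTI.
  have mX : measurable_fun setT (fun g => I - bump_mean c k g).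
    by apply: measurable_funB => //; exact: measurable_bump_mean.
  apply: mX => //; rewrite (_ : [set x | _] = `[- n.+1%:R^-1, n.+1%:R^-1]%classic).
    exact: measurable_itv.
  by apply/seteqP; split=> x /=; rewrite in_itv/= ler_norml.
apply/seteqP; split=> g.
  move=> /cvgrPdist_le gI n _.
  have [|N _ hN] := gI n.+1%:R^-1; first by rewrite invr_gt0.
  by exists N => // k _; case: ifP => // Nk; exact: hN.
move=> gI; apply/cvgrPdist_le => e e0.
have [N _ hN] := gI (Num.truncn e^-1) Logic.I.
exists N => // k /= Nk; have := hN k Logic.I; rewrite Nk /= => /le_trans; apply.
by rewrite invf_ple ?posrE// ltW// truncnS_gt.
Qed.

Lemma measurable_window_term c k : measurable_fun setT (window_term (R := R) c k).
Proof. by apply: measurable_funeM; apply: measurable_eval; exact: measurable_itv. Qed.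

Lemma measurable_window_sum c :
  measurable_fun setT (fun g => \sum_(k <oo) window_term c k g)%E.
Proof.
apply: ge0_emeasurable_sum => [k g _ _|k _]; first exact: window_term_ge0.
exact: measurable_window_term.
Qed.

Lemma subquadraticCE c : ~` subquadratic c =
  (fun g => \sum_(k <oo) window_term c k g)%E @^-1` [set +oo%E].
Proof.
apply/seteqP; split=> g; rewrite /subquadratic /=.
  by move=> /negP; rewrite -leNgt leye_eq => /eqP.
by move=> ->.
Qed.

Lemma measurable_subquadraticC c : measurable (~` @subquadratic R c).
Proof.
rewrite subquadraticCE -[X in measurable X]setTI.
exact: measurable_window_sum.
Qed.

Lemma subquadratic_ae (lambda : R) c P : (0 < c)%N -> has_intensity lambda P ->
  P (~` subquadratic c) = 0%E.
Proof.
move=> c0 intP.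
apply: (@integral_pinfty_null _ _ _ _ (fun g => \sum_(k <oo) window_term c k g)%E).
- exact: measurable_subquadraticC.
- by move=> g; rewrite subquadraticCE.
have t0 k g : (0 <= window_term c k g)%E by exact: window_term_ge0.
apply/andP; split.
  apply: (lt_le_trans ltNy0); apply: integral_ge0 => g _.
  by apply: nneseries_ge0 => k _ _.
rewrite integral_nneseries//; last by move=> k; exact: measurable_window_term.
(* The window has length [2 (c 2 ^ k + 1) <= 4 c 2 ^ k], so the expected term is at most
   [4 c |lambda| 2 ^- k], which is summable. *)
have M0 : 0 <= 4 * c%:R * `|lambda| by rewrite !mulr_ge0.
apply: le_lt_trans (le_trans (lee_nneseries (v := fun k => (4 * c%:R * `|lambda| * 2^-1 ^+ k)%:E) _ _)
  (geometric_half_le M0)) (ltey _) => [k _ _|k _]; first exact: integral_ge0.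
have kw : 0 < 4^-1 ^+ k :> R by rewrite exprn_gt0// invr_gt0.
rewrite integral_scale// intP; [|exact: measurable_itv|exact: bounded_itv].
have d1 : 1 <= dyadic R c k by rewrite /dyadic -natrX -natrM ler1n muln_gt0 c0 expn_gt0.
rewrite lebesgue_measure_itv/= lte_fin gtrN; last by lra.
rewrite -EFinB -!EFinM lee_fin.
apply: (@le_trans _ _ (4^-1 ^+ k * (`|lambda| * (4 * dyadic R c k)))).
  rewrite ler_pM2l//.
  apply: (@le_trans _ _ (`|lambda| * (dyadic R c k + 1 - - (dyadic R c k + 1)))).
    by apply: ler_wpM2r; [lra|exact: ler_norm].
  by apply: ler_wpM2l => //; lra.
have e1 : 4^-1 ^+ k = 2^-1 ^+ k * 2^-1 ^+ k :> R.
  by rewrite -exprMn; congr (_ ^+ _); field.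
have e2 : 2^-1 ^+ k * 2 ^+ k = 1 :> R by rewrite -exprMn mulVf ?expr1n.
rewrite e1 /dyadic le_eqVlt; apply/orP; left; apply/eqP.
move: (2^-1 ^+ k) (2 ^+ k) e2 `|lambda| => u v uv l.
by transitivity (4 * c%:R * l * u * (u * v)); [ring|rewrite uv mulr1].
Qed.

(** A subquadratic configuration without unit density has energy [+oo], and a finite integral forces
    the measurable event of all these to be null. *)
Lemma finite_energy_ae (q lambda : R) c P : (0 < c)%N -> has_intensity lambda P ->
  (-oo < Wdiv q P < +oo)%E -> P (~` unit_density c) = 0%E.
Proof.
move=> c0 intP WP; have mD := measurable_unit_density c0.
have mQ := measurable_subquadraticC c.
have mA : measurable (subquadratic c `\` unit_density c).
  by apply: measurableD => //; rewrite -[subquadratic c]setCK; exact: measurableC.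
have A0 : P (subquadratic c `\` unit_density c) = 0%E.
  apply: integral_pinfty_null mA _ WP => g [gQ gD].
  apply/eqP; rewrite -leye_eq leNgt; apply/negP => /(finite_energy_density c0).
  by move=> /(_ gQ).
apply/eqP; rewrite eq_le measure_ge0 andbT.
have -> : 0%E = (P (subquadratic c `\` unit_density c) + P (~` subquadratic c))%E.
  by rewrite A0 (subquadratic_ae c0 intP) adde0.
apply: le_trans (measureU2 _ mA mQ); apply: le_measure; rewrite ?inE//.
- exact: measurableC.
- exact: measurableU.
- by move=> g gD; have [gQ|gQ] := pselect (subquadratic c g); [left|right].
Qed.

(** Here the same event carries full probability, so the energy is [+oo] almost surely. *)
Lemma infinite_energy (q lambda : R) c P : (0 < c)%N -> has_intensity lambda P ->
  P (unit_density c) = 0%E -> Wdiv q P = +oo%E.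
Proof.
move=> c0 intP PD; have mD := measurable_unit_density c0.
have mQ := measurable_subquadraticC c.
have mA : measurable (subquadratic c `\` unit_density c).
  by apply: measurableD => //; rewrite -[subquadratic c]setCK; exact: measurableC.
have AC : P (~` (subquadratic c `\` unit_density c)) = 0%E.
  apply/eqP; rewrite eq_le measure_ge0 andbT.
  have -> : 0%E = (P (~` subquadratic c) + P (unit_density c))%E.
    by rewrite PD (subquadratic_ae c0 intP) adde0.
  apply: le_trans (measureU2 _ mQ mD); apply: le_measure; rewrite ?inE//.
  - exact: measurableC.
  - exact: measurableU.
  - by rewrite setCD.
have A0 : (0 < P (subquadratic c `\` unit_density c))%E.
  by have := probability_setC P (measurableC mA); rewrite setCK AC sube0 => ->.
apply: (integral_pinfty_ae mA A0 AC).
move=> g [gQ gD]; apply/eqP; rewrite -leye_eq leNgt; apply/negP.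
by move=> /(finite_energy_density c0)/(_ gQ).
Qed.

Lemma bump_mean_compress m (hm : (1 < m)%N) k g :
  bump_mean 1 k (conf_compress hm g) = m%:R * bump_mean m k g.
Proof.
have m0 : (m%:R : R) != 0 by rewrite pnatr_eq0; case: m hm.
have E := compressE hm g (exist _ _ (bump_scaled_Cc (dyadic_gt0 R k (isT : (0 < 1)%N)))).
rewrite /bump_mean; transitivity ((dyadic R 1 k)^-1 * \int[g]_x @bump R (x / m%:R / dyadic R 1 k)).
  by congr (_ * _); exact: E.
have dE : dyadic R m k = m%:R * dyadic R 1 k by rewrite /dyadic mul1r.
rewrite dE mulrA; congr (_ * _).
  have := lt0r_neq0 (dyadic_gt0 R k (isT : (0 < 1)%N)).
  by move: (dyadic R 1 k) => d d0; rewrite invfM mulVKf.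
by apply: eq_Rintegral => x _; move: (dyadic R 1 k) => d; rewrite invfM mulrA.
Qed.

Lemma compressed_infinite_energy (q : R) m (hm : (1 < m)%N) P : has_intensity 1 P ->
  (-oo < Wdiv q P < +oo)%E -> Wdiv q (compressed_law hm P) = +oo%E.
Proof.
move=> intP WP; have m0 : (0 < m)%N by case: m hm.
(* Scale [c = 1] for the compressed law is compared with scale [c = m] for [P]. If both means
   converged to that of Lebesgue measure, its positive value would equal [m] times itself. *)
apply: (@infinite_energy q m%:R 1) => //; first exact: compressed_intensity.
have mD1 := measurable_unit_density (isT : (0 < 1)%N).
apply/eqP; rewrite eq_le measure_ge0 andbT -(finite_energy_ae m0 intP WP).
apply: (@le_measure _ _ _ P); rewrite ?inE.
- by rewrite -[X in measurable X]setTI; exact: measurable_conf_compress.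
- by apply: measurableC; exact: measurable_unit_density.
move=> g /= g1 gm.
have I0 := Rintegral_bump_gt0 R.
have : bump_mean 1 k (conf_compress hm g) @[k --> \oo] --> m%:R * \int[mu]_x @bump R x.
  under eq_fun do rewrite bump_mean_compress.
  by apply: cvgM => //; exact: cvg_cst.
move=> /(cvg_lim (@Rhausdorff R)); rewrite (cvg_lim (@Rhausdorff R) g1).
move=> /eqP; rewrite -[X in X == _]mul1r (inj_eq (mulIf (lt0r_neq0 I0))).
by rewrite eq_sym pnatr_eq1 gtn_eqF.
Qed.

Lemma vacuum_infinite_energy (q : R) : Wdiv q (vacuum R) = +oo%E.
Proof.
apply: (@infinite_energy q 0 1) => //; first exact: vacuum_intensity.
have nD : ~ unit_density 1 (conf0 R).
  have E : (fun k => bump_mean 1 k (conf0 R)) = fun=> 0.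
    apply/funext => k; rewrite /bump_mean /Rintegral.
    by rewrite (@integral_measure_zero _ RB R setT) mulr0.
  rewrite /unit_density /= E => /(cvg_lim (@Rhausdorff R)); rewrite lim_cst//.
  by move=> I0; have := Rintegral_bump_gt0 R; rewrite -I0 ltxx.
by rewrite [LHS]diracE memNset.
Qed.

End density.

Theorem proposition9p3 (R : realType) (beta q : R)
    (hbeta : 0 < beta) (hq : 1 < q < 2) :
  (forall S : probability (conf R) R,
    is_Sine beta S ->
    stationary S ->
    has_intensity 1 S ->
    canonical_DLR beta S ->
    (-oo < Wdiv q S < +oo)%E ->
    ~ same_law (vacuum R) S /\
    forall (m : nat) (hm : (1 < m)%N),
      [/\ stationary (compressed_law hm S),
          {ae compressed_law hm S, forall g, simple_conf g},
          canonical_DLR beta (compressed_law hm S) &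
          has_intensity m%:R (compressed_law hm S)] /\
      [/\ ~ same_law (compressed_law hm S) S,
          Wdiv q (compressed_law hm S) = +oo%E &
          ~ same_law (vacuum R) (compressed_law hm S)]) /\
  [/\ stationary (vacuum R),
      canonical_DLR beta (vacuum R) &
      Wdiv q (vacuum R) = +oo%E].
Proof.
split; last first.
  split; [exact: vacuum_stationary|exact: vacuum_DLR|exact: vacuum_infinite_energy].
move=> S _ statS intS DLR WS; split=> [|m hm].
  have n01 : (0 : R) != 1 by rewrite eq_sym oner_eq0.
  exact: (intensity_neq_law (@vacuum_intensity R) intS n01).
have m0 : (m%:R : R) != 0 by rewrite pnatr_eq0; case: m hm.
have intP := compressed_intensity hm intS.
have DLRP := compressed_DLR hm hbeta DLR.
split; split=> //.
- exact: compressed_stationary.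
- exact: DLR_simple DLRP.
- by apply: (intensity_neq_law intP intS); rewrite pnatr_eq1 gtn_eqF.
- exact: compressed_infinite_energy.
- by apply: (intensity_neq_law (@vacuum_intensity R) intP); rewrite eq_sym.
Qed.
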